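(* In the 2D network, let for $x>0$ $$g_{\mathsf L}(x)=p_{\mathsf L}(x)\exp\Big(-\lambda\int_0^{2\pi}\int_0^{x}\frac{p_{\mathsf L,\mathsf L}(x,t,\theta)}{p_{\mathsf L}(x)}t\,dt\,d\theta-\lambda\int_0^{2\pi}\int_0^{e_{\mathsf N|\mathsf L}(x)}\frac{p_{\mathsf L,\mathsf N}(x,t,\theta)}{p_{\mathsf L}(x)}t\,dt\,d\theta\Big).$$ Then $g_{\mathsf L}(x)$ decreases when the blocking correlation increases: if two blockage environments have the same $\beta$ and $p^{(1)}_{\mathsf L,\mathsf L}\le p^{(2)}_{\mathsf L,\mathsf L}$ pointwise, then $g^{(1)}_{\mathsf L}(x)\ge g^{(2)}_{\mathsf L}(x)$. Further, $\underline{g_{\mathsf L}}(x)\le g_{\mathsf L}(x)\le\overline{g_{\mathsf L}}(x)$, where $$\overline{g_{\mathsf L}}(x)=\exp\Big(-\beta x-\lambda\pi\, e_{\mathsf N|\mathsf L}(x)^2-\frac{2\pi\lambda}{\beta^2}\big(F_1(e_{\mathsf N|\mathsf L}(x))-F_1(x)\big)\Big),$$ $$\underline{g_{\mathsf L}}(x)=e^{-\beta x}\exp\Big(-\lambda\pi\, e_{\mathsf N|\mathsf L}(x)^2-4\lambda\int_{e_{\mathsf N|\mathsf L}(x)}^x\int_0^{\pi/2}t\,e^{-\beta t\sin^2\theta}\,d\theta\,dt\Big)$$ $$\qquad=\exp\Big(-\beta x-\lambda\pi\, e_{\mathsf N|\mathsf L}(x)^2-\frac13\,\frac{2\pi\lambda}{\beta}\big[F(x,\beta)-F(e_{\mathsf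 N|\mathsf L}(x),\beta)\big]\Big),$$ with $F_1(z)=(1+\beta z)e^{-\beta z}$ and $F(r,\beta)=r e^{-\beta r/2}\big(\beta r\,\mathsf I_0(\beta r/2)+(\beta r+2)\,\mathsf I_1(\beta r/2)\big)$. Here $\overline{g_{\mathsf L}}(x)$ is the value of $g_{\mathsf L}(x)$ under independent blocking and $\underline{g_{\mathsf L}}(x)$ is its value in the maximally correlated case.
   Context: 2D network. Base stations have density $\lambda>0$ (homogeneous Poisson point process (PPP) on $\mathbb R^2$), with the typical user at the origin. Blockages form a Boolean model of line segments: centers form a homogeneous PPP of density $\mu>0$, with i.i.d. random lengths $L$ ($0<\mathbb E[L]<\infty$) and independent orientations uniform on $[0,\pi]$; $\beta=2\mu\mathbb E[L]/\pi$. A link of length $r$ from the origin is LoS if no blockage intersects it, with probability $p_{\mathsf L}(r)=e^{-\beta r}$, and NLoS otherwise. For two links from the origin of lengths $r_1,r_2$ with directions differing by $\theta\in[0,2\pi]$, $p_{\mathsf L,\mathsf L}(r_1,r_2,\theta)$ is the probability that no blockage intersects either of them, and $p_{\mathsf L,\mathsf N}(r_1,r_2,\theta)=e^{-\beta r_1}-p_{\mathsf L,\mathsf L}(r_1,r_2,\theta)$ is the probability that the first is LoS and the second is NLoS. Independent blocking means that $p_{\mathsf L,\mathsf L}(r_1,r_2,\theta)$ is replaced by $e^{-\beta r_1-\beta r_2}$. The maximally correlated case (blockages tending to infinite length with $\beta$ fixed) means that $p_{\mathsf L,\mathsf L}(r_1,r_2,\theta)$ is replaced by the upper bound $\exp\big(-\beta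 r_1-\beta r_2+\tfrac12\min(r_1,r_2)\beta(1+\cos\theta)\big)$. In both cases $p_{\mathsf L,\mathsf N}=e^{-\beta r_1}-p_{\mathsf L,\mathsf L}$. Path loss: $\ell_{\mathsf L},\ell_{\mathsf N}:[0,\infty)\to[0,\infty)$ are bounded and nonincreasing with $\ell_{\mathsf L}\ge\ell_{\mathsf N}$, and $e_{\mathsf N|\mathsf L}(x)=\min\{y\ge0:\ell_{\mathsf N}(y)\le\ell_{\mathsf L}(x)\}$ (min read as infimum), with $e_{\mathsf N|\mathsf L}(x)<x$ for $x>0$. $\mathsf I_n$ is the modified Bessel function of the first kind of order $n$. *)

(* Defs.v *)
From HB Require Import structures.
From mathcomp Require Import all_boot all_order all_algebra.
From mathcomp Require Import all_classical all_reals all_analysis.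
Set Implicit Arguments.
Unset Strict Implicit.
Unset Printing Implicit Defensive.
Import Order.TTheory GRing.Theory Num.Theory.
Import numFieldNormedType.Exports.
Local Open Scope classical_set_scope.
Local Open Scope ring_scope.

Notation plane R := (measurableTypeR R * measurableTypeR R)%type.

Definition area (R : realType) : set (plane R) -> \bar R :=
  (@lebesgue_measure R \x @lebesgue_measure R)%E.

(* A point process on the plane is given by a random enumeration [X] of its
   points; the number of points in [B] is counted with multiplicity. *)
Definition count_is (R : realType) (Omega : Type) (X : nat -> Omega -> plane R)
    (B : set (plane R)) (k : nat) : set Omega :=
  [set w | ([set n | B (X n w)] #= `I_k)%card].

(* Finite-dimensional distributions: the counts of pairwise disjoint Borel sets
   of finite area are independent, with Poisson laws of parameter [mu * area].
   The library's [poisson_pmf] is not used because it is constantly 1 at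
   rate 0, whereas a null set contains no point almost surely. *)
Definition homogeneous_PPP (R : realType) (d : measure_display)
    (Omega : measurableType d) (P : probability Omega R) (mu : R)
    (X : nat -> Omega -> plane R) : Prop :=
  forall (m : nat) (B : 'I_m -> set (plane R)) (k : 'I_m -> nat),
    (forall i, measurable (B i)) ->
    (forall i, (area (B i) < +oo)%E) ->
    trivIset setT B ->
    P (\bigcap_(i in [set: 'I_m]) count_is X (B i) (k i)) =
    (\prod_(i < m) (expR (- (mu * fine (area (B i)))) *
                    (mu * fine (area (B i))) ^+ k i / (k i)`!%:R))%:E.

Definition sigma_of_seq (d d' : measure_display) (Omega : measurableType d)
    (T : measurableType d') (X : nat -> Omega -> T) : set (set Omega) :=
  <<s [set A | exists n B, measurable B /\ A = X n @^-1` B] >>.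

(* The whole sequence of centers, each length and each orientation are
   mutually independent; subfamilies are covered by taking [A n] or [B n] to be
   [setT]. *)
Definition independent_marking (R : realType) (d : measure_display)
    (Omega : measurableType d) (P : probability Omega R)
    (X : nat -> Omega -> plane R) (L phi : nat -> Omega -> R) : Prop :=
  forall (E : set Omega) (N : nat) (A B : nat -> set R),
    sigma_of_seq X E ->
    (forall n, measurable (A n)) -> (forall n, measurable (B n)) ->
    fine (P (E `&` \bigcap_(n in `I_N) (L n @^-1` A n `&` phi n @^-1` B n))) =
    fine (P E) *
    \prod_(n < N) (fine (P (L n @^-1` A n)) * fine (P (phi n @^-1` B n))).

(* Boolean model of line segments.  Since the intensity is positive, the
   process of centers has infinitely many points almost surely, so that it can
   be enumerated by [nat]. *)
Record blockage_env (R : realType) (d : measure_display)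
    (Omega : measurableType d) (P : probability Omega R) := BlockageEnv {
  density : R;
  center : nat -> {mfun Omega >-> plane R};
  len : nat -> {RV P >-> R};
  orient : nat -> {RV P >-> R};
  density_gt0 : 0 < density;
  center_PPP : homogeneous_PPP P density (fun n => center n);
  marks_indep : independent_marking P
    (fun n => center n) (fun n => len n) (fun n => orient n);
  len_ge0 : forall n w, 0 <= len n w;
  len_ident : forall n (A : set R), measurable A ->
    distribution P (len n) A = distribution P (len 0%N) A;
  len_mean_gt0 : (0 < 'E_P[len 0%N])%E;
  len_mean_fin : ('E_P[len 0%N] < +oo)%E;
  orient_unif : forall n (A : set R), measurable A ->
    distribution P (orient n) A = uniform_prob (pi_gt0 R) A }.

Definition blockage (R : realType) (c : plane R) (l a : R) : set (plane R) :=
  [set (c.1 + s * cos a, c.2 + s * sin a) | s in `[- (l / 2), l / 2]].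

Definition link (R : realType) (r theta : R) : set (plane R) :=
  [set (s * cos theta, s * sin theta) | s in `[0, r]].

Section Environment.
Context (R : realType) (d : measure_display) (Omega : measurableType d).
Context (P : probability Omega R) (E : blockage_env P).

Definition beta : R := 2 * density E * fine 'E_P[len E 0%N] / pi.

Definition LoS (r theta : R) : set Omega :=
  [set w | forall n,
     blockage (center E n w) (len E n w) (orient E n w) `&` link r theta = set0].

(* The model is isotropic: the direction of the first link is taken as the
   reference direction. *)
Definition pL (r : R) : R := fine (P (LoS r 0)).
Definition pLL (r1 r2 theta : R) : R := fine (P (LoS r1 0 `&` LoS r2 theta)).
Definition pLN (r1 r2 theta : R) : R := fine (P (LoS r1 0 `\` LoS r2 theta)).

End Environment.

Definition path_loss (R : realType) (l : R -> R) : Prop :=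
  [/\ forall x : R, 0 <= x -> 0 <= l x,
      exists M, forall x : R, 0 <= x -> l x <= M
    & forall x y : R, 0 <= x -> x <= y -> l y <= l x].

Definition eNL (R : realType) (lL lN : R -> R) (x : R) : R :=
  inf [set y | 0 <= y /\ lN y <= lL x].

Definition gL_of (R : realType) (lambda : R) (pL : R -> R)
    (pLL pLN : R -> R -> R -> R) (e : R -> R) (x : R) : R :=
  pL x * expR
   (- (lambda * \int[lebesgue_measure]_(theta in `[0, 2 * pi])
                  \int[lebesgue_measure]_(t in `[0, x])
                    (pLL x t theta / pL x * t))
    - lambda * \int[lebesgue_measure]_(theta in `[0, 2 * pi])
                 \int[lebesgue_measure]_(t in `[0, e x])
                   (pLN x t theta / pL x * t)).

Definition gL (R : realType) (d : measure_display) (Omega : measurableType d)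
    (P : probability Omega R) (E : blockage_env P) (lambda : R)
    (e : R -> R) (x : R) : R :=
  gL_of lambda (pL E) (pLL E) (pLN E) e x.

(* [gL] when the joint LoS probability is replaced by [q], with [b] for beta. *)
Definition gL_replaced (R : realType) (lambda b : R) (q : R -> R -> R -> R)
    (e : R -> R) (x : R) : R :=
  gL_of lambda (fun r => expR (- (b * r))) q
    (fun r1 r2 theta => expR (- (b * r1)) - q r1 r2 theta) e x.

Definition pLL_indep (R : realType) (b r1 r2 theta : R) : R :=
  expR (- (b * r1) - b * r2).

Definition pLL_maxcorr (R : realType) (b r1 r2 theta : R) : R :=
  expR (- (b * r1) - b * r2
        + 2^-1 * Num.min r1 r2 * b * (1 + cos theta)).

(* Modified Bessel function of the first kind, of integer order. *)
Definition besselI (R : realType) (n : nat) (z : R) : R :=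
  limn (series (fun k : nat => (z / 2) ^+ (2 * k + n) / (k`! * (k + n)`!)%:R)).

Definition F1 (R : realType) (b z : R) : R := (1 + b * z) * expR (- (b * z)).

Definition F (R : realType) (r b : R) : R :=
  r * expR (- (b * r / 2)) *
  (b * r * besselI 0 (b * r / 2) + (b * r + 2) * besselI 1 (b * r / 2)).

Definition gL_upper (R : realType) (lambda b : R) (e : R -> R) (x : R) : R :=
  expR (- (b * x) - lambda * pi * e x ^+ 2
        - 2 * pi * lambda / b ^+ 2 * (F1 b (e x) - F1 b x)).

Definition gL_lower (R : realType) (lambda b : R) (e : R -> R) (x : R) : R :=
  expR (- (b * x)) *
  expR (- (lambda * pi * e x ^+ 2)
        - 4 * lambda * \int[lebesgue_measure]_(t in `[e x, x])
                         \int[lebesgue_measure]_(theta in `[0, pi / 2])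
                           (t * expR (- (b * t * sin theta ^+ 2)))).

Definition gL_lower_bessel (R : realType) (lambda b : R) (e : R -> R) (x : R)
    : R :=
  expR (- (b * x) - lambda * pi * e x ^+ 2
        - 3^-1 * (2 * pi * lambda / b) * (F x b - F (e x) b)).

(* Main.v *)
Require Import Defs.
From HB Require Import structures.
From mathcomp Require Import all_boot all_order all_algebra.
From mathcomp Require Import finmap.
From mathcomp Require Import all_classical all_reals all_analysis.
From mathcomp Require Import measurable_realfun ring lra.
Set Implicit Arguments.
Unset Strict Implicit.
Unset Printing Implicit Defensive.
Import Order.TTheory GRing.Theory Num.Theory.
Import numFieldNormedType.Exports.
Local Open Scope classical_set_scope.
Local Open Scope ring_scope.

(* The marks of the segments are independent of the centers and of each other,
   so they can be integrated out one at a time while the rest of the model is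
   frozen.  What remains is the generating functional of the Poisson process of
   centers: the probability that no segment hits a given set K is exp (- mu m),
   where m is the mean over the marks of the area of the set of centers whose
   segment hits K.  For one link that set is a parallelogram, which gives
   p_L r = exp (- beta r).  For two links of lengths x and t, the parallelograms
   of a segment of length l and direction a overlap in an area of at most
   l t max (0, sin (a - theta)), hence
   exp (- beta x - beta t) <= p_LL x t theta
     <= exp (- beta x - beta t + beta t (1 + cos theta) / 2).

   Since p_LN = p_L - p_LL, the exponent of g_L is, with e = e_NL x,
   - lambda pi e^2 - lambda \int_[0, 2 pi] \int_[e, x] (p_LL / p_L) t.
   Only p_LL is left in it, with a negative sign, so that g_L decreases in p_LL
   and the two bounds on p_LL give the two bounds on g_L.  For the lower one, the
   integral of exp (z cos theta) over [0, 2 pi] is 2 pi I_0 z, and the derivative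
   of F (r, beta) is 3 beta r exp (- beta r / 2) I_0 (beta r / 2). *)

(** * Integrating out independent marks *)

(** The hypothesis on the centers speaks only of counts in disjoint sets, while the segments are
    attached to an enumeration whose order is arbitrary. Hence the detour by finite products:
    averaging the marks of the first N segments leaves the mean of the product of the 1 - h (X n),
    and only its limit in N is governed by the counts.

    The correction beta t (1 + cos theta) / 2 comes from the orientation. For 0 < a < pi, the line
    of direction a through the origin has the links of directions 0 and theta on opposite sides when
    sin (a - theta) < 0, and the overlap is then null. Otherwise it is at most the whole
    parallelogram of the second link. The mean of max (0, sin (a - theta)) over a in [0, pi] is (1 +
    cos theta) / pi, and mu E[L] / pi = beta / 2.

    Splitting and comparing the integrals in g_L requires p_LL to be jointly measurable in (t,
    theta). This is why the hitting condition is kept in closed form, measurable in all its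
    parameters, and why p_LL / p_L is replaced by a measurable function with values in [0, 1] on the
    whole plane. *)

Lemma measurable_fun_bigprod (d : measure_display) (T : measurableType d)
    (R : realType) (I : Type) (s : seq I) (A : pred I) (h : I -> T -> R) :
  (forall i, A i -> measurable_fun setT (h i)) ->
  measurable_fun setT (fun x => \prod_(i <- s | A i) h i x).
Proof.
move=> mh; elim: s => [|i s IH].
  under [X in measurable_fun _ X]eq_fun do rewrite big_nil.
  exact: measurable_cst.
case: (boolP (A i)) => Ai; last first.
  by under [X in measurable_fun _ X]eq_fun do rewrite big_cons (negbTE Ai).
under [X in measurable_fun _ X]eq_fun do rewrite big_cons Ai.
by apply: measurable_funM => //; exact: mh.
Qed.

(** Rectangles whose second side lies in [G], rather than in [<<s G >>], are closed under
    intersection as soon as [G] is; uniqueness of measures can then be applied to them. *)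
Lemma measurable_prod_g_sigma (d : measure_display) (T1 : measurableType d)
    (T2 : pointedType) (G : set (set T2)) : G setT ->
  @measurable _ (T1 * g_sigma_algebraType G)%type =
  <<s [set A `*` B | A in measurable & B in G] >>.
Proof.
move=> GT; apply/seteqP; split; last first.
  apply: smallest_sub; first exact: sigma_algebra_measurable.
  move=> _ [A mA [B GB <-]]; apply: measurableX => //.
  exact: sub_sigma_algebra.
apply: smallest_sub; first exact: smallest_sigma_algebra.
move=> X [[A mA <-]|].
  apply: sub_sigma_algebra; exists A => //; exists setT => //.
  by rewrite setTI setXT.
have -> : @measurable _ (g_sigma_algebraType G) = <<s G >> by [].
rewrite -g_sigma_preimageE; move: X.
apply: smallest_sub; first exact: smallest_sigma_algebra.
move=> _ [B GB <-]; apply: sub_sigma_algebra; exists setT => //.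
by exists B => //; rewrite setTI setTX.
Qed.

Section freezing.
Context (R : realType) (d d' : measure_display) (Omega : measurableType d).
Context (T : measurableType d') (P : probability Omega R).
Variables (G : set (set Omega)) (Z : {mfun Omega >-> T}) (Q : probability T R).
Hypotheses (mG : G `<=` measurable) (GI : setI_closed G) (GT : G setT).
Hypothesis indep : forall F D, G F -> measurable D ->
  P (F `&` Z @^-1` D) = (P F * Q D)%E.

Local Notation OG := (g_sigma_algebraType G).

Lemma g_sigma_subset_measurable (A : set Omega) : <<s G >> A -> measurable A.
Proof. exact: (smallest_sub (@sigma_algebra_measurable _ Omega) mG). Qed.

(** The identity as a map to the coarser space: its law is the restriction of [P] to the
    sigma-algebra generated by [G]. *)
Let idG (w : Omega) : OG := w.

Let measurable_idG : measurable_fun setT idG.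
Proof. by move=> _ A mA; rewrite setTI; exact: g_sigma_subset_measurable. Qed.

Let idG_mfun : {mfun Omega >-> OG} :=
  HB.pack idG (isMeasurableFun.Build _ _ _ _ _ measurable_idG).

Let pairZ (w : Omega) : T * OG := (Z w, w).

Let measurable_pairZ : measurable_fun setT pairZ.
Proof. exact/measurable_fun_pairP. Qed.

Let pairZ_mfun : {mfun Omega >-> (T * OG)%type} :=
  HB.pack pairZ (isMeasurableFun.Build _ _ _ _ _ measurable_pairZ).

(* A mark independent of the past can be integrated out while the past is
   frozen. *)
Lemma integral_freeze (f : T * OG -> \bar R) : measurable_fun setT f ->
  (forall x, (0 <= f x)%E) ->
  (\int[P]_w f (Z w, w) = \int[P]_w \int[Q]_z f (z, w))%E.
Proof.
move=> mf f0.
have joint A : measurable A ->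
    distribution P pairZ_mfun A = (Q \x distribution P idG_mfun)%E A.
  pose C : set (set (T * OG)) := [set A `*` B | A in @measurable _ T & B in G].
  move=> mA; apply: (measure_unique C (fun=> setT)) => //.
  - exact: measurable_prod_g_sigma.
  - move=> _ _ [A1 mA1 [B1 GB1 <-]] [A2 mA2 [B2 GB2 <-]]; rewrite -setXI.
    by exists (A1 `&` A2); [exact: measurableI|exists (B1 `&` B2) => //; exact: GI].
  - by move=> _; exists setT => //; exists setT => //; rewrite setXTT.
  - by rewrite bigcup_const.
  - move=> _ [A1 mA1 [B1 GB1 <-]].
    have mB1 : @measurable _ OG B1 by exact: sub_sigma_algebra.
    transitivity (Q A1 * distribution P idG_mfun B1)%E; last first.
      by apply/esym; exact: product_measure1E.
    rewrite /distribution /pushforward/= muleC -indep//; congr (P _).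
    by apply/seteqP; split => x [].
  - by move=> _; rewrite -ge0_fin_numE// fin_num_measure.
transitivity (\int[distribution P pairZ_mfun]_x f x)%E.
  by rewrite /distribution ge0_integral_pushforward//= preimage_setT.
rewrite (eq_measure_integral (Q \x distribution P idG_mfun)%E); last first.
  by move=> A mA _; exact: joint.
rewrite fubini_tonelli2// /distribution ge0_integral_pushforward//.
- exact: measurable_fun_fubini_tonelli_G.
- by move=> w _; exact: integral_ge0.
Qed.

End freezing.

(* Declared as a probability because the canonical sigma-finite structure of
   [P1 \x P2] is only found for a pair of subprobabilities. *)
Definition product_probability (R : realType) (d1 d2 : measure_display)
    (T1 : measurableType d1) (T2 : measurableType d2)
    (P1 : probability T1 R) (P2 : probability T2 R) : probability _ R :=
  (P1 \x P2)%E.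

Section marks.
Context (R : realType) (d : measure_display) (Omega : measurableType d).
Context (P : probability Omega R) (X : nat -> {mfun Omega >-> plane R}).
Context (L phi : nat -> {mfun Omega >-> measurableTypeR R}).
Context (lawL lawphi : probability (measurableTypeR R) R).
Hypothesis indep : independent_marking P
  (fun n => X n) (fun n => L n) (fun n => phi n).
Hypothesis LE : forall n A, measurable A -> P (L n @^-1` A) = lawL A.
Hypothesis phiE : forall n A, measurable A -> P (phi n @^-1` A) = lawphi A.

Local Notation Q := (product_probability lawL lawphi).

Let mark n (w : Omega) : plane R := (L n w, phi n w).

Let measurable_mark n : measurable_fun setT (mark n).
Proof. by apply: measurable_fun_pair; exact: measurable_funP. Qed.

Let markZ n : {mfun Omega >-> plane R} :=
  HB.pack (mark n) (isMeasurableFun.Build _ _ _ _ _ (@measurable_mark n)).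

Let mark_box (A B : nat -> set (measurableTypeR R)) n := L n @^-1` A n `&` phi n @^-1` B n.

(** A generating family, closed under intersection, for the information in all the centers and the
    marks of index below [j]. Centers of index [j] and beyond belong to it as well. *)
Let past j : set (set Omega) := [set F | exists E A B,
  [/\ sigma_of_seq X E, forall n, measurable (A n), forall n, measurable (B n)
    & F = E `&` \bigcap_(n in `I_j) mark_box A B n]].

Let sigma_X_measurable E : sigma_of_seq X E -> measurable E.
Proof.
apply: smallest_sub; first exact: sigma_algebra_measurable.
by move=> _ [n [B [mB ->]]]; exact: measurable_funPTI.
Qed.

Let measurable_box A B n : measurable (A n) -> measurable (B n) ->
  measurable (mark_box A B n).
Proof. by move=> mA mB; apply: measurableI; exact: measurable_funPTI. Qed.

Let past_measurable j : past j `<=` measurable.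
Proof.
move=> _ [E [A [B [/sigma_X_measurable mE mA mB ->]]]].
apply: measurableI => //; apply: fin_bigcap_measurable => // n _; exact: measurable_box.
Qed.

Let pastI j : setI_closed (past j).
Proof.
move=> _ _ [E [A [B [sE mA mB ->]]]] [E' [A' [B' [sE' mA' mB' ->]]]].
exists (E `&` E'), (fun n => A n `&` A' n), (fun n => B n `&` B' n); split.
- exact: (@measurableI _ (g_sigma_algebraType _)).
- by move=> n; exact: measurableI.
- by move=> n; exact: measurableI.
- rewrite setIACA -bigcapI; congr (_ `&` _); apply: eq_bigcapr => n _.
  by rewrite /mark_box !preimage_setI setIACA.
Qed.

Let sigma_X_setT : sigma_of_seq X setT.
Proof. exact: (@measurableT _ (g_sigma_algebraType _)). Qed.

Let pastT j : past j setT.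
Proof.
exists setT, (fun=> setT), (fun=> setT); split => //.
by rewrite setTI; apply/esym; rewrite -subTset => w _ n _.
Qed.

Let finE A : measurable A -> P A = (fine (P A))%:E.
Proof. by move=> mA; rewrite fineK// fin_num_measure. Qed.

(** The independence hypothesis is used twice: with [j.+1] marks, the boxes of [F] being completed
    by [A] and [B] at index [j], and with [j] marks to recognise [P F]. *)
Let past_rect j F A B : past j F -> measurable A -> measurable B ->
  P (F `&` (L j @^-1` A `&` phi j @^-1` B)) = (P F * (lawL A * lawphi B))%E.
Proof.
move=> pF mA mB; have mF := past_measurable pF.
have mAB : measurable (L j @^-1` A `&` phi j @^-1` B).
  by apply: measurableI; exact: measurable_funPTI.
case: pF => E [A' [B' [sE mA' mB' FE]]].
pose A1 n := if n == j then A else A' n; pose B1 n := if n == j then B else B' n.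
have mA1 n : measurable (A1 n) by rewrite /A1; case: ifP.
have mB1 n : measurable (B1 n) by rewrite /B1; case: ifP.
have boxj : mark_box A1 B1 j = L j @^-1` A `&` phi j @^-1` B.
  by rewrite /mark_box /A1 /B1 eqxx.
have box_lt n : (n < j)%N -> mark_box A1 B1 n = mark_box A' B' n.
  by move=> nj; rewrite /mark_box /A1 /B1 (ltn_eqF nj).
rewrite -(LE j mA) -(phiE j mB) (finE mF) (finE (measurableI _ _ mF mAB)).
rewrite (finE (measurable_funPTI (L j) mA)) (finE (measurable_funPTI (phi j) mB)).
rewrite -!EFinM; congr (_%:E).
have := indep j.+1 sE mA1 mB1; rewrite big_ord_recr/=.
rewrite (_ : E `&` _ = F `&` (L j @^-1` A `&` phi j @^-1` B)); last first.
  rewrite FE -setIA; congr (_ `&` _); apply/seteqP; split.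
    move=> w hw; split=> [n nj|]; last by rewrite -boxj; exact: (hw j (ltnSn j)).
    by rewrite -box_lt//; apply: hw => /=; exact: ltnW.
  move=> w [hw1 hw2] n /=; rewrite ltnS leq_eqVlt => /predU1P[->|nj].
    by change (mark_box A1 B1 j w); rewrite boxj.
  by change (mark_box A1 B1 n w); rewrite box_lt//; exact: hw1.
move=> ->; rewrite FE indep//.
have A1j : A1 j = A by rewrite /A1 eqxx.
have B1j : B1 j = B by rewrite /B1 eqxx.
rewrite A1j B1j mulrA; congr (_ * _ * _).
by apply: eq_bigr => i _; rewrite /A1 /B1 (ltn_eqF (ltn_ord i)).
Qed.

(** For fixed [F] both sides are measures in [D], equal on rectangles by [past_rect]; the right one
    is a product measure once the factor [P F] is absorbed in [lawL]. *)
Let past_mark j F D : past j F -> measurable D ->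
  P (F `&` markZ j @^-1` D) = (P F * Q D)%E.
Proof.
move=> pF mD; have mF := past_measurable pF.
have PF0 : 0 <= fine (P F) by rewrite fine_ge0.
have PFE : P F = (fine (P F))%:E by exact: finE.
pose m2 : {measure set (plane R) -> \bar R} :=
  measure_function_pushforward__canonical__measure_function_Measure
    (mrestr P mF) (measurable_mark j).
have m2E A : m2 A = P (F `&` markZ j @^-1` A) by rewrite setIC.
rewrite -m2E -(@product_measure_unique _ _ _ _ _ (mscale (NngNum PF0) lawL) lawphi m2)//.
  rewrite /product_measure1/= ge0_integral_mscale//=; first by rewrite -PFE.
  exact: measurable_fun_xsection.
by move=> A B mA mB; rewrite m2E /= /mscale /= -PFE -muleA -(past_rect pF mA mB).
Qed.

Local Notation OG j := (g_sigma_algebraType (past j)).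

Let measurable_X_past j n : measurable_fun setT (X n : OG j -> plane R).
Proof.
move=> _ D mD; rewrite setTI; apply: sub_sigma_algebra.
exists (X n @^-1` D), (fun=> setT), (fun=> setT); split => //.
  by apply: sub_sigma_algebra; exists n, D.
rewrite [X in _ `&` X](_ : _ = setT) ?setIT//.
by apply/seteqP; split=> // w _ i _.
Qed.

Let measurable_coord_past j n (A B : set (measurableTypeR R)) : (n < j)%N ->
  measurable A -> measurable B -> past j (L n @^-1` A `&` phi n @^-1` B).
Proof.
move=> nj mA mB.
exists setT, (fun i => if i == n then A else setT),
  (fun i => if i == n then B else setT); split => //.
- by move=> i; case: ifP.
- by move=> i; case: ifP.
- rewrite setTI; apply/seteqP; split=> [w wAB i _|w /(_ n nj)].
    by rewrite /mark_box; case: eqP => [->|_].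
  by rewrite /mark_box eqxx.
Qed.

Let measurable_mark_past j n : (n < j)%N ->
  measurable_fun setT (mark n : OG j -> plane R).
Proof.
move=> nj; apply: measurable_fun_pair => _ D mD; rewrite setTI;
  apply: sub_sigma_algebra.
  rewrite [X in past _ X](_ : _ = L n @^-1` D `&` phi n @^-1` setT).
    exact: measurable_coord_past.
  by rewrite preimage_setT setIT.
rewrite [X in past _ X](_ : _ = L n @^-1` setT `&` phi n @^-1` D).
  exact: measurable_coord_past.
by rewrite preimage_setT setTI.
Qed.

Variable M : set (plane R * plane R).
Hypothesis mM : measurable M.
Let k (c : plane R) : R := fine (Q (xsection M c)).

Let k_ge0 c : 0 <= k c.
Proof. by rewrite /k fine_ge0. Qed.

Let measurable_k : measurable_fun setT k.
Proof.
apply: (@measurableT_comp _ _ _ _ _ _ fine _ (fun c => Q (xsection M c))).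
  exact: fine_measurable.
exact: (measurable_fun_xsection Q mM).
Qed.

Let hit n w : R := \1_M (X n w, mark n w).

(** Interpolates between the integrand with every mark averaged ([j = 0]) and the indicator that the
    first [N] points all lie in [M] ([j = N]). *)
Let hybrid N j w : R := \prod_(n < N) (if (n < j)%N then hit n w else k (X n w)).

(** The factors other than the one of index [j] depend only on the centers and on earlier marks, so
    freezing them lets mark [j] be averaged alone. *)
Let hybridS N j : (j < N)%N ->
  (\int[P]_w (hybrid N j.+1 w)%:E = \int[P]_w (hybrid N j w)%:E)%E.
Proof.
move=> jN; pose j0 := Ordinal jN.
pose rest w := \prod_(n < N | n != j0)
  (if (n < j)%N then hit n w else k (X n w)).
have rest_ge0 w : 0 <= rest w.
  by apply: prodr_ge0 => i _; case: ifP => _ //; rewrite /hit indicE ler0n.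
pose f (x : plane R * OG j) := ((\1_M (X j x.2, x.1) : R) * rest x.2)%:E.
have mrest : measurable_fun setT (rest : OG j -> R).
  apply: measurable_fun_bigprod => i _ /=; case: (ltnP i j) => ij.
    apply: (@measurableT_comp _ _ _ _ _ _ (\1_M : _ -> R) _
      (fun w : OG j => (X i w, mark i w))); first exact: measurable_indic.
    apply: measurable_fun_pair; first exact: measurable_X_past.
    exact: measurable_mark_past.
  exact: (measurableT_comp measurable_k (@measurable_X_past j i)).
have mf : measurable_fun setT f.
  apply/measurable_EFinP/measurable_funM.
    apply: (@measurableT_comp _ _ _ _ _ _ (\1_M : _ -> R) _
      (fun x : plane R * OG j => (X j x.2, x.1))); first exact: measurable_indic.
    apply: measurable_fun_pair => //.
    exact: (measurableT_comp (@measurable_X_past j j) measurable_snd).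
  exact: (measurableT_comp mrest measurable_snd).
have f0 x : (0 <= f x)%E by rewrite lee_fin mulr_ge0// indicE ler0n.
transitivity (\int[P]_w f (markZ j w, w))%E.
  apply: eq_integral => w _; rewrite /hybrid /f (bigD1 j0)//= ltnSn.
  congr (_ * _)%:E; apply: eq_bigr => i ij.
  by rewrite ltnS leq_eqVlt -[(i : nat) == j]/(i == j0) (negbTE ij).
rewrite (integral_freeze (@past_measurable j) (@pastI j) (pastT j) (@past_mark j) mf f0).
apply: eq_integral => w _; rewrite /hybrid /f (bigD1 j0)//= ltnn.
under eq_integral do rewrite EFinM muleC.
rewrite ge0_integralZl//; last 2 first.
- apply/measurable_EFinP; apply: (@measurableT_comp _ _ _ _ _ _ (\1_M : _ -> R) _
    (fun z : plane R => (X j w, z))); first exact: measurable_indic.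
  by apply: measurable_fun_pair.
- by rewrite lee_fin.
rewrite muleC EFinM; congr (_ * _)%E.
rewrite /k fineK; last by rewrite fin_num_measure//; exact: measurable_xsection.
transitivity (\int[Q]_z (\1_(xsection M (X j w)) z)%:E)%E; last first.
  by rewrite integral_indic ?setIT//; exact: measurable_xsection.
by apply: eq_integral => z _; rewrite !indicE mem_xsection.
Qed.

Lemma probability_marked_all N :
  P (\bigcap_(n in `I_N) [set w | M (X n w, (L n w, phi n w))]) =
  (\int[P]_w (\prod_(n < N) k (X n w))%:E)%E.
Proof.
have hybrid0 j : (j <= N)%N ->
    (\int[P]_w (hybrid N j w)%:E = \int[P]_w (hybrid N 0 w)%:E)%E.
  by elim: j => // j IH jN; rewrite hybridS// IH// ltnW.
rewrite -[RHS](hybrid0 N)//.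
set A := \bigcap_(n in _) _.
have mA : measurable A.
  apply: fin_bigcap_measurable => // n _.
  rewrite -[X in measurable X]setTI.
  by apply: (measurable_fun_pair (measurable_funP (X n)) (@measurable_mark n)).
rewrite -[X in P X]setIT -integral_indic//.
apply: eq_integral => w _; congr (_%:E); rewrite /hybrid.
under eq_bigr do rewrite ltn_ord.
rewrite indicE; case: (boolP (w \in _)) => [/set_mem/= wM|/negP wM].
  by rewrite big1// => i _; rewrite /hit indicE mem_set//; exact: (wM i (ltn_ord i)).
have [i Mi] : exists i : 'I_N, ~ M (X i w, mark i w).
  apply: contrapT => /forallNP h; apply: wM; apply: mem_set => n nN.
  by have := h (Ordinal nN); apply: contrapT.
by rewrite (bigD1 i)//= /hit indicE memNset// mul0r.
Qed.

End marks.

(** * Generating functional of a Poisson process *)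

HB.instance Definition _ (R : realType) := Measure.on (@area R).

Lemma area_sigma_finite (R : realType) : sigma_finite setT (@area R).
Proof.
have mI (n : nat) : measurable (`[- n%:R, n%:R] : set (measurableTypeR R)).
  exact: measurable_itv.
exists (fun n : nat => `[- n%:R, n%:R] `*` `[- n%:R, n%:R]).
  apply/esym; rewrite -subTset => -[x y] _.
  exists (Num.trunc (Num.max `|x| `|y|)).+1 => //=.
  have : Num.max `|x| `|y| < (Num.trunc (Num.max `|x| `|y|)).+1%:R.
    by rewrite truncnS_gt.
  rewrite gt_max => /andP[/ltW + /ltW].
  by rewrite !ler_norml !in_itv.
move=> n; split; first exact: measurableX.
rewrite /area product_measure1E//= lebesgue_measure_itv/= lte_fin.
by case: ifP => _; rewrite ?mule0 ?ltry// -EFinM ltry.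
Qed.

HB.instance Definition _ (R : realType) :=
  Measure_isSigmaFinite.Build _ _ _ (@area R) (@area_sigma_finite R).

Lemma card_setI_II (S : set nat) N :
  #|` fset_set (S `&` `I_N)| = (\sum_(n < N) (val n \in S))%N.
Proof.
elim: N => [|N IH]; first by rewrite big_ord0 II0 setI0 fset_set0 cardfs0.
have fI m : finite_set (S `&` `I_m) by exact: finite_setIr.
rewrite big_ord_recr/= IIS setIUr addnC.
have [NS|NS] := boolP (N \in S).
  rewrite (_ : S `&` [set N] = [set N]); last first.
    by apply/seteqP; split=> [x []//|x ->]; split=> //; exact/set_mem.
  rewrite setUC fset_setU1// cardfsU1 in_fset_set// IH.
  by rewrite memNset//= ltnn => -[].
rewrite (_ : S `&` [set N] = set0) ?setU0 ?addn0//.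
by rewrite -subset0 => x [xS xN]; move: NS; rewrite -xN mem_set.
Qed.

(** Rewrites a cardinality as the eventual value of partial counts, a countable condition from which
    the measurability of [count_is] follows. For an infinite set the partial counts never
    stabilise. *)
Lemma card_eq_II_eventually (S : set nat) k :
  (S #= `I_k)%card <->
  exists N0, forall N, (N0 <= N)%N -> (\sum_(n < N) (val n \in S) = k)%N.
Proof.
split=> [SK|[N0 SN0]].
  have fS : finite_set S by apply/finite_setP; exists k.
  have [N0 SN0] : exists N0, S `<=` `I_N0.
    exists (\max_(i <- fset_set S) i).+1 => n Sn /=; rewrite ltnS.
    by apply: leq_bigmax_seq => //; rewrite in_fset_set// mem_set.
  exists N0 => N N0N; rewrite -card_setI_II setIidl; last first.
    by move=> n /SN0 /= nN0; exact: leq_trans N0N.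
  exact: card_fset_set.
have SN0I : S `<=` `I_N0.
  move=> n Sn; rewrite /= ltnNge; apply/negP => N0n.
  (* An element n of [S] with [N0 <= n] would raise the count between n and n.+1, although both
     counts equal k. *)
  have := SN0 n.+1 (leqW N0n); rewrite big_ord_recr/= SN0// mem_set// => /eqP.
  by rewrite addn1 eqn_leq ltnn.
have /finite_setP[m Sm] : finite_set S by exact: sub_finite_set SN0I _.
rewrite -(SN0 N0 (leqnn _)) -card_setI_II setIidl//.
by rewrite (card_fset_set Sm).
Qed.

Section counts.
Context (R : realType) (d : measure_display) (Omega : measurableType d).
Variable X : nat -> {mfun Omega >-> plane R}.

Definition count_lt (B : set (plane R)) N w : nat :=
  \sum_(n < N) (X n w \in B).

Lemma count_isP (B : set (plane R)) k w :
  count_is (fun n => X n) B k w <->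
  exists N0, forall N, (N0 <= N)%N -> count_lt B N w = k.
Proof.
rewrite /count_is/= card_eq_II_eventually; split=> -[N0 h]; exists N0 => N /h <-;
  apply: eq_bigr => n _; congr (nat_of_bool _); apply/idP/idP;
  by move=> /set_mem ?; exact: mem_set.
Qed.

Lemma measurable_count_is B k : measurable B ->
  measurable (count_is (fun n => X n) B k).
Proof.
move=> mB.
have mc N : measurable_fun setT (count_lt B N).
  elim: N => [|N IH].
    rewrite (_ : count_lt B 0 = cst 0%N) ?measurable_cst//.
    by apply/funext => w; rewrite /count_lt big_ord0.
  rewrite (_ : count_lt B N.+1 = (fun w => count_lt B N w + (X N w \in B))%N).
    apply: measurable_fun_addn => //.
    have mb : measurable_fun setT nat_of_bool by move=> _ Y _; rewrite setTI.
    apply: (measurableT_comp mb); apply: (measurable_fun_bool true).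
    rewrite setTI (_ : _ @^-1` _ = X N @^-1` B); first exact: measurable_funPTI.
    by apply/seteqP; split=> w /=; [exact: set_mem|exact: mem_set].
  by apply/funext => w; rewrite /count_lt big_ord_recr.
rewrite (_ : count_is _ _ _ =
  \bigcup_N0 \bigcap_(N in [set N | (N0 <= N)%N]) (count_lt B N @^-1` [set k])).
  apply: bigcup_measurable => N0 _; apply: bigcap_measurable; first by exists N0 => /=.
  by move=> N _; rewrite -[X in measurable X]setTI; exact: mc.
apply/seteqP; split=> w.
  by move=> /count_isP[N0 h]; exists N0 => // N /= /h.
by move=> [N0 _ h]; apply/count_isP; exists N0 => N /h.
Qed.

End counts.

Section poisson.
Context (R : realType) (d : measure_display) (Omega : measurableType d).
Variables (P : probability Omega R) (X : nat -> {mfun Omega >-> plane R}).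

Local Notation count B k := (count_is (fun n => X n) B k).

Lemma count_is_inj B k l w : count B k w -> count B l w -> k = l.
Proof.
move=> /count_isP[N hN] /count_isP[M hM].
by rewrite -(hN (maxn N M)) ?leq_maxl// hM// leq_maxr.
Qed.

(* [y ^+ k] when exactly [k] points fall in [B]; 0 when infinitely many do *)
Definition thinning (B : set (plane R)) (y : R) (w : Omega) : R :=
  fine (\sum_(k <oo) (y ^+ k * \1_(count B k) w)%:E).

Lemma thinning_countE B y k w : 0 <= y -> count B k w -> thinning B y w = y ^+ k.
Proof.
move=> y0 ck; rewrite /thinning (@nneseriesD1 _ _ k)//; last first.
  by move=> n; rewrite lee_fin mulr_ge0 ?exprn_ge0// indicE ler0n.
rewrite eseries0 ?adde0 ?indicE ?mem_set ?mulr1// => n _ nk.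
rewrite indicE memNset ?mulr0// => cn; move: nk.
by rewrite (count_is_inj cn ck) eqxx.
Qed.

(** Counts are unique, so at most one term is nonzero and [fine] loses nothing. *)
Lemma thinning_series B y w : 0 <= y ->
  (\sum_(k <oo) (y ^+ k * \1_(count B k) w)%:E = (thinning B y w)%:E)%E.
Proof.
move=> y0; rewrite /thinning.
have [[k ck]|nc] := pselect (exists k, count B k w).
  rewrite fineK// (@nneseriesD1 _ _ k)//; last first.
    by move=> n; rewrite lee_fin mulr_ge0 ?exprn_ge0// indicE ler0n.
  rewrite eseries0 ?adde0// => n _ nk.
  rewrite indicE memNset ?mulr0// => cn; move: nk.
  by rewrite (count_is_inj cn ck) eqxx.
rewrite eseries0// => n _ _; rewrite indicE memNset ?mulr0// => cn.
by apply: nc; exists n.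
Qed.

Lemma thinning_ge0 B y w : 0 <= y -> 0 <= thinning B y w.
Proof.
move=> y0; rewrite fine_ge0// nneseries_ge0// => k _ _.
by rewrite lee_fin mulr_ge0 ?exprn_ge0// indicE ler0n.
Qed.

Lemma measurable_thinning B y : measurable B -> 0 <= y ->
  measurable_fun setT (thinning B y).
Proof.
move=> mB y0; apply: (measurableT_comp (fine_measurable measurableT)).
apply: (@ge0_emeasurable_sum _ _ _ setT (fun k w => (y ^+ k * \1_(count B k) w)%:E) xpredT).
  by move=> k w _ _; rewrite lee_fin mulr_ge0 ?exprn_ge0// indicE ler0n.
move=> k _; apply/measurable_EFinP/measurable_funM => //.
by apply/measurable_indic/measurable_count_is.
Qed.

Definition poisson_weight (a : R) k := expR (- a) * a ^+ k / k`!%:R.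

(** The generating function of a Poisson variable, exp (- a (1 - y)), in the presence of a weight
    [W] that stands for the contribution of the other sets. *)
Lemma integral_thinning (W : Omega -> R) B (y a c : R) : measurable B ->
  measurable_fun setT W -> (forall w, 0 <= W w) -> 0 <= y ->
  (forall k, \int[P]_w (W w * \1_(count B k) w)%:E = (c * poisson_weight a k)%:E)%E ->
  (\int[P]_w (W w * thinning B y w)%:E = (c * expR (- (a * (1 - y))))%:E)%E.
Proof.
move=> mB mW W0 y0 Wk.
have m1 k : measurable_fun setT (fun w => (W w * \1_(count B k) w)%:E).
  apply/measurable_EFinP/measurable_funM => //.
  by apply/measurable_indic/measurable_count_is.
have ge1 k w : (0 <= (W w * \1_(count B k) w)%:E)%E.
  by rewrite lee_fin mulr_ge0// indicE ler0n.
transitivity (\int[P]_w \sum_(k <oo) ((y ^+ k)%:E * (W w * \1_(count B k) w)%:E))%E.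
  apply: eq_integral => w _; rewrite EFinM -thinning_series// -nneseriesZl//.
    by apply: eq_eseriesr => k _; rewrite -!EFinM mulrCA.
  by move=> k _; rewrite lee_fin mulr_ge0 ?exprn_ge0// indicE ler0n.
rewrite integral_nneseries//; last 2 first.
- by move=> k; exact: measurable_funeM.
- by move=> k w _; rewrite mule_ge0// lee_fin exprn_ge0.
transitivity (\sum_(k <oo) (y ^+ k * (c * poisson_weight a k))%:E)%E.
  apply: eq_eseriesr => k _; rewrite ge0_integralZl//.
    by rewrite Wk -EFinM.
  by rewrite lee_fin exprn_ge0.
transitivity (limn (EFin \o
    (fun n => c * expR (- a) * series (exp_coeff (y * a)) n))); last first.
  have uE : (c * expR (- a) * series (exp_coeff (y * a)) n) @[n --> \oo] -->
      (c * expR (- (a * (1 - y)))).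
    have -> : c * expR (- (a * (1 - y))) = c * expR (- a) * expR (y * a).
      by rewrite -mulrA -expRD; congr (c * expR _); ring.
    by apply: cvgM; [exact: cvg_cst|exact: is_cvg_series_exp_coeff].
  by rewrite EFin_lim ?(cvg_lim _ uE)//; apply/cvg_ex; exists (c * expR (- (a * (1 - y)))).
congr (lim (_ @ \oo)).
apply/funext => n /=; rewrite /series/= big_distrr/= sumEFin; congr _%:E.
apply: eq_bigr => k _; rewrite /poisson_weight /exp_coeff/= exprMn; ring.
Qed.

End poisson.

Section PPP.
Context (R : realType) (d : measure_display) (Omega : measurableType d).
Variables (P : probability Omega R) (X : nat -> {mfun Omega >-> plane R}).
Variable mu : R.
Hypothesis hX : homogeneous_PPP P mu (fun n => X n).

Local Notation count B k := (count_is (fun n => X n) B k).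

Section disjoint_family.
Variables (m : nat) (B : 'I_m -> set (plane R)) (y : 'I_m -> R).
Hypothesis mB : forall i, measurable (B i).
Hypothesis Boo : forall i, (area (B i) < +oo)%E.
Hypothesis tB : trivIset setT B.
Hypothesis y0 : forall i, 0 <= y i.

Let a i := mu * fine (area (B i)).

Let hyb j (k : 'I_m -> nat) w : R :=
  \prod_(i < m) (if (i < j)%N then thinning X (B i) (y i) w
                 else \1_(count (B i) (k i)) w).

Let factor_ge0 j (k : 'I_m -> nat) (i : 'I_m) w :
  0 <= (if (i < j)%N then thinning X (B i) (y i) w
                 else \1_(count (B i) (k i)) w).
Proof. by case: ifP => _; [exact: thinning_ge0|rewrite indicE ler0n]. Qed.

(** At [j = 0] this is the Poisson hypothesis for prescribed counts; each step sums out the count of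
    one more set, the others being kept as a weight. *)
Lemma PPP_thinning_hybrid j (k : 'I_m -> nat) : (j <= m)%N ->
  (\int[P]_w (hyb j k w)%:E =
   (\prod_(i < m) (if (i < j)%N then expR (- (a i * (1 - y i)))
                   else poisson_weight (a i) (k i)))%:E)%E.
Proof.
elim: j k => [|j IH] k jm.
  under [in RHS]eq_bigr do rewrite /poisson_weight /a.
  rewrite -(hX _ mB Boo tB) -[in RHS](setIT (\bigcap_(i in _) _)) -integral_indic//; last first.
    by apply: fin_bigcap_measurable => // i _; exact: measurable_count_is.
  apply: eq_integral => w _; congr (_%:E); rewrite /hyb/= indicE.
  case: (boolP (w \in _)) => [/set_mem/= wM|/negP wM].
    by rewrite big1// => i _; rewrite indicE mem_set//; exact: (wM i).
  have [i Mi] : exists i : 'I_m, ~ count (B i) (k i) w.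
    apply: contrapT => /forallNP h; apply: wM; apply: mem_set => i _.
    by have := h i; apply: contrapT.
  by rewrite (bigD1 i)//= indicE memNset// mul0r.
pose j0 := Ordinal jm.
pose W w := \prod_(i < m | i != j0) (if (i < j)%N then thinning X (B i) (y i) w
                 else \1_(count (B i) (k i)) w).
pose c := \prod_(i < m | i != j0) (if (i < j)%N then expR (- (a i * (1 - y i)))
                   else poisson_weight (a i) (k i)).
have ltS (i : 'I_m) : i != j0 -> (i < j.+1)%N = (i < j)%N.
  by move=> ij; rewrite ltnS leq_eqVlt -[(i : nat) == j]/(i == j0) (negbTE ij).
rewrite (bigD1 j0)//= ltnSn mulrC.
rewrite (eq_bigr (fun i : 'I_m => if (i < j)%N then expR (- (a i * (1 - y i)))
                   else poisson_weight (a i) (k i))); last first.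
  by move=> i /ltS ->.
rewrite -/c -(@integral_thinning _ _ _ P X W (B j0) (y j0) (a j0) c)//.
- apply: eq_integral => w _; rewrite /hyb (bigD1 j0)//= ltnSn mulrC.
  by congr (_ * _)%:E; apply: eq_bigr => i /ltS ->.
- apply: measurable_fun_bigprod => i _ /=; case: (ltnP i j) => ij.
    exact: measurable_thinning.
  by apply: measurable_indic; exact: measurable_count_is.
- by move=> w; apply: prodr_ge0 => i _; exact: factor_ge0.
(* The induction hypothesis holds for every prescription of counts, so that of [j0] may be any l. *)
- move=> l; pose k' i := if i == j0 then l else k i.
  have := IH k' (ltnW jm); rewrite (bigD1 j0)//= ltnn /k' eqxx mulrC.
  rewrite -/k' (eq_bigr (fun i : 'I_m => if (i < j)%N then expR (- (a i * (1 - y i)))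
                   else poisson_weight (a i) (k i))); last first.
    by move=> i /negbTE ij; rewrite /k' ij.
  rewrite -/c => <-; apply: eq_integral => w _; rewrite /hyb (bigD1 j0)//= ltnn /k' eqxx mulrC.
  by congr (_ * _)%:E; apply: eq_bigr => i /negbTE ij; rewrite ij.
Qed.

Lemma PPP_thinning_prod :
  (\int[P]_w (\prod_(i < m) thinning X (B i) (y i) w)%:E =
   (expR (- (mu * \sum_(i < m) fine (area (B i)) * (1 - y i))))%:E)%E.
Proof.
have := PPP_thinning_hybrid (fun=> 0%N) (leqnn m); rewrite /hyb.
under eq_integral do under eq_bigr do rewrite ltn_ord.
move=> ->; under eq_bigr do rewrite ltn_ord.
rewrite -expR_sum; congr (expR _)%:E.
rewrite sumrN mulr_sumr; congr (- _).
by apply: eq_bigr => i _; rewrite /a mulrA.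
Qed.

End disjoint_family.

(** Thinning with [y = 1] is the indicator that the count is finite, and its mean is exp 0 = 1. *)
Lemma PPP_count_finite_ae B : measurable B -> (area B < +oo)%E ->
  {ae P, forall w, exists k, count B k w}.
Proof.
move=> mB Boo.
have mA : measurable [set w | exists k, count B k w].
  rewrite (_ : [set _ | _] = \bigcup_k count B k).
    by apply: bigcup_measurable => k _; exact: measurable_count_is.
  by apply/seteqP; split=> [w [k ck]|w [k _ ck]]; exists k.
have := @PPP_thinning_prod 1 (fun=> B) (fun=> 1) (fun=> mB) (fun=> Boo) _ (fun=> ler01).
rewrite big_ord1 subrr mulr0 mulr0 oppr0 expR0 => /(_ _) PA.
exists (~` [set w | exists k, count B k w]); split => //.
- exact: measurableC.
- have -> : P (~` [set w | exists k, count B k w]) = (1 - P [set w | exists k, count B k w])%E.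
    by rewrite probability_setC.
  rewrite -PA; last by apply/trivIsetP => i j _ _; rewrite !ord1.
  rewrite -[X in P X]setIT -integral_indic//.
  rewrite (_ : (\int[P]_w _)%E = (\int[P]_w (\1_[set w | exists k, count B k w] w)%:E)%E) ?subee//.
    by rewrite integral_indic// fin_num_measure// setIT.
  apply: eq_integral => w _; rewrite big_ord1 indicE.
  have [[k ck]|nk] := pselect (exists k, count B k w).
    by rewrite (thinning_countE _ ck)// expr1n mem_set//; exists k.
  rewrite memNset//=; congr _%:E; apply: EFin_inj; rewrite -thinning_series//.
  rewrite eseries0// => k _ _; rewrite indicE memNset ?mulr0// => ck.
  by apply: nk; exists k.
Qed.

(** The partial products follow the enumeration, but they are eventually constant with a value that
    depends only on the count. *)
Lemma thinning_cvg B y w : 0 <= y -> (exists k, count B k w) ->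
  (\prod_(n < N) (if X n w \in B then y else 1)) @[N --> \oo] --> thinning X B y w.
Proof.
move=> y0 [k ck]; rewrite (thinning_countE y0 ck).
have [N0 hN] := (count_isP X B k w).1 ck.
apply: cvg_near_cst; exists N0 => // N /= /hN <-.
rewrite /count_lt; elim: N => [|N IH]; first by rewrite !big_ord0.
rewrite !big_ord_recr/= IH exprD; congr (_ * _).
by case: ifP.
Qed.

End PPP.

Section generating.
Context (R : realType) (d : measure_display) (Omega : measurableType d).
Variables (P : probability Omega R) (X : nat -> {mfun Omega >-> plane R}).
Import HBNNSimple.

Variable mu : R.
Hypothesis mu_ge0 : 0 <= mu.
Hypothesis hX : homogeneous_PPP P mu (fun n => X n).

Let survive (h : plane R -> R) N w : R := \prod_(n < N) (1 - h (X n w)).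

Let survive_ge0 h N w : (forall x, h x <= 1) -> 0 <= survive h N w.
Proof. by move=> h1; apply: prodr_ge0 => n _; rewrite subr_ge0. Qed.

Let survive_le1 h N w : (forall x, 0 <= h x <= 1) -> survive h N w <= 1.
Proof.
move=> h1; rewrite /survive; apply: prodr_ile1 => n _.
by have /andP[h0 ?] := h1 (X n w); rewrite subr_ge0 gerBl h0 andbT.
Qed.

Let measurable_survive h N : measurable_fun setT h ->
  measurable_fun setT (survive h N).
Proof.
move=> mh; apply: measurable_fun_bigprod => n _.
apply: measurable_funB => //; exact: (measurableT_comp mh (measurable_funP (X n))).
Qed.

(** For a simple function the product splits over the level sets, and each level s contributes in
    the limit the thinning of its level set with parameter 1 - s. *)
Lemma PPP_generating_nnsfun (h : {nnsfun plane R >-> R}) :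
  (forall x, h x <= 1) -> (\int[@area R]_x (h x)%:E < +oo)%E ->
  (\int[P]_w (\prod_(n < N) (1 - h (X n w)))%:E)%E @[N --> \oo] -->
  (expR (- (mu * fine (\int[@area R]_x (h x)%:E)%E)))%:E.
Proof.
move=> h1 hoo.
(* The value 0 is left out: it contributes factors 1, and its level set may have infinite area. The
   other level sets have finite area because the integral of [h] is finite. *)
pose s := [seq r <- fset_set (range h) | r != 0].
have us : uniq s by rewrite filter_uniq// fset_uniq.
have mem_s x : (h x \in s) = (h x != 0).
  by rewrite mem_filter in_fset_set// mem_set ?andbT//; exists x.
have sP r : r \in s -> 0 < r <= 1.
  rewrite mem_filter in_fset_set// => /andP[r0 /set_mem[x _ rE]].
  by rewrite -rE h1 lt_neqAle eq_sym rE r0 -rE fun_ge0.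
pose si (i : 'I_(size s)) := s`_i.
have siP i : 0 < si i <= 1 by apply: sP; rewrite mem_nth.
pose B i := h @^-1` [set si i].
have mB i : measurable (B i) by exact: measurable_funPTI.
have tB : trivIset setT B.
  apply/trivIsetP => i j _ _ ij; rewrite -subset0 => x [/= hi hj].
  move/eqP: ij; apply; apply: val_inj; apply/eqP.
  by rewrite -(nth_uniq 0 (ltn_ord i) (ltn_ord j) us); apply/eqP; exact: (etrans (esym hi) hj).
have hB x : h x = \sum_i si i * \1_(B i) x.
  have [hx0|hx0] := eqVneq (h x) 0.
    rewrite big1 ?hx0// => i _; rewrite indicE memNset ?mulr0// /B/= hx0 => si0.
    by have := siP i; rewrite -si0 ltxx.
  have hxs : (index (h x) s < size s)%N by rewrite index_mem mem_s.
  pose i0 := Ordinal hxs.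
  have si0 : h x = si i0 by rewrite /si/= nth_index// mem_s.
  rewrite (bigD1 i0)//= indicE mem_set// mulr1 -si0 big1 ?addr0// => i ii0.
  rewrite indicE memNset ?mulr0// /B/= si0 => sisi.
  move/eqP: ii0; apply; apply: val_inj; apply/eqP.
  by rewrite -(nth_uniq 0 (ltn_ord i) (ltn_ord i0) us); apply/eqP; exact: esym sisi.
have h1B x : 1 - h x = \prod_i (if x \in B i then 1 - si i else 1).
  have [[i Bi]|nB] := pselect (exists i, B i x).
    rewrite (bigD1 i)//= mem_set// big1 ?mulr1 => [|j ji]; first by rewrite Bi.
    rewrite memNset// => Bj.
    by move/trivIsetP : tB => /(_ _ _ I I ji)/seteqP[+ _] => /(_ x); apply.
  rewrite big1 => [|i _]; last by rewrite memNset// => Bi; apply: nB; exists i.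
  rewrite hB big1 ?subr0// => i _; rewrite indicE memNset ?mulr0// => Bi.
  by apply: nB; exists i.
have mBi i : measurable_fun setT (fun x => (si i * \1_(B i) x)%:E).
  by apply/measurable_EFinP/measurable_funM => //; exact: measurable_indic.
have Bi0 i x : (0 <= (si i * \1_(B i) x)%:E)%E.
  by have /andP[/ltW ? _] := siP i; rewrite lee_fin mulr_ge0// indicE ler0n.
have int1 i : (\int[@area R]_x (si i * \1_(B i) x)%:E = (si i)%:E * area (B i))%E.
  have /andP[/ltW si_ge0 _] := siP i.
  under eq_integral do rewrite EFinM.
  rewrite ge0_integralZl//; last by apply/measurable_EFinP; exact: measurable_indic.
  by rewrite integral_indic ?setIT.
have intE : (\int[@area R]_x (h x)%:E = \sum_i (si i)%:E * area (B i))%E.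
  under eq_integral do rewrite hB -sumEFin.
  by rewrite ge0_integral_sum//; apply: eq_bigr => i _; exact: int1.
have Boo i : (area (B i) < +oo)%E.
  have /andP[si0 _] := siP i.
  have : ((si i)%:E * area (B i) < +oo)%E.
    apply: le_lt_trans hoo; rewrite intE (bigD1 i)//= leeDl// sume_ge0// => j _.
    by have /andP[/ltW ? _] := siP j; rewrite mule_ge0.
  by apply: contraTT; rewrite -!leNgt leye_eq => /eqP ->; rewrite gt0_muley ?lte_fin.
have -> : fine (\int[@area R]_x (h x)%:E)%E =
    \sum_i fine (area (B i)) * (1 - (1 - si i)).
  rewrite intE; under eq_bigr => i _.
    rewrite -[area (B i)]fineK ?ge0_fin_numE// -EFinM; over.
  rewrite sumEFin/=; apply: eq_bigr => i _; by rewrite subKr mulrC.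
have y0 i : 0 <= 1 - si i by have /andP[_ ?] := siP i; rewrite subr_ge0.
rewrite -(PPP_thinning_prod hX mB Boo tB y0).
have h01 x : 0 <= h x <= 1 by rewrite fun_ge0 h1.
(* Convergence holds almost surely, on the event that all the level sets contain finitely many
   points. *)
have [//|||||//] := @dominated_convergence _ _ _ P setT measurableT
  (fun N w => (survive h N w)%:E)
  (fun w => (\prod_i thinning X (B i) (1 - si i) w)%:E) (cst 1%E).
- by move=> N; apply/measurable_EFinP/measurable_survive.
- by apply/measurable_EFinP/measurable_fun_bigprod => i _; exact: measurable_thinning.
- have : {ae P, forall w, forall i, exists k, count_is (fun n => X n) (B i) k w}.
    apply: filter_forall => i; exact: (PPP_count_finite_ae hX (mB i) (Boo i)).
  apply: filterS => w fw _; apply: cvg_EFin; first exact: nearW.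
  rewrite (_ : fine \o _ = fun N =>
      \prod_i \prod_(n < N) (if X n w \in B i then 1 - si i else 1)); last first.
    apply/funext => N /=; rewrite exchange_big/=.
    by apply: eq_bigr => n _; rewrite h1B.
  apply: (@cvg_big _ _ _ _ _ mul_continuous) => i _; exact: thinning_cvg.
- apply/integrableP; split; first exact: measurable_cst.
  under eq_integral do rewrite abse1.
  by rewrite integral_cst//= mul1e (le_lt_trans (probability_le1 _ _))// ltry.
- apply: aeW => w N _.
  by rewrite abse_EFin lee_fin ger0_norm ?survive_le1// survive_ge0.
Qed.

(* Monotone approximation of [h] by simple functions [h_m]: the finite products
   for [h] are bounded above by those for [h_m], and bounded below because the
   products for [h_m] never go below their limit. *)
Lemma PPP_generating (h : plane R -> R) : measurable_fun setT h ->
  (forall x, 0 <= h x <= 1) -> (\int[@area R]_x (h x)%:E < +oo)%E ->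
  (\int[P]_w (\prod_(n < N) (1 - h (X n w)))%:E)%E @[N --> \oo] -->
  (expR (- (mu * fine (\int[@area R]_x (h x)%:E)%E)))%:E.
Proof.
move=> mh h01 hoo.
have mhE : measurable_fun setT (EFin \o h) by exact/measurable_EFinP.
pose g := nnsfun_approx measurableT mhE.
have h0 x : (0 <= (h x)%:E)%E by rewrite lee_fin; case/andP: (h01 x).
have g_cvg x : (g n x)%:E @[n --> \oo] --> (h x)%:E.
  by apply: (cvg_nnsfun_approx measurableT mhE) => // y _; exact: h0.
have g_nd x : nondecreasing_seq (g ^~ x).
  by move=> m n mn; exact/lefP/nd_nnsfun_approx.
have g_cvgR x : g n x @[n --> \oo] --> h x by exact: (fine_cvg (g_cvg x)).
have g_le m x : g m x <= h x.
  rewrite -(cvg_lim (@Rhausdorff R) (g_cvgR x)).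
  by apply: nondecreasing_cvgn_le; [exact: g_nd|exact: cvgP (g_cvgR x)].
have g1 m x : g m x <= 1 by apply: le_trans (g_le m x) _; case/andP: (h01 x).
have g01 m x : 0 <= g m x <= 1 by rewrite fun_ge0 g1.
have Ig_le m : (\int[@area R]_x (g m x)%:E <= \int[@area R]_x (h x)%:E)%E.
  apply: ge0_le_integral => //.
  - by move=> x _; rewrite lee_fin.
  - exact/measurable_EFinP.
  - by move=> x _; rewrite lee_fin.
have Igoo m : (\int[@area R]_x (g m x)%:E < +oo)%E by exact: le_lt_trans hoo.
have Ig_cvg : (\int[@area R]_x (g m x)%:E)%E @[m --> \oo] -->
    (\int[@area R]_x (h x)%:E)%E.
  rewrite (_ : (\int[@area R]_x (h x)%:E)%E =
      (\int[@area R]_x limn (fun n => (g n x)%:E))%E); last first.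
    by apply: eq_integral => x _; rewrite (cvg_lim _ (g_cvg x)).
  apply: cvg_monotone_convergence => //.
  - by move=> n; exact/measurable_EFinP.
  - by move=> n x _; rewrite lee_fin.
  - by move=> x _ m n mn; rewrite lee_fin; exact: g_nd.
have Ih_fin : (\int[@area R]_x (h x)%:E)%E \is a fin_num.
  by rewrite ge0_fin_numE// integral_ge0.
have Ig_fin m : (\int[@area R]_x (g m x)%:E)%E \is a fin_num.
  by rewrite ge0_fin_numE// integral_ge0// => x _; rewrite lee_fin.
pose e (m : nat) := expR (- (mu * fine (\int[@area R]_x (g m x)%:E)%E)).
pose eh := expR (- (mu * fine (\int[@area R]_x (h x)%:E)%E)).
have e_cvg : e m @[m --> \oo] --> eh.
  apply: (continuous_cvg _ (@continuous_expR R _)); apply: cvgN; apply: cvgM; first exact: cvg_cst.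
  by apply: fine_cvg; rewrite fineK.
have eh_le m : eh <= e m.
  by rewrite ler_expR lerN2 ler_wpM2l// fine_le// Ig_le.
have mS (f : plane R -> R) N : measurable_fun setT f ->
    measurable_fun setT (fun w => (survive f N w)%:E).
  by move=> mf; apply/measurable_EFinP/measurable_survive.
have nd_survive (f : plane R -> R) : (forall x, 0 <= f x <= 1) -> measurable_fun setT f ->
    nonincreasing_seq (fun N => \int[P]_w (survive f N w)%:E)%E.
  move=> f01 mf; apply/nonincreasing_seqP => N; apply: ge0_le_integral => //.
  - by move=> w _; rewrite lee_fin survive_ge0// => x; case/andP: (f01 x).
  - exact: mS.
  - exact: mS.
  - move=> w _; rewrite lee_fin /survive big_ord_recr/= ler_piMr//.
      by apply: survive_ge0 => x; case/andP: (f01 x).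
    by rewrite gerBl; case/andP: (f01 (X N w)).
have h1 x : h x <= 1 by case/andP: (h01 x).
pose u N := (\int[P]_w (survive h N w)%:E)%E.
have u_cvg : u @ \oo --> ereal_inf (range u).
  exact/ereal_nonincreasing_cvgn/nd_survive.
have gm_cvg m : (\int[P]_w (survive (g m) N w)%:E)%E @[N --> \oo] --> (e m)%:E.
  exact: PPP_generating_nnsfun.
have e_le m N : ((e m)%:E <= \int[P]_w (survive (g m) N w)%:E)%E.
  have := @ereal_nonincreasing_cvgn _ _ (nd_survive _ (g01 m) (measurable_funP (g m))).
  move=> /(cvg_lim (@ereal_hausdorff R)); rewrite (cvg_lim _ (gm_cvg m))// => ->.
  by apply: ereal_inf_lbound; exists N.
(* No interchange of limits is needed: here m tends to infinity at fixed [N], whereas [upper] lets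
   [N] tend to infinity at fixed m. *)
have lower N : (eh%:E <= u N)%E.
  have [//|||||_ _ gu] := @dominated_convergence _ _ _ P setT measurableT
    (fun m w => (survive (g m) N w)%:E) (fun w => (survive h N w)%:E) (cst 1%E).
  - by move=> m; exact: mS.
  - exact: mS.
  - apply: aeW => w _; apply: cvg_EFin; first exact: nearW.
    apply: (@cvg_big _ _ _ _ _ mul_continuous) => n _.
    by apply: cvgB; [exact: cvg_cst|exact: g_cvgR].
  - apply/integrableP; split; first exact: measurable_cst.
    under eq_integral do rewrite abse1.
    by rewrite integral_cst//= mul1e (le_lt_trans (probability_le1 _ _))// ltry.
  - apply: aeW => w m _.
    by rewrite abse_EFin lee_fin ger0_norm ?survive_le1// survive_ge0.
  rewrite /u -(cvg_lim _ gu)//; apply: lime_ge; first exact: cvgP gu.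
  by apply: nearW => m; apply: le_trans (e_le m N); rewrite lee_fin.
have upper m : (ereal_inf (range u) <= (e m)%:E)%E.
  rewrite -(cvg_lim _ (gm_cvg m))// -(cvg_lim _ u_cvg)//.
  apply: lee_lim.
  - exact: cvgP u_cvg.
  - exact: cvgP (gm_cvg m).
  - apply: nearW => N; apply: ge0_le_integral => //.
    + by move=> w _; rewrite lee_fin; exact: survive_ge0.
    + exact: mS.
    + exact: mS.
    + move=> w _; rewrite lee_fin /survive; apply: ler_prod => n _.
      by rewrite subr_ge0 h1 lerD2l lerN2 g_le.
rewrite -/eh (_ : eh%:E = ereal_inf (range u))//.
apply/eqP; rewrite eq_le; apply/andP; split.
  by apply: le_ereal_inf_tmp => _ [N _ <-].
have e_cvgE : (e m)%:E @[m --> \oo] --> eh%:E by apply: cvg_EFin => //; exact: nearW.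
rewrite -(cvg_lim _ e_cvgE)//; apply: lime_ge; first exact: cvgP e_cvgE.
by apply: nearW => m; exact: upper.
Qed.

End generating.

(** * Void probabilities of the marked process *)

Section missed.
Context (R : realType) (d : measure_display) (Omega : measurableType d).
Context (P : probability Omega R) (E : blockage_env P).

(** Lengths and orientations are retyped with the codomain used in [plane R], so that a mark is a
    point of the plane. *)
Let lenR n : Omega -> measurableTypeR R := len E n.
Let orientR n : Omega -> measurableTypeR R := orient E n.

Let measurable_lenR n : measurable_fun setT (lenR n).
Proof. by move=> mD A mA; rewrite setTI; exact: (@measurable_funPTI _ _ _ _ (len E n) A mA). Qed.

Let measurable_orientR n : measurable_fun setT (orientR n).
Proof. by move=> mD A mA; rewrite setTI; exact: (@measurable_funPTI _ _ _ _ (orient E n) A mA). Qed.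

Definition len_mfun n : {mfun Omega >-> measurableTypeR R} :=
  HB.pack (lenR n) (isMeasurableFun.Build _ _ _ _ _ (@measurable_lenR n)).

Definition orient_mfun n : {mfun Omega >-> measurableTypeR R} :=
  HB.pack (orientR n) (isMeasurableFun.Build _ _ _ _ _ (@measurable_orientR n)).

Definition mark_law : probability (plane R) R :=
  product_probability (distribution P (len_mfun 0)) (uniform_prob (pi_gt0 R)).

Definition missed (K : set (plane R * plane R)) : set Omega :=
  [set w | forall n, ~ K (Defs.center E n w, (len E n w, orient E n w))].

Lemma missedE K : missed K = \bigcap_N \bigcap_(n in `I_N)
  [set w | (~` K) (Defs.center E n w, (len_mfun n w, orient_mfun n w))].
Proof.
apply/seteqP; split=> [w h N _ n _|w h n]; first exact: h.
exact: (h n.+1 I n (ltnSn n)).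
Qed.

Variable K : set (plane R * plane R).
Hypothesis mK : measurable K.

Let cells N := \bigcap_(n in `I_N)
  [set w | (~` K) (Defs.center E n w, (len_mfun n w, orient_mfun n w))].

Let measurable_cells N : measurable (cells N).
Proof.
apply: fin_bigcap_measurable => // n _.
have mf : measurable_fun setT (fun w =>
    ((Defs.center E n w, (len_mfun n w, orient_mfun n w)) : plane R * plane R)).
  by apply: measurable_fun_pair => //; apply: measurable_fun_pair.
by rewrite -[X in measurable X]setTI; apply: mf => //; exact: measurableC.
Qed.

Lemma measurable_missed : measurable (missed K).
Proof. by rewrite missedE; apply: bigcapT_measurable => N; exact: measurable_cells. Qed.

(** Here [h c] is the probability that the mark of a segment centered at c puts it in [K]. The first
    N segments avoid [K] with probability the mean of a product of 1 - h, and Tonelli turns the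
    integral of h over the centers into the mean area of the sections. *)
Lemma probability_missed :
  (\int[mark_law]_z area (ysection K z) < +oo)%E ->
  P (missed K) =
  (expR (- (density E * fine (\int[mark_law]_z area (ysection K z))%E)))%:E.
Proof.
move=> Koo.
pose h c := fine (mark_law (xsection K c)).
have mh : measurable_fun setT h.
  apply: (@measurableT_comp _ _ _ _ _ _ fine _ (fun c => mark_law (xsection K c))).
    exact: fine_measurable.
  exact: (measurable_fun_xsection mark_law mK).
have hE c : mark_law (xsection K c) = (h c)%:E.
  by rewrite fineK// fin_num_measure//; exact: measurable_xsection.
have h01 c : 0 <= h c <= 1.
  by rewrite -!lee_fin -hE measure_ge0 probability_le1//; exact: measurable_xsection.
have Ih : (\int[@area R]_c (h c)%:E = \int[mark_law]_z area (ysection K z))%E.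
  under eq_integral do rewrite -hE.
  transitivity (\int[@area R]_c fubini_F mark_law (EFin \o \1_K) c)%E.
    by apply: eq_integral => c _; rewrite indic_fubini_tonelli_FE.
  rewrite (indic_fubini_tonelli (@area R) mark_law mK).
  by apply: eq_integral => z _; rewrite indic_fubini_tonelli_GE.
have PN N : P (cells N) = (\int[P]_w (\prod_(n < N) (1 - h (Defs.center E n w)))%:E)%E.
  have lenE n A : measurable A -> P (len_mfun n @^-1` A) = distribution P (len_mfun 0) A.
    by move=> mA; exact: (len_ident E n mA).
  have orE n A : measurable A -> P (orient_mfun n @^-1` A) = uniform_prob (pi_gt0 R) A.
    by move=> mA; exact: (orient_unif E n mA).
  rewrite /cells.
  rewrite (@probability_marked_all _ _ _ P (Defs.center E) len_mfun
  orient_mfun _ _ (@marks_indep _ _ _ _ E) lenE orE (~` K) (measurableC mK)).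
  apply: eq_integral => w _; congr (_%:E); apply: eq_bigr => n _.
  rewrite (_ : xsection (~` K) _ = ~` xsection K (Defs.center E n w)).
    rewrite -[product_probability _ _]/mark_law probability_setC; last exact: measurable_xsection.
    by rewrite hE -EFinB.
  apply/seteqP; split=> z /=; rewrite !xsectionE/=; first by [].
  by [].
have PN_cvg : P (cells N) @[N --> \oo] --> P (missed K).
  rewrite missedE; apply: nonincreasing_cvg_mu => //.
  - by rewrite (le_lt_trans (probability_le1 _ _))// ltry.
  - exact: bigcapT_measurable.
  - move=> m n mn; apply/subsetPset => w hw i im; apply: hw => /=.
    exact: leq_trans mn.
rewrite -(cvg_lim _ PN_cvg)//; apply: cvg_lim => //.
under eq_fun do rewrite PN.
rewrite -Ih; apply: PPP_generating => //.
- exact/ltW/density_gt0.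
- exact: center_PPP.
- by rewrite Ih.
Qed.

End missed.

(** * Areas of the hitting sets *)

Lemma lebesgue_measure_cc (R : realType) (u v : R) : u <= v ->
  lebesgue_measure (`[u, v]%classic : set (measurableTypeR R)) = (v - u)%:E.
Proof.
rewrite le_eqVlt => /predU1P[->|uv]; last by rewrite lebesgue_measure_itv/= lte_fin uv.
by rewrite lebesgue_measure_itv/= lte_fin ltxx subrr.
Qed.

Lemma preimage_affine_cc (R : realType) (k b u v : R) : k != 0 ->
  [set y | u <= k * y + b <= v] =
  if 0 < k then `[(u - b) / k, (v - b) / k]%classic
  else `[(v - b) / k, (u - b) / k]%classic.
Proof.
move=> k0; case: ifPn => [kp|]; last rewrite -leNgt le_eqVlt (negbTE k0)/= => kn.
  apply/seteqP; split=> y /=; rewrite in_itv/= ler_pdivrMr// ler_pdivlMr//;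
    by rewrite [y * k]mulrC lerBlDr lerBrDr.
apply/seteqP; split=> y /=; rewrite in_itv/= ler_ndivrMr// ler_ndivlMr//;
  by rewrite [y * k]mulrC lerBlDr lerBrDr andbC.
Qed.

Lemma lebesgue_measure_affine_cc (R : realType) (k b u v : R) : k != 0 -> u <= v ->
  lebesgue_measure ([set y | u <= k * y + b <= v] : set (measurableTypeR R)) =
  ((v - u) / `|k|)%:E.
Proof.
move=> k0 uv; rewrite preimage_affine_cc//; case: ifPn => [kp|].
  rewrite lebesgue_measure_cc ?ler_pM2r ?invr_gt0// ?lerB// gtr0_norm//.
  by congr (_%:E); field.
rewrite -leNgt le_eqVlt (negbTE k0)/= => kn.
rewrite lebesgue_measure_cc ?ler_nM2r ?invr_lt0// ?lerB// ltr0_norm//.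
by congr (_%:E); field.
Qed.

Lemma measurable_affine (R : realType) (k b : R) :
  measurable_fun setT (fun y : measurableTypeR R => k * y + b : measurableTypeR R).
Proof. by apply: measurable_funD => //; exact: measurable_funM. Qed.

(** By uniqueness of Lebesgue measure: [|k|] times the image measure gives half-open intervals their
    length. *)
Lemma lebesgue_measure_preimage_affine (R : realType) (k b : R)
    (A : set (measurableTypeR R)) : k != 0 -> measurable A ->
  lebesgue_measure ([set y | A (k * y + b)] : set (measurableTypeR R)) =
  (`|k|^-1%:E * lebesgue_measure A)%E.
Proof.
move=> k0 mA; have k0' : 0 <= `|k|^-1 by rewrite invr_ge0.
have k0n : 0 <= `|k| by [].
pose m : {measure set (measurableTypeR R) -> \bar R} :=
  measure_function_pushforward__canonical__measure_function_Measure
    (@lebesgue_measure R) (measurable_affine k b).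
have mE B : m B = lebesgue_measure [set y | B (k * y + b)] by [].
rewrite -mE (@lebesgue_measure_unique R (mscale (NngNum k0n) m) _ A mA).
  by rewrite /mscale/= muleA -EFinM mulVf ?normr_eq0// mul1e.
move=> _ [[u v] _ <-].
change (lebesgue_measure `]u, v] =
    `|k|%:E * lebesgue_measure [set y : measurableTypeR R | (k * y + b)%R \in `]u, v]])%E.
have [kp|] := boolP (0 < k); last rewrite -leNgt le_eqVlt (negbTE k0)/= => kn.
  rewrite (_ : [set y | k * y + b \in _] = `](u - b) / k, (v - b) / k]%classic); last first.
    apply/seteqP; split=> y /=; rewrite !in_itv/= ltr_pdivrMr// ler_pdivlMr//;
      by rewrite [y * k]mulrC ltrBlDr lerBrDr.
  rewrite !lebesgue_measure_itv/= !lte_fin ltr_pM2r ?invr_gt0// ltrD2r.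
  case: ifP => _; rewrite ?mule0// -!EFinB -EFinM gtr0_norm//.
  by congr (_%:E); field.
(* A negative slope reverses the interval, so the closed end moves to the left. *)
rewrite (_ : [set y | k * y + b \in _] = `[(v - b) / k, (u - b) / k[%classic); last first.
  apply/seteqP; split=> y /=; rewrite !in_itv/= ltr_ndivlMr// ler_ndivrMr//;
    by rewrite [y * k]mulrC ltrBlDr lerBrDr andbC.
rewrite !lebesgue_measure_itv/= !lte_fin ltr_nM2r ?invr_lt0// ltrD2r.
case: ifP => _; rewrite ?mule0// -!EFinB -EFinM ltr0_norm//.
by congr (_%:E); field.
Qed.

Lemma area_ysection (R : realType) (S : set (plane R)) : measurable S ->
  area S = (\int[@lebesgue_measure R]_y lebesgue_measure (ysection S y))%E.
Proof.
move=> mS; pose m2 := (@lebesgue_measure R \x^ @lebesgue_measure R)%E.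
rewrite -[RHS]/(m2 S); apply: product_measure_unique => // A B mA mB.
exact: product_measure2E.
Qed.

Lemma measurable_strip (R : realType) (a b u v : R) :
  measurable ([set z | u <= a * z.1 + b * z.2 <= v] : set (plane R)).
Proof.
have mf : measurable_fun setT (fun z : plane R => a * z.1 + b * z.2 : measurableTypeR R).
  by apply: measurable_funD; apply: measurable_funM.
rewrite (_ : [set _ | _] = (fun z : plane R => a * z.1 + b * z.2) @^-1` `[u, v]).
  by rewrite -[X in measurable X]setTI; apply: mf => //; exact: measurable_itv.
by apply/seteqP; split=> z /=; rewrite in_itv.
Qed.

(* When [b != 0], the substitution of [p = a c1 + b c2] for [c2] followed by an
   exchange of the order of integration reduces the area to that of a
   parallelogram with two sides parallel to an axis. *)
Lemma area_parallelogram (R : realType) (a b c e u0 u1 v0 v1 : R) :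
  a * e - b * c != 0 -> u0 <= u1 -> v0 <= v1 ->
  area [set x : plane R | u0 <= a * x.1 + b * x.2 <= u1 /\
                          v0 <= c * x.1 + e * x.2 <= v1] =
  ((u1 - u0) * (v1 - v0) / `|a * e - b * c|)%:E.
Proof.
move=> D0 u01 v01; set S := [set x | _].
have u10 : 0 <= u1 - u0 by rewrite subr_ge0.
have mS : measurable S.
  by exact: (measurableI _ _ (measurable_strip a b u0 u1) (measurable_strip c e v0 v1)).
(* With [b = 0] the first condition involves only the first coordinate, and every nonempty vertical
   section has length (v1 - v0) / |e|. *)
have [b0|b0] := eqVneq b 0.
  have [a0 e0] : a != 0 /\ e != 0.
    by move: D0; rewrite b0 mul0r subr0 mulf_eq0 negb_or => /andP.
  pose A : set (measurableTypeR R) := [set y | u0 <= a * y + 0 <= u1].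
  have mA : measurable A.
    by rewrite /A preimage_affine_cc//; case: ifP => _; exact: measurable_itv.
  transitivity (\int[@lebesgue_measure R]_x (((v1 - v0) / `|e|)%:E * (\1_A x)%:E))%E.
    apply: eq_integral => x _ /=; rewrite indicE.
    have [xA|xA] := boolP (x \in A).
      rewrite mule1 -[RHS](@lebesgue_measure_affine_cc R e (c * x))//.
      congr (lebesgue_measure _); apply/seteqP; split=> y; rewrite xsectionE/=.
        by move=> [_]; rewrite addrC.
      move=> h; split; last by rewrite addrC.
      by move: xA => /set_mem; rewrite /A/= b0 mul0r.
    rewrite mule0 (_ : xsection _ _ = set0) ?measure0// -subset0 => y.
    rewrite xsectionE/= => -[]; rewrite b0 mul0r => h _.
    by move/negP: xA; apply; apply: mem_set.
  rewrite ge0_integralZl//; last 2 first.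
  - by apply/measurable_EFinP; exact: measurable_indic.
  - by rewrite lee_fin divr_ge0// subr_ge0.
  rewrite integral_indic// setIT.
  rewrite [X in (_ * X)%E](lebesgue_measure_affine_cc 0 a0 u01) -EFinM.
  rewrite b0 mul0r subr0 normrM; congr (_%:E); field.
  by rewrite !normr_eq0 e0.
(* With p = a x1 + b x2, the second form becomes c x1 + e x2 = g x1 + (e / b) p, and the determinant
   is - b g. *)
pose g := c - e * a / b.
have g0 : g != 0.
  apply: contra D0 => /eqP; rewrite /g => h.
  have -> : a * e - b * c = - b * (c - e * a / b) by field.
  by rewrite h mulr0.
pose T : set (plane R) := [set x | u0 <= 0 * x.1 + 1 * x.2 <= u1 /\
   v0 <= g * x.1 + e / b * x.2 <= v1].
have mT : measurable T.
  exact: (measurableI _ _ (measurable_strip 0 1 u0 u1) (measurable_strip g (e / b) v0 v1)).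
transitivity (`|b|^-1%:E * area T)%E.
  rewrite /area /product_measure1 -ge0_integralZl//;
    last exact: (measurable_fun_xsection (@lebesgue_measure R) mT).
  apply: eq_integral => x _ /=.
  rewrite -(lebesgue_measure_preimage_affine (a * x) b0); last exact: measurable_xsection.
  congr (lebesgue_measure _); apply/seteqP; split=> y; rewrite !xsectionE/= /S /T/=
    mul0r add0r mul1r [b * y + _]addrC
    (_ : g * x + e / b * (a * x + b * y) = c * x + e * y)//; by rewrite /g; field.
have -> : area T = (((v1 - v0) / `|g|) * (u1 - u0))%:E.
  rewrite area_ysection//.
  transitivity (\int[@lebesgue_measure R]_y (((v1 - v0) / `|g|)%:E *
      (\1_(`[u0, u1] : set (measurableTypeR R)) y)%:E))%E.
    apply: eq_integral => y _ /=; rewrite indicE.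
    have [yA|yA] := boolP (y \in _).
      rewrite mule1 -(@lebesgue_measure_affine_cc R g (e / b * y))//.
      congr (lebesgue_measure _); apply/seteqP; split=> x; rewrite ysectionE/=.
        by case.
      move=> h; split=> //.
      by move: yA => /set_mem; rewrite /= in_itv/= mul0r add0r mul1r.
    rewrite mule0 (_ : ysection _ _ = set0) ?measure0// -subset0 => x.
    rewrite ysectionE/= => -[]; rewrite mul0r add0r mul1r => h _.
    by move/negP: yA; apply; apply: mem_set; rewrite /= in_itv.
  rewrite ge0_integralZl//; last 2 first.
  - by apply/measurable_EFinP; exact: (measurable_indic (measurable_itv `[u0, u1])).
  - by rewrite lee_fin divr_ge0// subr_ge0.
  rewrite integral_indic//.
  by rewrite setIT [X in (_ * X)%E](lebesgue_measure_cc u01) -EFinM.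
rewrite -EFinM (_ : a * e - b * c = - (b * g)); last by rewrite /g; field.
rewrite normrN normrM; congr (_%:E); field.
by rewrite !normr_eq0 b0 g0.
Qed.

Section hits.
Context (R : realType).
Implicit Types (c : plane R) (l a t theta : R).

(* [c + s u_a = sigma u_theta] gives [p = - sigma D] and [q = - s D], where
   [D = sin (theta - a)] and [p], [q] are the cross products of [c] with the two
   directions; the conditions on [sigma], [s] are multiplied by [D ^+ 2].  When
   [D = 0] both segments are parallel and must lie on the same line. *)
Definition hits c l a t theta : bool :=
  let D := sin (theta - a) in
  let p := c.1 * sin a - c.2 * cos a in
  let q := c.1 * sin theta - c.2 * cos theta in
  let v := c.1 * cos theta + c.2 * sin theta in
  if D == 0 then [&& q == 0, - (l / 2) <= v & v <= t + l / 2]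
  else [&& 0 <= - p * D, - p * D <= t * D ^+ 2,
           - (l / 2) * D ^+ 2 <= - q * D & - q * D <= l / 2 * D ^+ 2].

Lemma hitsP c l a t theta : 0 <= l -> 0 <= t ->
  blockage c l a `&` link t theta !=set0 <-> hits c l a t theta.
Proof.
move=> l0 t0; rewrite /hits sinB.
have Sa := cos2Dsin2 a; have St := cos2Dsin2 theta.
set D := _ - _; split.
- move=> [x [[s + <-] [sg + [E1 E2]]]]; rewrite /= !in_itv/= => /andP[s1 s2] /andP[g0 gt].
  have c1E : c.1 = sg * cos theta - s * cos a by rewrite E1 addrK.
  have c2E : c.2 = sg * sin theta - s * sin a by rewrite E2 addrK.
  have pE : - (c.1 * sin a - c.2 * cos a) = sg * D by rewrite c1E c2E /D; ring.
  have qE : - (c.1 * sin theta - c.2 * cos theta) = s * D by rewrite c1E c2E /D; ring.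
  case: eqP => [D0|/eqP D0].
    rewrite -oppr_eq0 qE D0 mulr0 eqxx/=.
    (* This is cos (theta - a); with [D = 0] it is 1 or -1, according to whether the directions
       agree or are opposite. *)
    pose e := cos theta * cos a + sin theta * sin a.
    have e2 : e ^+ 2 = 1.
      have : e ^+ 2 + D ^+ 2 = (cos theta ^+ 2 + sin theta ^+ 2) * (cos a ^+ 2 + sin a ^+ 2).
        by rewrite /e /D; ring.
      by rewrite D0 St Sa expr0n addr0 mulr1.
    have -> : c.1 * cos theta + c.2 * sin theta = sg - s * e.
      rewrite c1E c2E /e.
      transitivity (sg * (cos theta ^+ 2 + sin theta ^+ 2) - s * e); first by rewrite /e; ring.
      by rewrite St mulr1.
    have := e2 => /eqP; rewrite sqrf_eq1 => /orP[] /eqP ->; lra.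
  rewrite pE qE -[sg * D * D]mulrA -[s * D * D]mulrA -!expr2 !ler_pM2r ?exprn_even_gt0// s1 s2 gt !andbT.
  by rewrite mulr_ge0// sqr_ge0.
- case: eqP => [D0|/eqP D0].
    move=> /and3P[/eqP q0 v1 v2].
    pose e := cos theta * cos a + sin theta * sin a.
    have ca : cos a = e * cos theta.
      have : cos a * (cos theta ^+ 2 + sin theta ^+ 2) = e * cos theta + D * sin theta.
        by rewrite /e /D; ring.
      by rewrite St D0 mulr1 mul0r addr0.
    have sa : sin a = e * sin theta.
      have : sin a * (cos theta ^+ 2 + sin theta ^+ 2) = e * sin theta - D * cos theta.
        by rewrite /e /D; ring.
      by rewrite St D0 mulr1 mul0r subr0.
    have e2 : e ^+ 2 = 1.
      have : e ^+ 2 + D ^+ 2 = (cos theta ^+ 2 + sin theta ^+ 2) * (cos a ^+ 2 + sin a ^+ 2).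
        by rewrite /e /D; ring.
      by rewrite D0 St Sa expr0n addr0 mulr1.
    set v := c.1 * cos theta + c.2 * sin theta in v1 v2.
    have c1E : c.1 = v * cos theta.
      have : c.1 * (cos theta ^+ 2 + sin theta ^+ 2) =
        v * cos theta + (c.1 * sin theta - c.2 * cos theta) * sin theta by rewrite /v; ring.
      by rewrite St q0 mulr1 mul0r addr0.
    have c2E : c.2 = v * sin theta.
      have : c.2 * (cos theta ^+ 2 + sin theta ^+ 2) =
        v * sin theta - (c.1 * sin theta - c.2 * cos theta) * cos theta by rewrite /v; ring.
      by rewrite St q0 mulr1 mul0r subr0.
    (* The center lies on the line of the link at abscissa [v]; the nearest point of the link has
       abscissa [sg], at distance at most l / 2 from it. *)
    pose sg := if v < 0 then 0 else if t < v then t else v.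
    have sg_itv : 0 <= sg <= t.
      by rewrite /sg; case: ltP => ?; [|case: ltP => ?]; lra.
    have dv : - (l / 2) <= sg - v <= l / 2.
      by rewrite /sg; case: ltP => ?; [|case: ltP => ?]; lra.
    exists (sg * cos theta, sg * sin theta); split; last first.
      by exists sg => //=; rewrite in_itv.
    exists ((sg - v) * e).
      rewrite /= in_itv/=.
      by move/eqP : e2; rewrite sqrf_eq1 => /orP[] /eqP ->; lra.
    have ee x : (sg - v) * e * (e * x) = (sg - v) * x.
      by rewrite (_ : _ * _ = (sg - v) * e ^+ 2 * x); [rewrite e2 mulr1|ring].
    by congr (_, _); rewrite ?c1E ?c2E ?ca ?sa ee; ring.
  set p := c.1 * _ - _; set q := c.1 * _ - _.
  have pD : - p * D = (- p / D) * D ^+ 2 by field.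
  have qD : - q * D = (- q / D) * D ^+ 2 by field.
  have D2 : 0 < D ^+ 2 by rewrite exprn_even_gt0.
  rewrite pD qD !ler_pM2r// pmulr_lge0// => /and4P[p0 p1 q0 q1].
  (* Cramer's rule for the crossing point: its abscissa is - p / D on the link and - q / D on the
     segment. *)
  exists ((- p / D) * cos theta, (- p / D) * sin theta); split; last first.
    by exists (- p / D) => //=; rewrite in_itv/= p0.
  exists (- q / D); first by rewrite /= in_itv/= q0.
  have H1 : c.1 * D - q * cos a = - p * cos theta by rewrite /D /p /q; ring.
  have H2 : c.2 * D - q * sin a = - p * sin theta by rewrite /D /p /q; ring.
  congr (_, _).
    transitivity ((c.1 * D - q * cos a) / D); first by field.
    by rewrite H1; field.
  transitivity ((c.2 * D - q * sin a) / D); first by field.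
  by rewrite H2; field.
Qed.

Let measurable_sinR : measurable_fun setT (@sin R).
Proof. by apply: continuous_measurable_fun; exact: continuous_sin. Qed.

Let measurable_cosR : measurable_fun setT (@cos R).
Proof. by apply: continuous_measurable_fun; exact: continuous_cos. Qed.

(** Every argument may vary: the center and the mark in order to take areas and means, the length
    and direction of the link for the joint measurability of p_LL. *)
Lemma measurable_hits (d : measure_display) (T : measurableType d)
    (c : T -> plane R) (l a t theta : T -> R) :
  measurable_fun setT c -> measurable_fun setT l -> measurable_fun setT a ->
  measurable_fun setT t -> measurable_fun setT theta ->
  measurable_fun setT (fun x => hits (c x) (l x) (a x) (t x) (theta x)).
Proof.
move=> mc ml ma mt mth.
have mc1 : measurable_fun setT (fun x => (c x).1 : R) by exact: (measurableT_comp measurable_fst mc).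
have mc2 : measurable_fun setT (fun x => (c x).2 : R) by exact: (measurableT_comp measurable_snd mc).
have msa := measurableT_comp measurable_sinR ma.
have mca := measurableT_comp measurable_cosR ma.
have mst := measurableT_comp measurable_sinR mth.
have mct := measurableT_comp measurable_cosR mth.
have mD := measurableT_comp measurable_sinR (measurable_funB mth ma).
have ml2 : measurable_fun setT (fun x => l x / 2 : R) by exact: measurable_funM.
have ml2N : measurable_fun setT (fun x => - (l x / 2) : R) by exact: measurableT_comp.
have mp := measurable_funB (measurable_funM mc1 msa) (measurable_funM mc2 mca).
have mq := measurable_funB (measurable_funM mc1 mst) (measurable_funM mc2 mct).
have mv := measurable_funD (measurable_funM mc1 mct) (measurable_funM mc2 mst).
have mpD := measurable_funM (measurable_funN mp) mD.
have mqD := measurable_funM (measurable_funN mq) mD.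
have mD2 := measurable_funX 2 mD.
rewrite /hits; apply: measurable_fun_ifT.
- by apply: measurable_fun_eqr.
- apply: measurable_and; first exact: measurable_fun_eqr.
  apply: measurable_and; first exact: measurable_fun_ler.
  by apply: measurable_fun_ler => //; exact: measurable_funD.
- apply: measurable_and; first exact: measurable_fun_ler.
  apply: measurable_and.
    by apply: measurable_fun_ler => //; exact: measurable_funM.
  apply: measurable_and.
    by apply: measurable_fun_ler => //; exact: measurable_funM.
  by apply: measurable_fun_ler => //; exact: measurable_funM.
Qed.

End hits.

(** * Integrals on intervals and the positive part of the sine *)

Section real_integrals.
Context (R : realType).
Local Notation mu := (@lebesgue_measure R).

Lemma integral_is_derive (f F : R -> R) (a b : R) : a <= b ->
  (forall x : R, is_derive x 1 F (f x)) -> continuous f ->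
  (\int[mu]_(x in `[a, b]) (f x)%:E = (F b - F a)%:E)%E.
Proof.
rewrite le_eqVlt => /predU1P[->|ab] dF cf.
  by rewrite set_itv1 integral_set1 subrr.
have cF x : {for x, continuous F}.
  by apply: differentiable_continuous; apply/derivable1_diffP; have [] := dF x.
rewrite (@continuous_FTC2 _ f F a b)// ?EFinB//.
- exact: continuous_subspaceT.
- split=> [x _||]; first by have [] := dF x.
  + by apply: cvg_at_right_filter; exact: cF.
  + by apply: cvg_at_left_filter; exact: cF.
- by move=> x _; rewrite derive1E; have [_ ->] := dF x.
Qed.

Lemma ge0_integral_itv_split (f : R -> \bar R) (a c b : R) : a <= c -> c <= b ->
  measurable_fun setT f -> (forall x, 0 <= f x)%E ->
  (\int[mu]_(x in `[a, b]) f x =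
   \int[mu]_(x in `[a, c]) f x + \int[mu]_(x in `[c, b]) f x)%E.
Proof.
move=> ac cb mf f0.
rewrite (_ : `[a, b]%classic = `[a, c[ `|` `[c, b]); last first.
  by rewrite -itv_bndbnd_setU// bnd_simp.
rewrite ge0_integral_setU//; last 2 first.
- exact: measurable_funTS.
- apply/disj_set2P; rewrite -subset0 => x []/=; rewrite !in_itv/= => /andP[_ xc] /andP[cx _].
  by rewrite leNgt xc in cx.
by rewrite integral_itv_bndo_bndc//; exact: measurable_funTS.
Qed.

Lemma measurable_sin_max (theta : R) :
  measurable_fun setT (fun a : R => (Num.max 0 (sin (a - theta)))%:E).
Proof.
apply/measurable_EFinP; apply: measurable_maxr => //.
have msin : measurable_fun setT (@sin R).
  by apply: continuous_measurable_fun; exact: continuous_sin.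
by apply: (measurableT_comp msin); exact: measurable_funB.
Qed.

Lemma integral_sin_shift (theta a b : R) : a <= b ->
  (\int[mu]_(x in `[a, b]) (sin (x - theta))%:E =
   (cos (a - theta) - cos (b - theta))%:E)%E.
Proof.
move=> ab; have dF (x : R) : is_derive x 1 (fun x => - cos (x - theta)) (sin (x - theta)).
  have d1 : is_derive x 1 (fun x : R => x - theta) 1.
    by apply: is_derive_eq; rewrite subr0.
  have := is_deriveN (@is_derive1_comp R cos (fun x => x - theta) x _ _ (is_derive_cos _) d1).
  by rewrite mulr1 opprK.
rewrite (integral_is_derive ab dF) ?opprK 1?addrC//.
by move=> x; apply: continuous_comp;
  [apply: cvgB; [exact: cvg_id|exact: cvg_cst]|exact: continuous_sin].
Qed.

Lemma sin_le0 (x : R) : - pi <= x <= 0 -> sin x <= 0.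
Proof.
move=> /andP[x1 x2]; rewrite -oppr_ge0 -sinN; apply: sin_ge0_pi.
by rewrite oppr_ge0 x2 lerNl.
Qed.

(** The sine is nonnegative on [theta, pi] when theta <= pi and on [0, theta - pi] otherwise; the
    two cases give the same value. *)
Lemma integral_sin_max (theta : R) : 0 <= theta <= 2 * pi ->
  (\int[mu]_(a in `[0%R, pi]) (Num.max 0 (sin (a - theta)))%:E =
   (1 + cos theta)%:E)%E.
Proof.
move=> /andP[t0 t2]; have pi0 := pi_ge0 R.
have f0 (x : R) : (0 <= (Num.max 0 (sin (x - theta)))%:E)%E by rewrite lee_fin le_max lexx.
have pos (a b : R) : a <= b -> (forall x, a <= x <= b -> 0 <= sin (x - theta)) ->
    (\int[mu]_(x in `[a, b]) (Num.max 0 (sin (x - theta)))%:E =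
     (cos (a - theta) - cos (b - theta))%:E)%E.
  move=> ab h; rewrite -integral_sin_shift//; apply: eq_integral => x.
  by rewrite inE/= in_itv/= => /h hx; rewrite (max_idPr hx).
have neg (a b : R) : (forall x, a <= x <= b -> sin (x - theta) <= 0) ->
    (\int[mu]_(x in `[a, b]) (Num.max 0 (sin (x - theta)))%:E = 0)%E.
  move=> h; apply: integral0_eq => x; rewrite /= in_itv/= => /h hx.
  by rewrite (max_idPl hx).
have [tp|/ltW pt] := leP theta pi.
  rewrite (@ge0_integral_itv_split _ 0 theta pi)//; last exact: measurable_sin_max.
  rewrite neg ?add0e; last by move=> x /andP[x0 xt]; apply: sin_le0; lra.
  rewrite pos//; last by move=> x /andP[x0 xt]; apply: sin_ge0_pi; lra.
  by rewrite subrr cos0 cosB cospi sinpi mulN1r mul0r addr0 opprK.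
rewrite (@ge0_integral_itv_split _ 0 (theta - pi) pi)//; [|lra|lra|exact: measurable_sin_max].
rewrite pos; [|lra|].
  rewrite neg ?adde0; last by move=> x /andP[x0 xt]; apply: sin_le0; lra.
  by rewrite sub0r cosN (_ : _ - pi - theta = - pi) ?cosN ?cospi ?opprK 1?addrC//; ring.
(* Two shifts by pi bring x - theta from [- 2 pi, - pi] into [0, pi]. *)
move=> x /andP[x0 xt]; rewrite -[sin _]opprK -sinDpi -sinDpi; apply: sin_ge0_pi.
by lra.
Qed.

End real_integrals.

Section hit_areas.
Context (R : realType).
Implicit Types l a t theta : R.

Lemma measurable_hits_center l a t theta :
  measurable [set c : plane R | hits c l a t theta].
Proof.
rewrite -[X in measurable X]setTI.
by apply: (@measurable_hits R _ (plane R) id (cst l) (cst a) (cst t) (cst theta)) => //.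
Qed.

(** For [D = 0] the set is a rectangle of width 0. Otherwise both forms carry a factor [D]: the
    sides are t D^2 and l D^2 and the determinant is D^3, which leaves l t |D|. *)
Lemma area_hits l a t theta : 0 <= l -> 0 <= t ->
  area [set c : plane R | hits c l a t theta] = (l * (t * `|sin (theta - a)|))%:E.
Proof.
move=> l0 t0; rewrite /hits; set D := sin (theta - a).
have DE : D = sin theta * cos a - cos theta * sin a by rewrite /D sinB.
have l2 : - (l / 2) <= l / 2 by lra.
have [D0|D0] := eqVneq D 0.
  have v2 : - (l / 2) <= t + l / 2 by lra.
  have det1 : sin theta * sin theta - - cos theta * cos theta = 1.
    by rewrite -(cos2Dsin2 theta); ring.
  rewrite (_ : [set c | _] = [set x : plane R |
      0 <= sin theta * x.1 + - cos theta * x.2 <= 0 /\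
      - (l / 2) <= cos theta * x.1 + sin theta * x.2 <= t + l / 2]).
    rewrite area_parallelogram ?det1 ?oner_neq0//.
    by rewrite subrr mul0r mul0r D0 normr0 mulr0 mulr0.
  apply/seteqP; split=> c /=; rewrite !(mulrC _ c.1) !(mulrC _ c.2) mulrN -eq_le eq_sym.
    by move=> /and3P[-> -> ->].
  by move=> [-> /andP[-> ->]].
have D2 : 0 < D ^+ 2 by rewrite exprn_even_gt0.
have det : (- sin a * D) * (cos theta * D) - (cos a * D) * (- sin theta * D) = D ^+ 3.
  by rewrite [in RHS]DE DE; ring.
rewrite (_ : [set c | _] = [set x : plane R |
    0 <= (- sin a * D) * x.1 + (cos a * D) * x.2 <= t * D ^+ 2 /\
    - (l / 2) * D ^+ 2 <= (- sin theta * D) * x.1 + (cos theta * D) * x.2 <= l / 2 * D ^+ 2]).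
  rewrite area_parallelogram ?det ?expf_neq0//.
  - have -> : `|D ^+ 3| = `|D| ^+ 3 by rewrite normrX.
    by rewrite -(real_normK (num_real D)); congr (_%:E); field; rewrite normr_eq0.
  - by apply: mulr_ge0 => //; exact: ltW.
  - by rewrite ler_pM2r.
have E1 (c : plane R) : - (c.1 * sin a - c.2 * cos a) * D =
    - sin a * D * c.1 + cos a * D * c.2 by ring.
have E2 (c : plane R) : - (c.1 * sin theta - c.2 * cos theta) * D =
    - sin theta * D * c.1 + cos theta * D * c.2 by ring.
apply/seteqP; split=> c /=; rewrite E1 E2.
  by move=> /and4P[-> -> -> ->].
by move=> [/andP[-> ->] /andP[-> ->]].
Qed.

(* Two links on opposite sides of the line through the origin of direction [a]
   can only be hit by the same segment if it passes through the origin. *)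
Lemma area_hits_both l a x t theta : 0 <= l -> 0 <= t -> 0 <= a <= pi ->
  (area [set c : plane R | hits c l a x 0 && hits c l a t theta] <=
   (l * (t * Num.max 0 (sin (a - theta))))%:E)%E.
Proof.
move=> l0 t0 a0.
have mb : measurable [set c : plane R | hits c l a x 0 && hits c l a t theta].
  rewrite (_ : [set c | _] = [set c | hits c l a x 0] `&` [set c | hits c l a t theta]).
    by apply: measurableI; exact: measurable_hits_center.
  by apply/seteqP; split=> c /= /andP.
have sE : sin (a - theta) = - sin (theta - a) by rewrite -sinN opprB.
(* If the sine is nonpositive, the overlap is bounded by the whole set of the second link. If it is
   positive, the two links force opposite signs on the cross product [p], and the overlap lies in
   the degenerate parallelogram where p = 0. *)
have [D0|D0] := leP (sin (theta - a)) 0.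
  rewrite (max_idPr _) ?sE ?oppr_ge0// -(ler0_norm D0) -area_hits//.
  by apply: le_measure; rewrite ?inE//;
    [exact: measurable_hits_center|move=> c /= /andP[]].
rewrite (max_idPl _) ?sE ?oppr_le0 ?(ltW D0)// !mulr0.
set D := sin (theta - a) in D0.
have DE : D = sin theta * cos a - cos theta * sin a by rewrite /D sinB.
have D2 : 0 < D ^+ 2 by exact: exprn_gt0.
have l2 : - (l / 2) * D ^+ 2 <= l / 2 * D ^+ 2 by rewrite ler_pM2r//; lra.
have det : (- sin a * D) * (cos theta * D) - (cos a * D) * (- sin theta * D) = D ^+ 3.
  by rewrite [in RHS]DE DE; ring.
pose S := [set y : plane R |
    0 <= (- sin a * D) * y.1 + (cos a * D) * y.2 <= 0 /\
    - (l / 2) * D ^+ 2 <= (- sin theta * D) * y.1 + (cos theta * D) * y.2 <= l / 2 * D ^+ 2].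
have S0 : area S = 0%E.
  by rewrite area_parallelogram ?det ?expf_neq0 ?gt_eqF// subrr mul0r mul0r.
suff : (area [set c : plane R | hits c l a x 0 && hits c l a t theta] <= area S)%E by rewrite S0.
apply: le_measure; rewrite ?inE//.
  exact: (measurableI _ _ (measurable_strip _ _ _ _) (measurable_strip _ _ _ _)).
move=> c /= /andP[h0 ht].
set p := c.1 * sin a - c.2 * cos a.
have sa0 : 0 <= sin a by exact: sin_ge0_pi.
(* Hitting the link of direction 0 gives p sin a >= 0; when sin a = 0 the center is on the axis and
   p = 0. *)
have p0 : 0 <= p.
  move: h0; rewrite /hits sub0r sinN oppr_eq0 cos0 sin0 -/p; case: eqP => [sa|].
    move=> /andP[/eqP]; rewrite mulr0 mulr1 sub0r => /eqP; rewrite oppr_eq0 => /eqP c2 _.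
    by rewrite /p sa c2 mulr0 mul0r subrr.
  move=> /eqP sa /and4P[+ _ _ _]; rewrite mulrNN pmulr_lge0//.
  by rewrite lt_neqAle eq_sym sa.
move: ht; rewrite /hits -/D gt_eqF// -/p => /and4P[h1 _ h3 h4].
have pE : p = 0.
  apply/eqP; rewrite eq_le p0 andbT.
  by move: h1; rewrite pmulr_lge0// oppr_ge0.
split.
  rewrite (_ : _ + _ = - p * D); last by rewrite /p; ring.
  by rewrite pE oppr0 mul0r lexx.
rewrite (_ : _ + _ = - (c.1 * sin theta - c.2 * cos theta) * D); last by ring.
by rewrite h3.
Qed.

End hit_areas.

(** * Means over the length and the orientation *)

Section mean_areas.
Context (R : realType) (d : measure_display) (Omega : measurableType d).
Context (P : probability Omega R) (E : blockage_env P).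

Local Notation law := (mark_law E).
Local Notation lawL := (distribution P (len_mfun E 0)).
Let EL : R := fine 'E_P[len E 0%N].

Lemma integral_mark_law (g : plane R -> \bar R) : measurable_fun setT g ->
  (forall z, 0 <= g z)%E ->
  (\int[law]_z g z =
   \int[lawL]_l ((pi^-1)%:E * \int[lebesgue_measure]_(a in `[0%R, pi]) g (l, a)))%E.
Proof.
move=> mg g0; rewrite fubini_tonelli1//; apply: eq_integral => l _.
rewrite /fubini_F integral_uniform ?subr0//.
exact: (measurableT_comp mg (pair1_measurable l)).
Qed.

(** The overlap bound is only available for orientations in [0, pi], where the uniform law lives, so
    the comparison is made in the iterated integral. *)
Lemma le_integral_mark_law (g h : plane R -> \bar R) :
  measurable_fun setT g -> measurable_fun setT h ->
  (forall z, 0 <= g z)%E -> (forall z, 0 <= h z)%E ->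
  (forall l a, 0 <= a <= pi -> (g (l, a) <= h (l, a))%E) ->
  (\int[law]_z g z <= \int[law]_z h z)%E.
Proof.
move=> mg mh g0 h0 gh; rewrite !integral_mark_law//.
have pi0 := pi_ge0 R.
have mF (f : plane R -> \bar R) : measurable_fun setT f -> (forall z, 0 <= f z)%E ->
    measurable_fun setT (fun l : measurableTypeR R =>
      (pi^-1)%:E * \int[lebesgue_measure]_(a in `[0%R, pi]) f (l, a))%E.
  move=> mf f0.
  have := @measurable_fun_fubini_tonelli_F _ _ _ _ _ (uniform_prob (pi_gt0 R)) f mf f0.
  apply: eq_measurable_fun => l _.
  rewrite /fubini_F integral_uniform ?subr0//.
  exact: (measurableT_comp mf (pair1_measurable l)).
have ge0 (f : plane R -> \bar R) l : (forall z, 0 <= f z)%E ->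
    (0 <= (pi^-1)%:E * \int[lebesgue_measure]_(a in `[0%R, pi]) f (l, a))%E.
  move=> f0; apply: mule_ge0; first by rewrite lee_fin invr_ge0.
  by apply: integral_ge0 => a _.
apply: ge0_le_integral => //.
- by move=> l _; exact: ge0.
- exact: mF.
- exact: mF.
- move=> l _; apply: lee_wpmul2l; first by rewrite lee_fin invr_ge0.
  apply: ge0_le_integral => //.
  + apply: measurable_funTS; exact: (measurableT_comp mg (pair1_measurable l)).
  + apply: measurable_funTS; exact: (measurableT_comp mh (pair1_measurable l)).
  + by move=> a; rewrite /= in_itv/= => /gh.
Qed.

Lemma expectation_lenE : ('E_P[len E 0%N] = EL%:E)%E.
Proof.
rewrite fineK// ge0_fin_numE ?len_mean_fin//.
exact/ltW/len_mean_gt0.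
Qed.

Lemma integral_law_len : (\int[lawL]_l (Num.max 0 l)%:E = EL%:E)%E.
Proof.
have mm : measurable_fun setT (fun l : measurableTypeR R => (Num.max 0 l)%:E).
  by apply/measurable_EFinP; exact: measurable_maxr.
rewrite /distribution ge0_integral_pushforward//; last first.
  by move=> l _; rewrite lee_fin le_max lexx.
rewrite -expectation_lenE unlock preimage_setT; apply: eq_integral => w _ /=.
by rewrite (max_idPr (len_ge0 E 0 w)).
Qed.

Lemma integral_mark_law_prod (f : R -> R) (I : R) :
  measurable_fun setT f -> (forall a, 0 <= f a) ->
  (\int[lebesgue_measure]_(a in `[0%R, pi]) (f a)%:E = I%:E)%E ->
  (\int[law]_z (Num.max 0 z.1 * f z.2)%:E = (EL * I / pi)%:E)%E.
Proof.
move=> mf f0 fI.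
have I0 : 0 <= I.
  by rewrite -lee_fin -fI; apply: integral_ge0 => a _; rewrite lee_fin.
have m0 (l : R) : 0 <= Num.max 0 l by rewrite le_max lexx.
rewrite integral_mark_law; last 2 first.
- apply/measurable_EFinP/measurable_funM.
    by apply: measurable_maxr => //; exact: measurable_fst.
  exact: (measurableT_comp mf measurable_snd).
- by move=> z; rewrite lee_fin mulr_ge0.
have -> : (EL * I / pi)%:E = ((I / pi)%:E * \int[lawL]_l (Num.max 0 l)%:E)%E.
  by rewrite integral_law_len -EFinM; congr (_%:E); ring.
rewrite -ge0_integralZl//; last 3 first.
- by apply/measurable_EFinP; exact: measurable_maxr.
- by move=> l _; rewrite lee_fin.
- by rewrite lee_fin divr_ge0// pi_ge0.
apply: eq_integral => l _ /=.
under eq_integral do rewrite EFinM.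
rewrite ge0_integralZl//.
- by rewrite fI -!EFinM; congr (_%:E); ring.
- by apply/measurable_EFinP; exact: measurable_funTS.
- by move=> a _; rewrite lee_fin.
- by rewrite lee_fin.
Qed.

End mean_areas.

(** * Line-of-sight probabilities *)

Lemma measureUI_fin (d : measure_display) (T : measurableType d) (R : realType)
    (mu : {measure set T -> \bar R}) (A B : set T) :
  measurable A -> measurable B -> (mu B < +oo)%E ->
  (mu A + mu B = mu (A `|` B) + mu (A `&` B))%E.
Proof.
move=> mA mB Boo; rewrite measureUfinr// subeK//.
rewrite ge0_fin_numE ?measure_ge0//; apply: le_lt_trans Boo.
by apply: le_measure; rewrite ?inE//; exact: measurableI.
Qed.

(** The absolute value is the sum of two positive parts, the second being that of the direction
    turned by pi; the integrals 1 + cos theta and 1 - cos theta add up to 2. The turn is by +pi or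
    -pi so as to stay in [0, 2 pi]. *)
Lemma integral_abs_sin (R : realType) (theta : R) : 0 <= theta <= 2 * pi ->
  (\int[@lebesgue_measure R]_(a in `[0%R, pi]) `|sin (theta - a)|%:E = 2%:E)%E.
Proof.
move=> t02; have pi0 := pi_ge0 R.
have [th' [t02' th'E cE]] : exists th', [/\ 0 <= th' <= 2 * pi,
    forall a, sin (a - th') = sin (theta - a) & cos th' = - cos theta].
  have [tp|/ltW pt] := leP theta pi.
    exists (theta + pi); split; [lra| |exact: cosDpi].
    by move=> a; rewrite opprD addrA -[sin _]opprK -sinDpi subrK -sinN opprB.
  exists (theta - pi); split; [lra| |].
    by move=> a; rewrite opprB addrCA addrC sinDpi -sinN opprB.
  by rewrite -[LHS]opprK -cosDpi subrK.
transitivity (\int[@lebesgue_measure R]_(a in `[0%R, pi])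
    ((Num.max 0 (sin (a - theta)))%:E + (Num.max 0 (sin (a - th')))%:E))%E.
  apply: eq_integral => a _; rewrite -EFinD; congr (_%:E).
  rewrite th'E -[a - theta]opprB sinN; set s := sin _.
  have [s0|/ltW s0] := leP s 0.
    have Ns0 : 0 <= - s by rewrite oppr_ge0.
    by rewrite ler0_norm// (max_idPr Ns0) addr0.
  have Ns0 : - s <= 0 by rewrite oppr_le0.
  by rewrite ger0_norm// (max_idPl Ns0) add0r.
rewrite ge0_integralD//.
- by rewrite !integral_sin_max// cE -EFinD; congr (_%:E); ring.
- by apply: measurable_funTS; exact: measurable_sin_max.
- by apply: measurable_funTS; exact: measurable_sin_max.
Qed.

Section hitsets.
Context (R : realType).

(** The guard on the length lets the area formula hold for every mark: the law of the length is a
    measure on the whole line, and [hitsP] is stated for nonnegative lengths. *)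
Definition hitset (t theta : R) : set (plane R * plane R) :=
  [set x | (0 <= x.2.1) && hits x.1 x.2.1 x.2.2 t theta].

Lemma measurable_hitset t theta : measurable (hitset t theta).
Proof.
have m1 : measurable_fun setT (fun x : plane R * plane R => x.2.1 : R).
  exact: (measurableT_comp measurable_fst measurable_snd).
have m2 : measurable_fun setT (fun x : plane R * plane R => x.2.2 : R).
  exact: (measurableT_comp measurable_snd measurable_snd).
rewrite -[X in measurable X]setTI.
apply: (@measurable_and _ _ _ (fun x : plane R * plane R => 0 <= x.2.1)
  (fun x => hits x.1 x.2.1 x.2.2 t theta)) => //.
  exact: measurable_fun_ler.
by apply: measurable_hits.
Qed.

Lemma area_hitset t theta (z : plane R) : 0 <= t ->
  area (ysection (hitset t theta) z) =
  (Num.max 0 z.1 * (t * `|sin (theta - z.2)|))%:E.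
Proof.
move=> t0; have [z0|z0] := leP 0 z.1.
  rewrite -area_hits//; congr (area _).
  by apply/seteqP; split=> c; rewrite ysectionE /hitset/= z0.
rewrite mul0r (_ : ysection _ _ = set0) ?measure0// -subset0 => c.
by rewrite ysectionE /hitset/= leNgt z0.
Qed.

Lemma area_hitsetI x t theta (z : plane R) : 0 <= t -> 0 <= z.2 <= pi ->
  (area (ysection (hitset x 0 `&` hitset t theta) z) <=
   (Num.max 0 z.1 * (t * Num.max 0 (sin (z.2 - theta))))%:E)%E.
Proof.
move=> t0 zpi; have [z0|z0] := leP 0 z.1.
  rewrite (_ : ysection _ _ =
      [set c : plane R | hits c z.1 z.2 x 0 && hits c z.1 z.2 t theta]).
    exact: area_hits_both.
  apply/seteqP; split=> c; rewrite ysectionE /hitset/= z0/=.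
    by move=> [-> ->].
  by move=> /andP[-> ->].
rewrite mul0r (_ : ysection _ _ = set0) ?measure0// -subset0 => c.
by rewrite ysectionE /hitset/= leNgt z0/= => -[].
Qed.

End hitsets.

Section link_probabilities.
Context (R : realType) (d : measure_display) (Omega : measurableType d).
Context (P : probability Omega R) (E : blockage_env P).

Local Notation law := (mark_law E).
Let EL : R := fine 'E_P[len E 0%N].

Lemma mean_area_hitset (t theta : R) : 0 <= t -> 0 <= theta <= 2 * pi ->
  (\int[law]_z area (ysection (hitset t theta) z) = (EL * (t * 2) / pi)%:E)%E.
Proof.
move=> t0 th.
have msin : measurable_fun setT (fun a : R => `|sin (theta - a)|).
  have ms : measurable_fun setT (@sin R).
    by apply: continuous_measurable_fun; exact: continuous_sin.
  apply: (measurableT_comp (@normr_measurable R setT)).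
  by apply: (measurableT_comp ms); exact: measurable_funB.
rewrite -(@integral_mark_law_prod _ _ _ _ E (fun a => t * `|sin (theta - a)|) (t * 2)).
- by apply: eq_integral => z _; rewrite area_hitset.
- exact: measurable_funM.
- by move=> a; rewrite mulr_ge0.
- under eq_integral do rewrite EFinM.
  rewrite ge0_integralZl//.
  + by rewrite integral_abs_sin.
  + exact/measurable_EFinP/measurable_funTS.
Qed.

(** Inclusion-exclusion: the upper bound neglects the overlap, and the lower one replaces it by its
    bound [g], whose mean is EL t (1 + cos theta) / pi. *)
Lemma mean_area_hitsetU (x t theta : R) : 0 <= x -> 0 <= t -> 0 <= theta <= 2 * pi ->
  ((EL * (x * 2 + t * 2 - t * (1 + cos theta)) / pi)%:E <=
   \int[law]_z area (ysection (hitset x 0 `|` hitset t theta) z) <=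
   (EL * (x * 2 + t * 2) / pi)%:E)%E.
Proof.
move=> x0 t0 th; have pi0 := pi_ge0 R.
have th0 : 0 <= (0:R) <= 2 * pi by rewrite lexx mulr_ge0.
pose A0 := hitset x 0; pose A1 := hitset t theta.
have mA0 : measurable A0 by exact: measurable_hitset.
have mA1 : measurable A1 by exact: measurable_hitset.
have mU : measurable (A0 `|` A1) by exact: measurableU.
have mI : measurable (A0 `&` A1) by exact: measurableI.
have ma (A : set (plane R * plane R)) : measurable A ->
    measurable_fun setT (fun z => area (ysection A z)).
  by move=> mA; exact: (measurable_fun_ysection (@area R) mA).
have I0 : (\int[law]_z area (ysection A0 z) = (EL * (x * 2) / pi)%:E)%E.
  exact: mean_area_hitset.
have I1 : (\int[law]_z area (ysection A1 z) = (EL * (t * 2) / pi)%:E)%E.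
  exact: mean_area_hitset.
have I01 : (\int[law]_z (area (ysection A0 z) + area (ysection A1 z)) =
    (EL * (x * 2 + t * 2) / pi)%:E)%E.
  rewrite ge0_integralD//; [|exact: ma|exact: ma].
  rewrite [X in (X + _)%E]I0 [X in (_ + X)%E]I1 -EFinD.
  by rewrite -mulrDl -mulrDr.
pose g (z : plane R) := (Num.max 0 z.1 * (t * Num.max 0 (sin (z.2 - theta))))%:E.
have g0 z : (0 <= g z)%E by rewrite lee_fin !mulr_ge0// le_max lexx.
have mms : measurable_fun setT (fun a : R => t * Num.max 0 (sin (a - theta))).
  by apply: measurable_funM => //; apply/measurable_EFinP; exact: measurable_sin_max.
have mg : measurable_fun setT g.
  apply/measurable_EFinP/measurable_funM.
    by apply: measurable_maxr => //; exact: measurable_fst.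
  exact: (measurableT_comp mms measurable_snd).
have Ig : (\int[law]_z g z = (EL * (t * (1 + cos theta)) / pi)%:E)%E.
  rewrite -(@integral_mark_law_prod _ _ _ _ E
    (fun a => t * Num.max 0 (sin (a - theta))) (t * (1 + cos theta)))//.
    by move=> a; rewrite mulr_ge0// le_max lexx.
  under eq_integral do rewrite EFinM.
  rewrite ge0_integralZl//.
  - by rewrite integral_sin_max.
  - by apply: measurable_funTS; exact: measurable_sin_max.
have ysU z : ysection (A0 `|` A1) z = ysection A0 z `|` ysection A1 z.
  by rewrite !ysectionE.
have ysI z : ysection (A0 `&` A1) z = ysection A0 z `&` ysection A1 z.
  by rewrite !ysectionE.
have my (A : set (plane R * plane R)) z : measurable A -> measurable (ysection A z).
  by move=> mA; exact: measurable_ysection.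
have hiU z : (area (ysection (A0 `|` A1) z) <= area (ysection A0 z) + area (ysection A1 z))%E.
  by rewrite ysU; apply: measureU2; exact: my.
have UI z : (area (ysection A0 z) + area (ysection A1 z) =
    area (ysection (A0 `|` A1) z) + area (ysection (A0 `&` A1) z))%E.
  have fA1 : (area (ysection A1 z) < +oo)%E by rewrite area_hitset// ltry.
  by rewrite ysU ysI; apply: measureUI_fin => //; exact: my.
apply/andP; split; last first.
  by rewrite -I01; apply: ge0_le_integral => //; [exact: ma|apply: emeasurable_funD; exact: ma].
have : (\int[law]_z (area (ysection A0 z) + area (ysection A1 z)) <=
    \int[law]_z (area (ysection (A0 `|` A1) z) + g z))%E.
  apply: le_integral_mark_law.
  - by apply: emeasurable_funD; exact: ma.
  - by apply: emeasurable_funD => //; exact: ma.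
  - by move=> z; exact: adde_ge0.
  - by move=> z; exact: adde_ge0.
  - by move=> l a api; rewrite UI leeD2l//; exact: area_hitsetI.
rewrite I01 ge0_integralD//; last exact: ma.
rewrite Ig -leeBlDr// -EFinB => h; apply: le_trans h.
by rewrite lee_fin -mulrBl -mulrBr.
Qed.

Lemma LoS_missed (r theta : R) : 0 <= r -> LoS E r theta = missed E (hitset r theta).
Proof.
move=> r0; apply/seteqP; split=> w h n.
  move=> /= /andP[l0 hn].
  by have := (hitsP _ _ _ l0 r0).2 hn; rewrite h => -[x []].
apply/eqP/negPn/negP => /set0P hne; apply: (h n) => /=.
by apply/andP; split; [exact: len_ge0|apply/hitsP => //; exact: len_ge0].
Qed.

Lemma LoSI_missed (x t theta : R) : 0 <= x -> 0 <= t ->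
  LoS E x 0 `&` LoS E t theta = missed E (hitset x 0 `|` hitset t theta).
Proof.
move=> x0 t0; rewrite !LoS_missed//; apply/seteqP; split=> w.
  by move=> [h1 h2] n [/h1|/h2].
by move=> h; split=> n hn; apply: (h n); [left|right].
Qed.

Lemma measurable_LoS (r theta : R) : 0 <= r -> measurable (LoS E r theta).
Proof. by move=> r0; rewrite LoS_missed//; apply: measurable_missed; exact: measurable_hitset. Qed.

(** Conversion of units: since beta = 2 mu E[L] / pi, a mean area EL s / pi contributes beta s / 2
    to the exponent. *)
Lemma density_EL (s : R) : density E * (EL * s / pi) = beta E * (s / 2).
Proof.
have : pi != 0 :> R by rewrite gt_eqF ?pi_gt0.
by rewrite /beta -/EL; move: pi => p p0; field.
Qed.

Lemma pLE (r : R) : 0 <= r -> pL E r = expR (- (beta E * r)).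
Proof.
move=> r0; have th0 : 0 <= (0:R) <= 2 * pi by rewrite lexx mulr_ge0// pi_ge0.
rewrite /pL LoS_missed// probability_missed.
- by rewrite mean_area_hitset//= density_EL mulfK.
- exact: measurable_hitset.
- by rewrite mean_area_hitset// ltry.
Qed.

Let mean_area x (y : plane R) : \bar R :=
  (\int[law]_z area (ysection (hitset x 0 `|` hitset y.1 y.2) z))%E.

(** A version of [pLL] that is defined by a formula, hence measurable, on the whole plane; the two
    agree for nonnegative lengths and angles in [0, 2 pi]. *)
Let pLL_joint x (y : plane R) : R := expR (- (density E * fine (mean_area x y))).

Let mean_area_fin x t theta : 0 <= x -> 0 <= t -> 0 <= theta <= 2 * pi ->
  mean_area x (t, theta) \is a fin_num.
Proof.
move=> x0 t0 th; have /andP[h1 h2] := mean_area_hitsetU x0 t0 th.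
by rewrite fin_real// (lt_le_trans _ h1) ?ltNyr// (le_lt_trans h2) ?ltry.
Qed.

Let pLL_jointE x t theta : 0 <= x -> 0 <= t -> 0 <= theta <= 2 * pi ->
  pLL E x t theta = pLL_joint x (t, theta).
Proof.
move=> x0 t0 th; rewrite /pLL LoSI_missed// probability_missed//.
  by apply: measurableU; exact: measurable_hitset.
by move: (mean_area_fin x0 t0 th); rewrite /mean_area/= => /fin_numPlt/andP[].
Qed.

(** The bounds on the mean area, reversed by the exponential. The upper one has [t] in place of the
    minimum of the two lengths; they coincide for t <= x, the range of the integrals in g_L. *)
Lemma pLL_bounds (x t theta : R) : 0 <= x -> 0 <= t -> 0 <= theta <= 2 * pi ->
  expR (- (beta E * x) - beta E * t) <= pLL E x t theta <=
  expR (- (beta E * x) - beta E * t + 2^-1 * t * beta E * (1 + cos theta)).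
Proof.
move=> x0 t0 th; rewrite pLL_jointE// /pLL_joint !ler_expR.
have /andP[] := mean_area_hitsetU x0 t0 th.
rewrite -/(mean_area x (t, theta)) -(fineK (mean_area_fin x0 t0 th)) !lee_fin.
rewrite -(ler_pM2l (density_gt0 E)) density_EL => h1.
rewrite -(ler_pM2l (density_gt0 E)) density_EL => h2.
by apply/andP; split; lra.
Qed.

Lemma pLL_ge0 (x t theta : R) : 0 <= pLL E x t theta.
Proof. by rewrite fine_ge0. Qed.

Lemma pLL_le_pL (x t theta : R) : 0 <= x -> 0 <= t -> pLL E x t theta <= pL E x.
Proof.
move=> x0 t0; have mx := measurable_LoS 0 x0; have mt := measurable_LoS theta t0.
apply: fine_le; rewrite ?fin_num_measure//; first exact: measurableI.
by apply: le_measure; rewrite ?inE//; exact: measurableI.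
Qed.

Lemma pLNE (x t theta : R) : 0 <= x -> 0 <= t ->
  pLN E x t theta = pL E x - pLL E x t theta.
Proof.
move=> x0 t0; have mx := measurable_LoS 0 x0; have mt := measurable_LoS theta t0.
rewrite /pLN measureD//; last by rewrite (le_lt_trans (probability_le1 _ _))// ltry.
by rewrite fineB// fin_num_measure//; exact: measurableI.
Qed.

(** The length and direction of the second link become coordinates of a measurable set of center,
    mark and link; section areas, then the partial integral over the marks, preserve
    measurability. *)
Lemma measurable_pLL_joint (x : R) : measurable_fun setT (pLL_joint x).
Proof.
pose X : set (plane R * (plane R * plane R)) := [set u | (0 <= u.2.1.1) &&
  (hits u.1 u.2.1.1 u.2.1.2 x 0 || hits u.1 u.2.1.1 u.2.1.2 u.2.2.1 u.2.2.2)].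
have mX : measurable X.
  have m11 : measurable_fun setT (fun u : plane R * (plane R * plane R) => u.2.1.1 : R).
    exact: (measurableT_comp measurable_fst (measurableT_comp measurable_fst measurable_snd)).
  have m12 : measurable_fun setT (fun u : plane R * (plane R * plane R) => u.2.1.2 : R).
    exact: (measurableT_comp measurable_snd (measurableT_comp measurable_fst measurable_snd)).
  have m21 : measurable_fun setT (fun u : plane R * (plane R * plane R) => u.2.2.1 : R).
    exact: (measurableT_comp measurable_fst (measurableT_comp measurable_snd measurable_snd)).
  have m22 : measurable_fun setT (fun u : plane R * (plane R * plane R) => u.2.2.2 : R).
    exact: (measurableT_comp measurable_snd (measurableT_comp measurable_snd measurable_snd)).
  rewrite -[X in measurable X]setTI.
  apply: (@measurable_and _ _ _ (fun u : plane R * (plane R * plane R) => 0 <= u.2.1.1)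
    (fun u => hits u.1 u.2.1.1 u.2.1.2 x 0 || hits u.1 u.2.1.1 u.2.1.2 u.2.2.1 u.2.2.2)) => //.
    exact: measurable_fun_ler.
  by apply: measurable_or; apply: measurable_hits.
have XE z y : ysection X (z, y) = ysection (hitset x 0 `|` hitset y.1 y.2) z.
  apply/seteqP; split=> c; rewrite !ysectionE/= /hitset /X/=.
    by move=> /andP[-> /orP[->|->]]; [left|right].
  by move=> [|] /andP[-> ->]; rewrite ?orbT.
have mf := measurable_fun_ysection (@area R) mX.
have f0 z : (0 <= (@area R \o ysection X) z)%E by exact: measure_ge0.
have mG := @measurable_fun_fubini_tonelli_G _ _ _ _ _ law _ mf f0.
have GE : fubini_G law (@area R \o ysection X) = mean_area x.
  by apply/funext => y; apply: eq_integral => z _; rewrite -XE.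
rewrite GE in mG.
have mA := measurableT_comp (fine_measurable measurableT) mG.
have mM := measurable_funM (measurable_cst (density E)) mA.
exact: (measurableT_comp (@measurable_expR R) (measurable_funN mM)).
Qed.

Lemma pLL_measurable_ext (x : R) : 0 <= x -> exists q : plane R -> R,
  measurable_fun setT q /\ forall t theta, 0 <= t -> 0 <= theta <= 2 * pi ->
    pLL E x t theta = q (t, theta).
Proof.
move=> x0; exists (pLL_joint x); split; first exact: measurable_pLL_joint.
by move=> t theta t0 th; exact: pLL_jointE.
Qed.

Lemma beta_gt0 : 0 < beta E.
Proof.
rewrite divr_gt0 ?pi_gt0// mulr_gt0//; first by rewrite mulr_gt0// density_gt0.
by rewrite -lte_fin -expectation_lenE; exact: len_mean_gt0.
Qed.

End link_probabilities.

(** * Integrals over sectors *)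

Section angular_integrals.
Context (R : realType).
Local Notation mu := (@lebesgue_measure R).
Implicit Types (g h : plane R -> R) (a b : R).

(** The weight max (0, t) equals t on the intervals of interest and keeps the integrand nonnegative
    everywhere, as Tonelli's theorem asks. *)
Definition radial_integral g a b (theta : R) : \bar R :=
  (\int[mu]_(t in `[a, b]) (g (t, theta) * Num.max 0 t)%:E)%E.

Definition sector_integral g a b : \bar R :=
  (\int[mu]_(theta in `[0%R, (2 * pi)%R]) radial_integral g a b theta)%E.

Let max0_ge0 (t : R) : 0 <= Num.max 0 t.
Proof. by rewrite le_max lexx. Qed.

Let measurable_max0 : measurable_fun setT (fun t : R => Num.max 0 t).
Proof. exact: measurable_maxr. Qed.

Let measurable_weight g : measurable_fun setT g ->
  measurable_fun setT (fun y : plane R => (g y * Num.max 0 y.1)%:E).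
Proof.
move=> mg; apply/measurable_EFinP/measurable_funM => //.
exact: (measurableT_comp measurable_max0 measurable_fst).
Qed.

Let measurable_slice g (theta : R) : measurable_fun setT g ->
  measurable_fun setT (fun t : R => (g (t, theta) * Num.max 0 t)%:E).
Proof.
by move=> mg; exact: (measurableT_comp (measurable_weight mg) (pair2_measurable theta)).
Qed.

(** The range of t is moved into the integrand, so that integrals over [a, b] become partial
    integrals over the whole line. *)
Let cut g a b (y : plane R) : \bar R :=
  ((g y * Num.max 0 y.1) * \1_(`[a, b]%classic : set (measurableTypeR R)) y.1)%:E.

Let measurable_cut g a b : measurable_fun setT g -> measurable_fun setT (cut g a b).
Proof.
move=> mg; apply/measurable_EFinP/measurable_funM.
  by apply/measurable_EFinP; exact: measurable_weight.
have mi : measurable_fun setT (\1_(`[a, b]%classic : set (measurableTypeR R)) : R -> R).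
  by apply: measurable_indic; exact: measurable_itv.
exact: (measurableT_comp mi measurable_fst).
Qed.

Let cut_ge0 g a b y : (forall y, 0 <= g y) -> (0 <= cut g a b y)%E.
Proof. by move=> g0; rewrite lee_fin !mulr_ge0. Qed.

Let radial_cut g a b theta :
  radial_integral g a b theta = (\int[mu]_t cut g a b (t, theta))%E.
Proof.
rewrite /radial_integral integral_mkcond; apply: eq_integral => t _.
by rewrite patchE /cut indicE/=; case: ifP => _; rewrite ?mulr1 ?mulr0.
Qed.

Lemma measurable_radial_integral g a b : measurable_fun setT g ->
  (forall y, 0 <= g y) -> measurable_fun setT (radial_integral g a b).
Proof.
move=> mg g0; rewrite (_ : radial_integral g a b = fubini_G mu (cut g a b)).
  by apply: measurable_fun_fubini_tonelli_G => [|y]; [exact: measurable_cut|exact: cut_ge0].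
by apply/funext => theta; rewrite radial_cut.
Qed.

Lemma radial_integral_ge0 g a b theta : (forall y, 0 <= g y) ->
  (0 <= radial_integral g a b theta)%E.
Proof. by move=> g0; apply: integral_ge0 => t _; rewrite lee_fin mulr_ge0. Qed.

Lemma sector_integral_ge0 g a b : (forall y, 0 <= g y) ->
  (0 <= sector_integral g a b)%E.
Proof. by move=> g0; apply: integral_ge0 => t _; exact: radial_integral_ge0. Qed.

Lemma radial_integral_split g a c b theta : a <= c -> c <= b ->
  measurable_fun setT g -> (forall y, 0 <= g y) ->
  radial_integral g a b theta =
  (radial_integral g a c theta + radial_integral g c b theta)%E.
Proof.
move=> ac cb mg g0; apply: ge0_integral_itv_split => //.
- exact: measurable_slice.
- by move=> t; rewrite lee_fin mulr_ge0.
Qed.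

Lemma sector_integral_split g a c b : a <= c -> c <= b ->
  measurable_fun setT g -> (forall y, 0 <= g y) ->
  sector_integral g a b = (sector_integral g a c + sector_integral g c b)%E.
Proof.
move=> ac cb mg g0; rewrite /sector_integral -ge0_integralD//.
- by apply: eq_integral => theta _; exact: radial_integral_split.
- by move=> theta _; exact: radial_integral_ge0.
- by apply: measurable_funTS; exact: measurable_radial_integral.
- by move=> theta _; exact: radial_integral_ge0.
- by apply: measurable_funTS; exact: measurable_radial_integral.
Qed.

Lemma radial_integralD g h a b theta :
  measurable_fun setT g -> (forall y, 0 <= g y) ->
  measurable_fun setT h -> (forall y, 0 <= h y) ->
  radial_integral (fun y : plane R => g y + h y) a b theta =
  (radial_integral g a b theta + radial_integral h a b theta)%E.
Proof.
move=> mg g0 mh h0; rewrite /radial_integral -ge0_integralD//.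
- by apply: eq_integral => t _; rewrite -EFinD mulrDl.
- by move=> t _; rewrite lee_fin mulr_ge0.
- by apply: measurable_funTS; exact: measurable_slice.
- by move=> t _; rewrite lee_fin mulr_ge0.
- by apply: measurable_funTS; exact: measurable_slice.
Qed.

Lemma sector_integralD g h a b :
  measurable_fun setT g -> (forall y, 0 <= g y) ->
  measurable_fun setT h -> (forall y, 0 <= h y) ->
  sector_integral (fun y : plane R => g y + h y) a b =
  (sector_integral g a b + sector_integral h a b)%E.
Proof.
move=> mg g0 mh h0; rewrite /sector_integral -ge0_integralD//.
- by apply: eq_integral => theta _; exact: radial_integralD.
- by move=> theta _; exact: radial_integral_ge0.
- by apply: measurable_funTS; exact: measurable_radial_integral.
- by move=> theta _; exact: radial_integral_ge0.
- by apply: measurable_funTS; exact: measurable_radial_integral.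
Qed.

Lemma le_radial_integral g h a b theta : measurable_fun setT g ->
  measurable_fun setT h -> (forall y, 0 <= g y) ->
  (forall t, a <= t <= b -> g (t, theta) <= h (t, theta)) ->
  (radial_integral g a b theta <= radial_integral h a b theta)%E.
Proof.
move=> mg mh g0 gh; apply: ge0_le_integral => //.
- by move=> t _; rewrite lee_fin mulr_ge0.
- by apply: measurable_funTS; exact: measurable_slice.
- by apply: measurable_funTS; exact: measurable_slice.
- by move=> t; rewrite /= in_itv/= => /gh ght; rewrite lee_fin ler_wpM2r.
Qed.

Lemma le_sector_integral g h a b : measurable_fun setT g -> measurable_fun setT h ->
  (forall y, 0 <= g y) -> (forall y, 0 <= h y) ->
  (forall t theta, a <= t <= b -> 0 <= theta <= 2 * pi ->
     g (t, theta) <= h (t, theta)) ->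
  (sector_integral g a b <= sector_integral h a b)%E.
Proof.
move=> mg mh g0 h0 gh; apply: ge0_le_integral => //.
- by move=> theta _; exact: radial_integral_ge0.
- by apply: measurable_funTS; exact: measurable_radial_integral.
- by apply: measurable_funTS; exact: measurable_radial_integral.
- move=> theta; rewrite /= in_itv/= => th; apply: le_radial_integral => // t tab.
  exact: gh.
Qed.

(** Puts the angle innermost, where the closed forms are known. *)
Lemma sector_integral_swap g a b : measurable_fun setT g -> (forall y, 0 <= g y) ->
  sector_integral g a b = (\int[mu]_(t in `[a, b]) ((Num.max 0 t)%:E *
    \int[mu]_(theta in `[0%R, (2 * pi)%R]) (g (t, theta))%:E))%E.
Proof.
move=> mg g0; pose I : set (measurableTypeR R) := `[0, 2 * pi]%classic.
have mI : measurable_fun setT (\1_I : R -> R).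
  by apply: measurable_indic; exact: measurable_itv.
pose f y := (cut g a b y * (\1_I y.2)%:E)%E.
have mf : measurable_fun setT f.
  apply: emeasurable_funM; first exact: measurable_cut.
  by apply/measurable_EFinP; exact: (measurableT_comp mI measurable_snd).
have f0 y : (0 <= f y)%E by apply: mule_ge0; [exact: cut_ge0|rewrite lee_fin].
transitivity (\int[mu]_theta \int[mu]_t f (t, theta))%E.
  rewrite /sector_integral integral_mkcond; apply: eq_integral => theta _.
  rewrite patchE radial_cut; case: ifP => hth.
    by apply: eq_integral => t _; rewrite /f/= [\1_I _]indicE (_ : theta \in I) ?mule1.
  apply/esym; apply: integral0_eq => t _.
  by rewrite /f/= [\1_I _]indicE (_ : theta \in I = false) ?mule0.
rewrite -fubini_tonelli// [RHS]integral_mkcond; apply: eq_integral => t _.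
rewrite patchE; case: ifP => ht; last first.
  by apply: integral0_eq => theta _; rewrite /f /cut/= indicE ht mulr0 mul0e.
rewrite [in RHS]integral_mkcond -ge0_integralZl//.
- apply: eq_integral => theta _; rewrite patchE /f /cut/= !indicE ht mulr1.
  by case: ifP => _; rewrite ?mule1 ?mule0// -EFinM mulrC.
- apply/(measurable_restrictT _ _).1 => //.
  apply: measurable_funTS; apply/measurable_EFinP.
  exact: (measurableT_comp mg (pair1_measurable t)).
- by move=> theta _; rewrite patchE; case: ifP => // _; rewrite lee_fin.
- by rewrite lee_fin.
Qed.

End angular_integrals.

(** * Reduction of g_L to one integral over an annulus *)

Section gL_formula.
Context (R : realType).
Local Notation mu := (@lebesgue_measure R).
Implicit Types (g : plane R -> R).

(** Here [f t] is the mean of [g] over the circle of radius t, and [F] is a primitive of t f(t). *)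
Lemma sector_integral_primitive g (f F : R -> R) (a b : R) : 0 <= a -> a <= b ->
  measurable_fun setT g -> (forall y, 0 <= g y) ->
  (forall t, 0 <= t ->
     (\int[mu]_(theta in `[0%R, (2 * pi)%R]) (g (t, theta))%:E = (2 * pi * f t)%:E)%E) ->
  (forall t : R, is_derive t 1 F (t * f t)) -> continuous (fun t : R => t * f t) ->
  sector_integral g a b = (2 * pi * (F b - F a))%:E.
Proof.
move=> a0 ab mg g0 gf dF cF; rewrite sector_integral_swap//.
have pi0 := pi_ge0 R.
have f0 t : 0 <= t -> 0 <= 2 * pi * f t.
  by move=> t0; rewrite -lee_fin -gf//; apply: integral_ge0 => th _; rewrite lee_fin.
have f0' t : 0 <= t -> 0 <= f t.
  by move=> /f0; rewrite pmulr_rge0// mulr_gt0// pi_gt0.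
rewrite EFinM -(integral_is_derive ab dF cF) -ge0_integralZl//.
- apply: eq_integral => t; rewrite inE/= in_itv/= => /andP[ta tb].
  have t0 : 0 <= t by exact: le_trans ta.
  by rewrite gf// (max_idPr t0) -!EFinM; congr (_%:E); rewrite mulrCA.
- apply/measurable_EFinP; apply: measurable_funTS.
  exact: continuous_measurable_fun.
- move=> t; rewrite /= in_itv/= => /andP[ta tb]; rewrite lee_fin.
  have t0 : 0 <= t by exact: le_trans ta.
  by rewrite mulr_ge0// f0'.
- by rewrite lee_fin mulr_ge0.
Qed.

Lemma sector_integral1 (a b : R) : 0 <= a -> a <= b ->
  sector_integral (fun=> 1) a b = (pi * (b ^+ 2 - a ^+ 2))%:E.
Proof.
move=> a0 ab; have pi0 := pi_ge0 R.
pose F (t : R) := 2^-1 *: (t ^+ 2).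
have dF (t : R) : is_derive t 1 F (t * 1).
  have : is_derive t 1 (2^-1 \*: (@id R ^+ 2)) (2^-1 *: ((2%:R * t ^+ 1) *: 1)).
    by apply: is_deriveZ; apply: is_deriveX.
  by rewrite (_ : _ *: _ = t * 1)// /GRing.scale/=; field.
have cF : continuous (fun t : R => t * 1).
  by move=> t; apply: cvgM; [exact: cvg_id|exact: cvg_cst].
have m1 : measurable_fun setT (fun _ : plane R => 1 : R) by exact: measurable_cst.
have gf (t : R) : 0 <= t ->
    (\int[mu]_(theta in `[0%R, (2 * pi)%R]) 1%:E = (2 * pi * 1)%:E)%E.
  move=> _; rewrite integral_cst//.
  have pi2 : 0 <= 2 * pi :> R by rewrite mulr_ge0.
  by rewrite [X in (_ * X)%E](lebesgue_measure_cc pi2) mul1e subr0 mulr1.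
rewrite (sector_integral_primitive a0 ab m1 (fun=> ler01) gf dF cF) /F /GRing.scale/=.
by congr (_%:E); move: (pi) => p; field.
Qed.

Lemma radial_integral1 (a b theta : R) : 0 <= a -> a <= b ->
  radial_integral (fun=> 1) a b theta \is a fin_num.
Proof.
move=> a0 ab; rewrite ge0_fin_numE ?radial_integral_ge0//.
apply: (@le_lt_trans _ _ (\int[mu]_(t in `[a, b]) (cst b%:E t))%E).
  apply: ge0_le_integral => //.
  - by move=> t _; rewrite lee_fin mul1r le_max lexx.
  - apply/measurable_EFinP; apply: measurable_funTS; apply: measurable_funM => //.
    exact: measurable_maxr.
  - move=> t; rewrite /= in_itv/= => /andP[_ tb].
    by rewrite lee_fin mul1r ge_max tb (le_trans a0 ab).
rewrite integral_cst//.
by rewrite [X in (_ * X)%E](lebesgue_measure_cc ab) -EFinM ltry.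
Qed.

Section unit_density.
Variables (g : plane R -> R) (a b : R).
Hypotheses (mg : measurable_fun setT g) (g01 : forall y, 0 <= g y <= 1).
Hypotheses (a0 : 0 <= a) (ab : a <= b).

Let g0 y : 0 <= g y.
Proof. by case/andP: (g01 y). Qed.

Let g1 y : g y <= 1.
Proof. by case/andP: (g01 y). Qed.

Lemma radial_integral_fin theta : radial_integral g a b theta \is a fin_num.
Proof.
rewrite ge0_fin_numE ?radial_integral_ge0//.
have := radial_integral1 theta a0 ab.
rewrite ge0_fin_numE ?radial_integral_ge0//; apply: le_lt_trans.
exact: le_radial_integral.
Qed.

Lemma sector_integral_fin : sector_integral g a b \is a fin_num.
Proof.
rewrite ge0_fin_numE ?sector_integral_ge0//.
apply: (@le_lt_trans _ _ (sector_integral (fun=> 1) a b)).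
  exact: le_sector_integral.
by rewrite sector_integral1// ltry.
Qed.

(** A real integral is [fine] of an extended one at both levels; finiteness of the radial integrals
    lets the inner [fine] be removed. *)
Lemma Rintegral_sector (q : R -> R -> R) :
  (forall t theta, a <= t <= b -> 0 <= theta <= 2 * pi -> q t theta = g (t, theta)) ->
  \int[mu]_(theta in `[0, 2 * pi]) \int[mu]_(t in `[a, b]) (q t theta * t) =
  fine (sector_integral g a b).
Proof.
move=> qg; rewrite /Rintegral; congr fine; apply: eq_integral => theta.
rewrite inE/= in_itv/= => th; rewrite -[RHS]fineK; last exact: radial_integral_fin.
congr ((fine _)%:E); apply: eq_integral => t; rewrite inE/= in_itv/= => tab.
have /andP[ta tb] := tab; have t0 : 0 <= t by exact: le_trans ta.
by rewrite qg// (max_idPr t0).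
Qed.

End unit_density.

(** On the disc of radius e x the ratios [g] and [1 - g] add up to 1, so their integrals give its
    area. Stated for arbitrary [p], [q], [n] so as to serve the model and both replaced cases. *)
Lemma gL_ofE (lambda : R) (p : R -> R) (q n : R -> R -> R -> R) (e : R -> R) (x : R)
    g : 0 <= e x -> e x <= x -> 0 < p x ->
  measurable_fun setT g -> (forall y, 0 <= g y <= 1) ->
  (forall t theta, 0 <= t <= x -> 0 <= theta <= 2 * pi -> q x t theta = p x * g (t, theta)) ->
  (forall t theta, 0 <= t <= x -> 0 <= theta <= 2 * pi -> n x t theta = p x - q x t theta) ->
  gL_of lambda p q n e x =
  p x * expR (- (lambda * pi * e x ^+ 2) - lambda * fine (sector_integral g (e x) x)).
Proof.
move=> e0 ex px mg g01 qE nE; have x0 := le_trans e0 ex.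
have p0 : p x != 0 by rewrite gt_eqF.
have g0 y : 0 <= g y by case/andP: (g01 y).
pose h y := 1 - g y.
have mh : measurable_fun setT h by exact: measurable_funB.
have h01 y : 0 <= h y <= 1.
  by rewrite /h subr_ge0 gerBl; case/andP: (g01 y) => -> ->.
have h0 y : 0 <= h y by case/andP: (h01 y).
rewrite /gL_of (@Rintegral_sector g 0 x mg g01 (lexx _) x0); last first.
  by move=> t th t0 thb; rewrite qE// mulrC mulKf.
rewrite (@Rintegral_sector h 0 (e x) mh h01 (lexx _) e0); last first.
  move=> t th /andP[t0 te] thb; have tx : 0 <= t <= x by rewrite t0 (le_trans te).
  by rewrite nE// qE// /h mulrBl divff// mulrC mulKf.
have fin1 := sector_integral_fin mg g01 (lexx 0) e0.
have fin2 := sector_integral_fin mg g01 e0 ex.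
have fin3 := sector_integral_fin mh h01 (lexx 0) e0.
rewrite (sector_integral_split e0 ex mg g0) (fineD fin1 fin2).
have E1 : fine (sector_integral g 0 (e x)) + fine (sector_integral h 0 (e x)) =
    pi * e x ^+ 2.
  rewrite -(fineD fin1 fin3) -(sector_integralD 0 (e x) mg g0 mh h0).
  rewrite (_ : (fun y => _) = fun=> 1); last by apply/funext => y; rewrite /h subrKC.
  by rewrite (sector_integral1 (lexx 0) e0) expr0n subr0.
have combine (c u v w k y : R) : u + v = k * y ->
    c * expR (- (lambda * (u + w)) - lambda * v) = c * expR (- (lambda * k * y) - lambda * w).
  by rewrite -[lambda * k * y]mulrA => <-; congr (_ * expR _); ring.
exact: (combine _ _ _ _ _ _ E1).
Qed.

End gL_formula.

(** * Bessel functions *)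

Section bessel_primitive.
Context (R : realType).

(** Comparison with the exponential series at |K| + 1, a point strictly beyond K. *)
Lemma is_cvg_pseries_inv_fact (u : R^nat) (K : R) :
  (forall k, 0 <= u k <= (k`!%:R)^-1) -> cvgn (pseries u K).
Proof.
move=> u01; apply: (@is_cvg_pseries_inside _ _ (`|K| + 1)); last first.
  by rewrite [ltRHS]ger0_norm ?addr_ge0// ltrDl.
apply: (@series_le_cvg _ _ (exp_coeff (`|K| + 1))).
- by move=> k; case/andP: (u01 k) => u0 _; rewrite mulr_ge0// exprn_ge0// addr_ge0.
- by move=> k; apply: exp_coeff_ge0; rewrite addr_ge0.
- move=> k; rewrite /exp_coeff/= mulrC ler_wpM2l ?exprn_ge0 ?addr_ge0//.
  by case/andP: (u01 k).
- exact: is_cvg_series_exp_coeff.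
Qed.

(* [I_0 z = sumA (z ^+ 2 / 4)] and [z * I_1 z = 2 * sumG (z ^+ 2 / 4)]; these
   power series satisfy [sumG' = sumA] and [y * sumA' y = sumG y]. *)
Let cA (k : nat) : R := (k`!%:R * k`!%:R)^-1.
Let cG (k : nat) : R := k%:R * cA k.
Let cD : R^nat := pseries_diffs cA.

Let factS_neq0 k : (k`!%:R : R) != 0.
Proof. by rewrite pnatr_eq0 -lt0n fact_gt0. Qed.

Let succ_neq0 k : (k.+1%:R : R) != 0.
Proof. by rewrite pnatr_eq0. Qed.

Let fact_inv_le1 k : (k`!%:R)^-1 <= 1 :> R.
Proof. by rewrite invf_le1 ?ltr0n ?fact_gt0// ler1n fact_gt0. Qed.

Let cDE k : cD k = (k`!%:R * k.+1`!%:R)^-1.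
Proof.
rewrite /cD /pseries_diffs /cA factS natrM.
have := factS_neq0 k; have := succ_neq0 k.
by move: (k.+1%:R) (k`!%:R) => m a m0 a0; field; rewrite m0 a0.
Qed.

Let cGS k : cG k.+1 = cD k.
Proof. by []. Qed.

Let diffs_cG : pseries_diffs cG = cA.
Proof.
apply/funext => k; rewrite /pseries_diffs cGS cDE /cA factS natrM.
have := factS_neq0 k; have := succ_neq0 k.
by move: (k.+1%:R) (k`!%:R) => m a m0 a0; field; rewrite m0 a0.
Qed.

Let diffs_cD k : pseries_diffs cD k = (k`!%:R * k.+2`!%:R)^-1.
Proof.
rewrite /pseries_diffs cDE (factS k) natrM.
have := factS_neq0 k; have := factS_neq0 k.+2; have := succ_neq0 k.
by move: (k.+1%:R) (k`!%:R) (k.+2`!%:R) => m a c m0 c0 a0; field; rewrite m0 a0 c0.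
Qed.

Let inv_fact_le k m : 0 <= ((k`!%:R * m`!%:R)^-1 : R) <= (k`!%:R)^-1.
Proof.
by rewrite invr_ge0 mulr_ge0//= invfM ler_piMr.
Qed.

Let cvgA K : cvgn (pseries cA K).
Proof. by apply: is_cvg_pseries_inv_fact => k; exact: inv_fact_le. Qed.

Let cvgD K : cvgn (pseries cD K).
Proof. by apply: is_cvg_pseries_inv_fact => k; rewrite cDE; exact: inv_fact_le. Qed.

Let cvgDD K : cvgn (pseries (pseries_diffs cD) K).
Proof. by apply: is_cvg_pseries_inv_fact => k; rewrite diffs_cD; exact: inv_fact_le. Qed.

Let cvgG K : cvgn (pseries cG K).
Proof.
apply: is_cvg_pseries_inv_fact => -[|k].
  by rewrite /cG mul0r lexx invr_ge0 ler0n.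
rewrite cGS cDE [k`!%:R * _]mulrC; exact: inv_fact_le.
Qed.

Let sumA y := limn (pseries cA y).
Let sumD y := limn (pseries cD y).
Let sumG y := limn (pseries cG y).

(** Termwise differentiation asks for the convergence, strictly beyond y, of the series and of its
    first two formal derivatives. *)
Let dA (y : R) : is_derive y 1 sumA (sumD y).
Proof.
apply: (@pseries_snd_diffs _ _ (`|y| + 1)).
- exact: cvgA.
- exact: cvgD.
- exact: cvgDD.
- by rewrite [ltRHS]ger0_norm ?addr_ge0// ltrDl.
Qed.

Let dG (y : R) : is_derive y 1 sumG (sumA y).
Proof.
rewrite /sumA -diffs_cG.
apply: (@pseries_snd_diffs _ _ (`|y| + 1)); rewrite ?diffs_cG.
- exact: cvgG.
- exact: cvgA.
- exact: cvgD.
- by rewrite [ltRHS]ger0_norm ?addr_ge0// ltrDl.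
Qed.

(** An index shift: the term of degree 0 in [sumG] vanishes. *)
Let yD y : y * sumD y = sumG y.
Proof.
have h1 : (y * pseries cD y n) @[n --> \oo] --> y * sumD y.
  by apply: cvgM; [exact: cvg_cst|exact: cvgD].
have h2 : pseries cG y n.+1 @[n --> \oo] --> sumG y.
  by rewrite (cvg_shiftS (pseries cG y)); exact: cvgG.
rewrite -(cvg_lim (@Rhausdorff R) h1) -(cvg_lim (@Rhausdorff R) h2).
congr (lim (_ @ \oo)); apply/funext => n.
rewrite /pseries /series/= big_nat_recl//= {1}/cG mul0r mul0r add0r mulr_sumr.
by apply: eq_bigr => i _; rewrite cGS exprS mulrCA.
Qed.

Let besselI0_series (z : R) :
  series (fun k : nat => (z / 2) ^+ (2 * k + 0) / (k`! * (k + 0)`!)%:R) =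
  pseries cA (z ^+ 2 / 4).
Proof.
rewrite /pseries; congr series; apply/funext => k /=.
rewrite !addn0 natrM [LHS]mulrC exprM (_ : (z / 2) ^+ 2 = z ^+ 2 / 4)//.
by field.
Qed.

Lemma is_cvg_besselI0 (z : R) :
  cvgn (series (fun k : nat => (z / 2) ^+ (2 * k + 0) / (k`! * (k + 0)`!)%:R)).
Proof. by rewrite besselI0_series; exact: cvgA. Qed.

Let besselI0E (z : R) : besselI 0 z = sumA (z ^+ 2 / 4).
Proof. by rewrite /besselI besselI0_series. Qed.

Let besselI1E (z : R) : z * besselI 1 z = 2 * sumG (z ^+ 2 / 4).
Proof.
have -> : besselI 1 z = z / 2 * sumD (z ^+ 2 / 4).
  have h1 : (z / 2 * pseries cD (z ^+ 2 / 4) n) @[n --> \oo] --> z / 2 * sumD (z ^+ 2 / 4).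
    by apply: cvgM; [exact: cvg_cst|exact: cvgD].
  rewrite -(cvg_lim (@Rhausdorff R) h1) /besselI.
  congr (lim (_ @ \oo)); apply/funext => n.
  rewrite /pseries /series/= mulr_sumr; apply: eq_bigr => k _.
  rewrite addn1 exprS exprM natrM cDE addn1 (_ : (z / 2) ^+ 2 = z ^+ 2 / 4); last by field.
  by rewrite -mulrA; congr (_ * _); rewrite mulrC.
by rewrite -yD; field.
Qed.

(** In Bessel terms, exp (- z) (z^2 I_0 z + (z + 1) z I_1 z); with z = b r / 2, F (r, b) = 4 H(z) /
    b. Even power series avoid dividing by z at 0. *)
Let H z := expR (- z) * (z ^+ 2 * sumA (z ^+ 2 / 4) + 2 * (z + 1) * sumG (z ^+ 2 / 4)).

Let dH (z : R) : is_derive z 1 H (expR (- z) * (3 * z * sumA (z ^+ 2 / 4))).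
Proof.
have d5 : is_derive z 1 (fun z : R => z ^+ 2) (2 * z).
  apply: (is_derive_eq (is_deriveX 2 (is_derive_id z (1 : R)))).
  by rewrite /GRing.scale/= mulr1.
have dy : is_derive z 1 (fun z : R => z ^+ 2 / 4) (z / 2).
  apply: (is_derive_eq (is_deriveM d5 (is_derive_cst (4^-1 : R) z (1 : R)))).
  by rewrite /GRing.scale/=; field.
have d1 := @is_derive1_comp R _ (fun z : R => z ^+ 2 / 4) z _ _ (dA _) dy.
have d2 := @is_derive1_comp R _ (fun z : R => z ^+ 2 / 4) z _ _ (dG _) dy.
have d3 := @is_derive1_comp R expR (fun z : R => - z) z _ _ (is_derive_expR _) (is_deriveNid z 1).
have d4 : is_derive z 1 (fun z : R => 2 * (z + 1)) 2.
  apply: (is_derive_eq (is_deriveZ 2 (is_deriveD (is_derive_id z (1 : R)) (is_derive_cst (1 : R) z (1 : R))))).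
  by rewrite /GRing.scale/= addr0 mulr1.
have d6 := is_deriveM d3 (is_deriveD (is_deriveM d5 d1) (is_deriveM d4 d2)).
apply: (is_derive_eq d6).
rewrite /GRing.scale/=.
have := yD (z ^+ 2 / 4).
set a := sumA _; set g := sumG _; set D := sumD _ => yDg.
rewrite [X in _ + X * _](_ : _ = z ^+ 2 * a + 2 * (z + 1) * g)//.
by rewrite -yDg; field.
Qed.

Lemma is_derive_F (b r : R) : b != 0 ->
  is_derive r 1 (fun r => F r b / (3 * b)) (r * (expR (- (b * r / 2)) * besselI 0 (b * r / 2))).
Proof.
move=> b0.
have dz : is_derive r 1 (fun r : R => b * r / 2) (b / 2).
  apply: (is_derive_eq (is_deriveM (is_deriveZ b (is_derive_id r (1 : R)))
    (is_derive_cst (2^-1 : R) r (1 : R)))).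
  by rewrite /GRing.scale/=; field.
have dF := @is_derive1_comp R H (fun r : R => b * r / 2) r _ _ (dH _) dz.
(* The constant is 4 / b, from F = 4 H / b, divided by 3 b. *)
have := is_deriveZ (4 / (3 * b ^+ 2)) dF.
rewrite (_ : _ \*: _ = fun r => F r b / (3 * b)); last first.
  apply/funext => s; rewrite /F /= /H -besselI0E.
  set z := b * s / 2.
  have -> : 2 * (z + 1) * sumG (z ^+ 2 / 4) = (z + 1) * (z * besselI 1 z).
    by rewrite besselI1E; ring.
  have -> : s = 2 * z / b by rewrite /z; field.
  have -> : b * (2 * z / b) = 2 * z by field.
  by rewrite /GRing.scale/=; field.
rewrite (_ : _ *: _ = r * (expR (- (b * r / 2)) * besselI 0 (b * r / 2)))//.
by rewrite /GRing.scale/= besselI0E; field.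
Qed.

Lemma continuous_besselI0 : continuous (@besselI R 0).
Proof.
move=> z; rewrite (_ : besselI 0 = sumA \o (fun z : R => z ^+ 2 / 4)); last first.
  by apply/funext => ?; rewrite besselI0E.
apply: continuous_comp.
  by apply: cvgM; [exact: exprn_continuous|exact: cvg_cst].
by apply: differentiable_continuous; apply/derivable1_diffP; have [] := dA (z ^+ 2 / 4).
Qed.

End bessel_primitive.

(** * The integral representation of I_0 *)

Section bessel_integral.
Context (R : realType).
Local Notation mu := (@lebesgue_measure R).

(** The mean of cos^n over a full turn. *)
Fixpoint wallis (n : nat) : R :=
  match n with
  | 0 => 1
  | 1 => 0
  | m.+2 => m.+1%:R / m.+2%:R * wallis m
  end.

Let wallisSS n : wallis n.+2 = n.+1%:R / n.+2%:R * wallis n.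
Proof. by []. Qed.

Lemma wallis_odd j : wallis (2 * j).+1 = 0.
Proof.
by elim: j => [//|j IH]; rewrite mulnS -[(2 + _).+1%N]/((2 * j).+1.+2) wallisSS IH mulr0.
Qed.

(** The mean of cos^(2j) is (2j)! / (4^j j!^2), so the averaged exponential series has exactly the
    terms of I_0 in even degree. *)
Lemma wallis_even (z : R) j :
  z ^+ (2 * j) / (2 * j)`!%:R * wallis (2 * j) =
  (z / 2) ^+ (2 * j) / (j`! * j`!)%:R.
Proof.
have -> : (z / 2) ^+ (2 * j) = z ^+ (2 * j) * 4^-1 ^+ j.
  by rewrite exprMn exprM; congr (_ * _); rewrite exprM; congr (_ ^+ _); field.
rewrite -!mulrA; congr (_ * _).
elim: j => [|j IH]; first by rewrite muln0 !fact0 muln1 invr1 mulr1.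
rewrite mulnS -[(2 + _)%N]/((2 * j).+2) wallisSS !factS !natrM exprS.
have fne k : (k`!%:R : R) != 0 by rewrite pnatr_eq0 -lt0n fact_gt0.
have sne k : (k.+1%:R : R) != 0 by rewrite pnatr_eq0.
have E : (2 * j).+2%:R = 2 * j.+1%:R :> R by rewrite -natrM mulnS.
transitivity (4^-1 * j.+1%:R ^- 2 * ((2 * j)`!%:R^-1 * wallis (2 * j))).
  have := sne (2 * j)%N; have := sne j; have := fne (2 * j)%N; rewrite E.
  move: (wallis _) (j.+1%:R) ((2 * j).+1%:R) ((2 * j)`!%:R) => w a c f f0 a0 c0.
  by field; rewrite f0 a0 c0.
rewrite IH natrM; have := sne j; have := fne j.
move: (4^-1 ^+ j) (j.+1%:R) (j`!%:R) => q a f f0 a0.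
by field; rewrite f0 a0.
Qed.

Section angle.
Variables (k B : R).
Hypotheses (k0 : k != 0) (B0 : 0 <= B) (kB : sin (k * B) = 0).

Let is_derive_scale (theta : R) : is_derive theta 1 (fun theta : R => k * theta) k.
Proof.
apply: (is_derive_eq (is_deriveZ k (is_derive_id theta (1 : R)))).
by rewrite /GRing.scale/= mulr1.
Qed.

Let is_derive_sinZ (theta : R) :
  is_derive theta 1 (fun theta : R => sin (k * theta)) (k * cos (k * theta)).
Proof.
have := @is_derive1_comp R sin (fun theta : R => k * theta) theta _ _
  (is_derive_sin _) (is_derive_scale theta).
by rewrite mulrC.
Qed.

Let is_derive_cosZ (theta : R) :
  is_derive theta 1 (fun theta : R => cos (k * theta)) (- k * sin (k * theta)).
Proof.
apply: (is_derive_eq (@is_derive1_comp R cos (fun theta : R => k * theta) theta _ _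
  (is_derive_cos _) (is_derive_scale theta))).
by ring.
Qed.

(* [cos ^+ n] minus its mean is the derivative of a function vanishing at both
   ends, by the reduction formula for [cos ^+ n.+1 * sin]. *)
Lemma cos_pow_primitive n : exists G : R -> R,
  [/\ forall theta : R, is_derive theta 1 G (cos (k * theta) ^+ n - wallis n),
      G 0 = 0 & G B = 0].
Proof.
elim/ltn_ind: n => -[|[|n]] IH.
- exists (cst 0); split => // theta.
  by rewrite expr0 subrr; exact: is_derive_cst.
- exists (fun theta => k^-1 * sin (k * theta)); split.
  + move=> theta; apply: (is_derive_eq (is_deriveZ k^-1 (is_derive_sinZ theta))).
    by rewrite /GRing.scale/= subr0 mulKf.
  + by rewrite mulr0 sin0 mulr0.
  + by rewrite kB mulr0.
have [G [dG G0 GB]] := IH n (leqW (ltnSn n)).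
exists (fun theta => (k * n.+2%:R)^-1 * (cos (k * theta) ^+ n.+1 * sin (k * theta)) +
  n.+1%:R / n.+2%:R * G theta); split.
- move=> theta.
  have dX : is_derive theta 1 (fun theta => cos (k * theta) ^+ n.+1)
      (n.+1%:R * cos (k * theta) ^+ n * (- k * sin (k * theta))).
    have := is_deriveX n.+1 (is_derive_cosZ theta).
    rewrite /GRing.scale/= (_ : _ ^+ n.+1 = fun theta => cos (k * theta) ^+ n.+1)//.
    by apply/funext => x; rewrite exprfctE.
  have d1 := is_deriveM dX (is_derive_sinZ theta).
  have d2 := is_deriveD (is_deriveZ (k * n.+2%:R)^-1 d1)
    (is_deriveZ (n.+1%:R / n.+2%:R) (dG theta)).
  apply: (is_derive_eq d2); rewrite /GRing.scale/=.
  have s2 : sin (k * theta) ^+ 2 = 1 - cos (k * theta) ^+ 2 by exact: sin2cos2.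
  have n2 : n.+2%:R != 0 :> R by rewrite pnatr_eq0.
  have n2E : n.+2%:R = n.+1%:R + 1 :> R by rewrite -natr1.
  rewrite !exprS; move: s2 n2; rewrite n2E.
  move: (cos _) (sin _) (wallis n) (n.+1%:R) => c s w m s2 m0.
  transitivity ((m + 1)^-1 * (c ^+ n * (c * c - m * s ^+ 2 + m)) - m / (m + 1) * w).
    by field; rewrite k0 m0.
  by rewrite s2; field.
- by rewrite mulr0 sin0 mulr0 G0 !mulr0 addr0.
- by rewrite kB GB !mulr0 addr0.
Qed.

Variable z : R.

Let partial N (theta : R) : R := series (exp_coeff (z * cos (k * theta))) N.
Let mean N : R := \sum_(0 <= n < N) z ^+ n / n`!%:R * wallis n.

Let partial_primitive N : exists G : R -> R,
  [/\ forall theta : R, is_derive theta 1 G (partial N theta - mean N),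
      G 0 = 0 & G B = 0].
Proof.
elim: N => [|N [G [dG G0 GB]]].
  exists (cst 0); split => // theta.
  rewrite /partial /mean /series/= !big_geq// subrr; exact: is_derive_cst.
have [H [dH H0 HB]] := cos_pow_primitive N.
exists (fun theta => G theta + z ^+ N / N`!%:R * H theta); split.
- move=> theta.
  apply: (is_derive_eq (is_deriveD (dG theta) (is_deriveZ (z ^+ N / N`!%:R) (dH theta)))).
  rewrite /partial /mean /series/= !big_nat_recr//= /exp_coeff/= exprMn /GRing.scale/=.
  by move: (N`!%:R^-1) => f; ring.
- by rewrite G0 H0 mulr0 addr0.
- by rewrite GB HB mulr0 addr0.
Qed.

Let continuous_cosZ : continuous (fun theta : R => cos (k * theta)).
Proof.
by move=> theta; apply: differentiable_continuous; apply/derivable1_diffP;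
  have [] := is_derive_cosZ theta.
Qed.

Let continuous_partial N : continuous (partial N).
Proof.
elim: N => [|N IH] theta.
  rewrite (_ : partial 0 = cst 0); first exact: cst_continuous.
  by apply/funext => x; rewrite /partial /series/= big_geq.
rewrite (_ : partial N.+1 =
    (fun x => partial N x + (z * cos (k * x)) ^+ N * N`!%:R^-1)); last first.
  by apply/funext => x; rewrite /partial /series/= big_nat_recr.
apply: cvgD; first exact: IH.
apply: cvgM; last exact: cvg_cst.
apply: (@continuous_comp _ _ _ (fun x => z * cos (k * x)) (fun y => y ^+ N)).
  by apply: cvgM; [exact: cvg_cst|exact: continuous_cosZ].
exact: exprn_continuous.
Qed.

Let integral_partial N :
  (\int[mu]_(theta in `[0%R, B]) (partial N theta)%:E = (B * mean N)%:E)%E.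
Proof.
have [G [dG G0 GB]] := partial_primitive N.
have dF (theta : R) : is_derive theta 1 (fun theta => G theta + mean N * theta) (partial N theta).
  apply: (is_derive_eq (is_deriveD (dG theta) (is_deriveZ (mean N) (is_derive_id theta (1 : R))))).
  by rewrite /GRing.scale/= mulr1 subrK.
rewrite (integral_is_derive B0 dF); last exact: continuous_partial.
by rewrite G0 GB mulr0 !add0r subr0 mulrC.
Qed.

Let mean_even M : mean (2 * M) =
  series (fun j => (z / 2) ^+ (2 * j + 0) / (j`! * (j + 0)`!)%:R) M.
Proof.
elim: M => [|M IH]; first by rewrite muln0 /mean /series/= !big_geq.
have meanS N : mean N.+1 = mean N + z ^+ N / N`!%:R * wallis N.
  by rewrite /mean big_nat_recr.
rewrite mulnS -[(2 + _)%N]/((2 * M).+2) !meanS IH wallis_odd mulr0 addr0.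
by rewrite wallis_even /series/= big_nat_recr//= !addn0.
Qed.

(** The exponential series is averaged term by term, under the bound exp |z|. It is used with k = 1
    on [0, 2 pi] and with k = 2 on [0, pi / 2]; the condition sin (k B) = 0 covers both. *)
Lemma integral_expR_cos :
  (\int[mu]_(theta in `[0%R, B]) (expR (z * cos (k * theta)))%:E =
   (B * besselI 0 z)%:E)%E.
Proof.
have mI : measurable (`[0, B]%classic : set (measurableTypeR R)) by exact: measurable_itv.
have mp N : measurable_fun setT (fun theta : R => (partial N theta)%:E).
  by apply/measurable_EFinP; apply: continuous_measurable_fun; exact: continuous_partial.
have ce : continuous (fun theta : R => expR (z * cos (k * theta))).
  move=> theta; apply: continuous_comp; last exact: continuous_expR.
  by apply: cvgM; [exact: cvg_cst|exact: continuous_cosZ].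
have [//|||||_ _ h] := @dominated_convergence _ _ _ mu `[0, B] mI
  (fun N theta => (partial N theta)%:E) (fun theta => (expR (z * cos (k * theta)))%:E)
  (cst (expR `|z|)%:E).
- by move=> N; apply: measurable_funTS; exact: mp.
- apply: measurable_funTS; apply/measurable_EFinP.
  exact: continuous_measurable_fun.
- apply: aeW => theta _; apply: cvg_EFin; first exact: nearW.
  exact: is_cvg_series_exp_coeff.
- apply/integrableP; split; first exact: measurable_cst.
  rewrite integral_cst// [X in (_ * X)%E](lebesgue_measure_cc B0).
  by rewrite /= -EFinM ltry.
- apply: aeW => theta N _; rewrite abse_EFin lee_fin.
  apply: (@le_trans _ _ (series (exp_coeff `|z|) N)).
    rewrite /partial /series/= (le_trans (ler_norm_sum _ _ _))//.
    apply: ler_sum => n _; rewrite /exp_coeff/= normrM normrX [X in _ * X <= _]ger0_norm ?invr_ge0//.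
    rewrite ler_pM2r ?invr_gt0 ?ltr0n ?fact_gt0// lerXn2r ?nnegrE//.
    by rewrite normrM ler_piMr// ler_norml cos_geN1 cos_le1.
  apply: nondecreasing_cvgn_le; last exact: is_cvg_series_exp_coeff.
  by apply: nondecreasing_series => n _ _; exact: exp_coeff_ge0.
(* Odd powers have mean 0, so along even lengths the averaged partial sums are exactly those of
   I_0. *)
have even_oo : (fun M => (2 * M)%N) @ \oo --> \oo.
  by move=> A [N _ hN]; exists N => // M /= NM; apply: hN => /=; rewrite (leq_trans NM)// leq_pmull.
have h2 := cvg_comp _ _ even_oo h.
have h3 : (B * mean (2 * M))%:E @[M --> \oo] -->
    (\int[mu]_(theta in `[0%R, B]) (expR (z * cos (k * theta)))%:E)%E.
  by move: h2; apply: cvg_trans; apply: near_eq_cvg; apply: nearW => M /=; rewrite integral_partial.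
rewrite -(cvg_lim _ h3)//; apply: cvg_lim => //.
apply: cvg_EFin; first exact: nearW.
apply: cvgM; first exact: cvg_cst.
rewrite (_ : (fun M => mean (2 * M)) =
  series (fun j => (z / 2) ^+ (2 * j + 0) / (j`! * (j + 0)`!)%:R)); last first.
  by apply/funext => M; rewrite mean_even.
exact: is_cvg_besselI0.
Qed.

End angle.
End bessel_integral.

(** * Closed forms and the bounds *)

Section closed_forms.
Context (R : realType) (b : R).
Hypothesis b0 : 0 < b.
Local Notation mu := (@lebesgue_measure R).

Let b_neq0 : b != 0.
Proof. by rewrite gt_eqF. Qed.

Let max0_ge0 (t : R) : 0 <= Num.max 0 t.
Proof. by rewrite le_max lexx. Qed.

(* [p_LL(x, t, theta) / p_L(x)] under independent blocking and in the maximally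
   correlated case, for [0 <= t <= x]; negative [t] is cut off to stay in [0, 1]. *)
Definition ratio_indep (y : plane R) : R := expR (- (b * Num.max 0 y.1)).

Definition ratio_maxcorr (y : plane R) : R :=
  expR (- (b * Num.max 0 y.1 / 2 * (1 - cos y.2))).

Lemma measurable_ratio_indep : measurable_fun setT ratio_indep.
Proof.
have mm : measurable_fun setT (fun y : plane R => Num.max 0 y.1 : R).
  by apply: measurable_maxr => //; exact: measurable_fst.
have m2 := measurable_funN (measurable_funM (measurable_cst b) mm).
exact: (measurableT_comp (@measurable_expR R) m2).
Qed.

Lemma measurable_ratio_maxcorr : measurable_fun setT ratio_maxcorr.
Proof.
have mm : measurable_fun setT (fun y : plane R => Num.max 0 y.1 : R).
  by apply: measurable_maxr => //; exact: measurable_fst.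
have mcos : measurable_fun setT (fun y : plane R => cos y.2).
  have mc : measurable_fun setT (@cos R).
    by apply: continuous_measurable_fun; exact: continuous_cos.
  exact: (measurableT_comp mc measurable_snd).
have m2 := measurable_funM (measurable_funM (measurable_cst b) mm) (measurable_cst (2^-1 : R)).
have m3 := measurable_funN (measurable_funM m2 (measurable_funB (measurable_cst (1 : R)) mcos)).
exact: (measurableT_comp (@measurable_expR R) m3).
Qed.

Lemma ratio_indep01 y : 0 <= ratio_indep y <= 1.
Proof. by rewrite expR_ge0 -expR0 ler_expR oppr_le0 mulr_ge0// ltW. Qed.

Lemma ratio_maxcorr01 y : 0 <= ratio_maxcorr y <= 1.
Proof.
rewrite expR_ge0 -expR0 ler_expR oppr_le0; apply: mulr_ge0.
  by rewrite divr_ge0// mulr_ge0// ltW.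
by rewrite subr_ge0 cos_le1.
Qed.

Lemma sector_integral_indep (a x : R) : 0 <= a -> a <= x ->
  fine (sector_integral ratio_indep a x) = 2 * pi / b ^+ 2 * (F1 b a - F1 b x).
Proof.
move=> a0 ax.
pose f (t : R) := expR (- (b * t)).
(* The derivative of F1 is - b^2 t exp (- b t). *)
pose G (t : R) := - (F1 b t / b ^+ 2).
have df (t : R) : is_derive t 1 (fun t : R => - (b * t)) (- b).
  apply: (is_derive_eq (is_deriveN (is_deriveZ b (is_derive_id t (1 : R))))).
  by rewrite /GRing.scale/= mulr1.
have dexp (t : R) : is_derive t 1 f (- b * f t).
  apply: (is_derive_eq (@is_derive1_comp R expR (fun t => - (b * t)) t _ _ (is_derive_expR _) (df t))).
  by rewrite mulrC.
have dG (t : R) : is_derive t 1 G (t * f t).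
  have dl : is_derive t 1 (fun t : R => 1 + b * t) b.
    apply: (is_derive_eq (is_deriveD (is_derive_cst (1 : R) t (1 : R))
      (is_deriveZ b (is_derive_id t (1 : R))))).
    by rewrite /GRing.scale/= add0r mulr1.
  have d1 := is_deriveN (is_deriveM (is_deriveM dl (dexp t)) (is_derive_cst ((b ^+ 2)^-1) t (1 : R))).
  apply: (is_derive_eq d1); rewrite /GRing.scale/=.
  by field.
have cf : continuous (fun t : R => t * f t).
  move=> t; apply: cvgM; first exact: cvg_id.
  by apply: differentiable_continuous; apply/derivable1_diffP; have [] := dexp t.
rewrite (@sector_integral_primitive _ _ f G)//.
- by rewrite /G/=; move: (pi) => p; field.
- exact: measurable_ratio_indep.
- by move=> y; case/andP: (ratio_indep01 y).
- move=> t t0; under eq_integral do rewrite /ratio_indep/= (max_idPr t0).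
  have pi2 : 0 <= 2 * pi :> R by rewrite mulr_ge0// pi_ge0.
  by rewrite integral_cst// [X in (_ * X)%E](lebesgue_measure_cc pi2) subr0 -EFinM mulrC.
Qed.

(** The mean of [ratio_maxcorr] over the circle of radius t; [G] is the primitive of t f(t) given by
    [is_derive_F]. *)
Let f (t : R) := expR (- (b * t / 2)) * besselI 0 (b * t / 2).
Let G (t : R) := F t b / (3 * b).

Let dG (t : R) : is_derive t 1 G (t * f t).
Proof. exact: is_derive_F. Qed.

Let cf : continuous (fun t : R => t * f t).
Proof.
have ch (t : R) : b * s / 2 @[s --> t] --> b * t / 2.
  by apply: cvgM; [apply: cvgM; [exact: cvg_cst|exact: cvg_id]|exact: cvg_cst].
move=> t; apply: cvgM; first exact: cvg_id; apply: cvgM.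
  apply: (@continuous_comp _ _ _ (fun t => - (b * t / 2)) expR); last exact: continuous_expR.
  by apply: cvgN; exact: ch.
apply: (@continuous_comp _ _ _ (fun t => b * t / 2) (besselI 0)); first exact: ch.
exact: continuous_besselI0.
Qed.

Let continuous_expR_cos (z k : R) : continuous (fun theta : R => expR (z * cos (k * theta))).
Proof.
move=> theta; apply: continuous_comp; last exact: continuous_expR.
apply: cvgM; first exact: cvg_cst.
apply: (@continuous_comp _ _ _ (fun s : R => k * s) cos); last exact: continuous_cos.
by apply: cvgM; [exact: cvg_cst|exact: cvg_id].
Qed.

Lemma sector_integral_maxcorr (a x : R) : 0 <= a -> a <= x ->
  fine (sector_integral ratio_maxcorr a x) = 3^-1 * (2 * pi / b) * (F x b - F a b).
Proof.
move=> a0 ax.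
have g0 y : 0 <= ratio_maxcorr y by case/andP: (ratio_maxcorr01 y).
have gf (t : R) : 0 <= t -> (\int[mu]_(theta in `[0%R, (2 * pi)%R])
    (ratio_maxcorr (t, theta))%:E = (2 * pi * f t)%:E)%E.
  move=> t0.
  have pi2 : 0 <= 2 * pi :> R by rewrite mulr_ge0// pi_ge0.
  have s0 : sin (1 * (2 * pi)) = 0 :> R by rewrite mul1r mulr_natl sin2pi.
  transitivity (\int[mu]_(theta in `[0%R, (2 * pi)%R])
      ((expR (- (b * t / 2)))%:E * (expR (b * t / 2 * cos (1 * theta)))%:E))%E.
    apply: eq_integral => theta _; rewrite /ratio_maxcorr/= (max_idPr t0) -EFinM -expRD.
    by congr (expR _)%:E; rewrite mul1r; ring.
  rewrite ge0_integralZl//.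
  - rewrite (integral_expR_cos (oner_neq0 _) pi2 s0) -EFinM; congr (_%:E).
    by rewrite /f mulrCA.
  - apply: measurable_funTS; apply/measurable_EFinP; apply: continuous_measurable_fun.
    exact: continuous_expR_cos.
rewrite (sector_integral_primitive a0 ax measurable_ratio_maxcorr g0 gf dG cf).
by rewrite /G/=; move: (pi) => p; field.
Qed.

(** Since sin^2 = (1 - cos (2 theta)) / 2, the integrand is t exp (- b t / 2) exp ((b t / 2) cos (2
    theta)), whose mean over [0, pi / 2] is t f(t); the factor 4 (pi / 2) restores 2 pi. *)
Lemma Rintegral_sin2 (a x : R) : 0 <= a -> a <= x ->
  4 * \int[mu]_(t in `[a, x]) \int[mu]_(theta in `[0, pi / 2])
        (t * expR (- (b * t * sin theta ^+ 2))) =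
  3^-1 * (2 * pi / b) * (F x b - F a b).
Proof.
move=> a0 ax.
have pi2 : 0 <= pi / 2 :> R by rewrite divr_ge0// pi_ge0.
have s0 : sin (2 * (pi / 2)) = 0 :> R by rewrite mulrC divfK// sinpi.
have two0 : (2 : R) != 0 by [].
transitivity (4 * (pi / 2) * (G x - G a)); last first.
  by rewrite /G; move: (pi) => p; field.
rewrite -mulrA; congr (4 * _).
have inner (t : R) : 0 <= t -> \int[mu]_(theta in `[0, pi / 2])
    (t * expR (- (b * t * sin theta ^+ 2))) = pi / 2 * (t * f t).
  move=> t0; rewrite /Rintegral.
  transitivity (fine (\int[mu]_(theta in `[0%R, (pi / 2)%R])
    ((t * expR (- (b * t / 2)))%:E * (expR (b * t / 2 * cos (2 * theta)))%:E))%E).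
    congr fine; apply: eq_integral => theta _; rewrite -EFinM; congr (_%:E).
    rewrite -[RHS]mulrA -expRD; congr (_ * expR _).
    by rewrite mulr_natl cos_mulr2n cos2sin2; field.
  rewrite ge0_integralZl//.
  - rewrite (integral_expR_cos two0 pi2 s0) -EFinM/=.
    by rewrite /f; move: (pi) => p; ring.
  - apply: measurable_funTS; apply/measurable_EFinP; apply: continuous_measurable_fun.
    exact: continuous_expR_cos.
  - by rewrite lee_fin mulr_ge0// expR_ge0.
rewrite /Rintegral.
transitivity (fine (\int[mu]_(t in `[a, x]) ((pi / 2)%:E * (t * f t)%:E))%E).
  congr fine; apply: eq_integral => t; rewrite inE/= in_itv/= => /andP[ta tx].
  by rewrite -EFinM -inner// (le_trans a0).
have mf : measurable_fun setT (fun t : R => (t * f t)%:E).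
  by apply/measurable_EFinP; exact: continuous_measurable_fun.
rewrite ge0_integralZl//.
- by rewrite (integral_is_derive ax dG cf).
- exact: measurable_funTS.
- move=> t; rewrite /= in_itv/= => /andP[ta tx]; have t0 := le_trans a0 ta.
  have pi20 : 0 < pi / 2 :> R by rewrite divr_gt0 ?pi_gt0.
  rewrite lee_fin -(pmulr_rge0 _ pi20) -inner//; apply: Rintegral_ge0 => theta _.
  by rewrite mulr_ge0// expR_ge0.
Qed.

End closed_forms.

(** * Comparison of g_L with its bounds *)

Lemma eNL_ge0 (R : realType) (lL lN : R -> R) (x : R) : 0 <= eNL lL lN x.
Proof.
(* For arbitrary functions the set may be empty; [inf] then has the default value 0. *)
rewrite /eNL; have [->|S0] := eqVneq [set y | 0 <= y /\ lN y <= lL x] set0.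
  by rewrite inf0.
by apply: lb_le_inf; [exact/set0P|move=> y []].
Qed.

Lemma gL_sector (R : realType) (d : measure_display) (Omega : measurableType d)
    (P : probability Omega R) (E : blockage_env P) (lambda : R) (e : R -> R) (x : R) :
  0 <= e x -> e x <= x -> exists g : plane R -> R,
  [/\ measurable_fun setT g, forall y, 0 <= g y <= 1,
      forall t theta, 0 <= t -> 0 <= theta <= 2 * pi ->
        pLL E x t theta = expR (- (beta E * x)) * g (t, theta)
    & gL E lambda e x = expR (- (beta E * x)) *
        expR (- (lambda * pi * e x ^+ 2) - lambda * fine (sector_integral g (e x) x))].
Proof.
move=> e0 ex; have x0 := le_trans e0 ex.
have [q [mq qE]] := pLL_measurable_ext E x0.
pose p := expR (- (beta E * x)).
have p0 : 0 < p by exact: expR_gt0.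
(* Clipping changes nothing where 0 <= p_LL <= p_L, and gives the bounds on the whole plane that the
   lemmas on sector integrals ask for. *)
pose g y := Num.min 1 (Num.max 0 (q y / p)).
have mg : measurable_fun setT g.
  apply: measurable_minr; first exact: measurable_cst.
  apply: measurable_maxr; first exact: measurable_cst.
  exact: measurable_funM.
have g01 y : 0 <= g y <= 1 by rewrite /g le_min ler01 le_max lexx ge_min lexx.
have pLLg (t theta : R) : 0 <= t -> 0 <= theta <= 2 * pi ->
    pLL E x t theta = p * g (t, theta).
  move=> t0 th; have h0 := pLL_ge0 E x t theta; have h1 := pLL_le_pL E theta x0 t0.
  rewrite pLE// -/p in h1; rewrite qE// in h0 h1 *.
  have q0 : 0 <= q (t, theta) / p by rewrite divr_ge0// ltW.
  have q1 : q (t, theta) / p <= 1 by rewrite ler_pdivrMr// mul1r.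
  by rewrite /g (max_idPr q0) (min_idPr q1) mulrC divfK// gt_eqF.
exists g; split; [exact: mg|exact: g01|exact: pLLg|].
have pLx : pL E x = p by rewrite pLE.
rewrite /gL (@gL_ofE _ lambda (pL E) (pLL E) (pLN E) e x g) ?pLx//.
- by move=> t theta /andP[t0 _] th; rewrite pLLg.
- by move=> t theta /andP[t0 _] th; rewrite pLNE// pLx.
Qed.

(** The single comparison behind the monotonicity and both bounds; the ratios need only be ordered
    on the annulus between a and x. *)
Lemma le_gL_sector (R : realType) (lambda p c : R) (g h : plane R -> R) (a x : R) :
  0 <= lambda -> 0 <= p -> 0 <= a -> a <= x ->
  measurable_fun setT g -> (forall y, 0 <= g y <= 1) ->
  measurable_fun setT h -> (forall y, 0 <= h y <= 1) ->
  (forall t theta, a <= t <= x -> 0 <= theta <= 2 * pi -> g (t, theta) <= h (t, theta)) ->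
  p * expR (c - lambda * fine (sector_integral h a x)) <=
  p * expR (c - lambda * fine (sector_integral g a x)).
Proof.
move=> l0 p0 a0 ax mg g01 mh h01 gh.
apply: (ler_wpM2l p0); rewrite ler_expR lerD2l lerN2; apply: (ler_wpM2l l0).
apply: fine_le; [exact: sector_integral_fin|exact: sector_integral_fin|].
apply: le_sector_integral => // y; first by case/andP: (g01 y).
by case/andP: (h01 y).
Qed.

Lemma gL_replaced_indep (R : realType) (lambda b : R) (e : R -> R) (x : R) :
  0 < b -> 0 <= e x -> e x <= x ->
  gL_replaced lambda b (pLL_indep b) e x = expR (- (b * x)) *
    expR (- (lambda * pi * e x ^+ 2) -
          lambda * fine (sector_integral (ratio_indep b) (e x) x)).
Proof.
move=> b0 e0 ex; rewrite /gL_replaced (@gL_ofE _ _ _ _ _ _ _ (ratio_indep b))//.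
- exact: expR_gt0.
- exact: measurable_ratio_indep.
- by move=> y; exact: ratio_indep01.
- move=> t theta /andP[t0 _] _.
  by rewrite /pLL_indep /ratio_indep/= (max_idPr t0) expRD.
Qed.

(** For t <= x the minimum is t, and - b t + b t (1 + cos theta) / 2 collapses to - (b t / 2) (1 -
    cos theta). *)
Lemma gL_replaced_maxcorr (R : realType) (lambda b : R) (e : R -> R) (x : R) :
  0 < b -> 0 <= e x -> e x <= x ->
  gL_replaced lambda b (pLL_maxcorr b) e x = expR (- (b * x)) *
    expR (- (lambda * pi * e x ^+ 2) -
          lambda * fine (sector_integral (ratio_maxcorr b) (e x) x)).
Proof.
move=> b0 e0 ex; rewrite /gL_replaced (@gL_ofE _ _ _ _ _ _ _ (ratio_maxcorr b))//.
- exact: expR_gt0.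
- exact: measurable_ratio_maxcorr.
- by move=> y; exact: ratio_maxcorr01.
- move=> t theta /andP[t0 tx] _.
  rewrite /pLL_maxcorr /ratio_maxcorr/= (max_idPr t0) (min_idPr tx) -expRD.
  by congr expR; field.
Qed.

Lemma ratio_bounds (R : realType) (b x t theta p : R) : 0 <= t ->
  expR (- (b * x) - b * t) <= expR (- (b * x)) * p <=
    expR (- (b * x) - b * t + 2^-1 * t * b * (1 + cos theta)) ->
  ratio_indep b (t, theta) <= p <= ratio_maxcorr b (t, theta).
Proof.
move=> t0; rewrite /ratio_indep /ratio_maxcorr/= (max_idPr t0).
rewrite -addrA !(expRD (- (b * x))) !(ler_pM2l (expR_gt0 _)) => /andP[-> h]/=.
suff <- : - (b * t) + 2^-1 * t * b * (1 + cos theta) = - (b * t / 2 * (1 - cos theta)) by [].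
by field.
Qed.

Section explicit_bounds.
Context (R : realType) (lambda b : R) (e : R -> R) (x : R).
Hypotheses (b0 : 0 < b) (e0 : 0 <= e x) (ex : e x <= x).

Let gL_lowerE : gL_lower lambda b e x = expR (- (b * x)) *
  expR (- (lambda * pi * e x ^+ 2) -
        lambda * (3^-1 * (2 * pi / b) * (F x b - F (e x) b))).
Proof.
rewrite /gL_lower -(Rintegral_sin2 b0 e0 ex).
have four (y : R) : 4 * lambda * y = lambda * (4 * y) by ring.
by rewrite four.
Qed.

Lemma gL_lower_besselE : gL_lower lambda b e x = gL_lower_bessel lambda b e x.
Proof.
rewrite gL_lowerE /gL_lower_bessel -expRD; congr expR.
by move: (F x b) (F (e x) b) (e x) (pi : R) => u v y p; ring.
Qed.

Lemma gL_lower_maxcorr :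
  gL_lower lambda b e x = gL_replaced lambda b (pLL_maxcorr b) e x.
Proof.
by rewrite gL_lowerE (gL_replaced_maxcorr _ b0 e0 ex) (sector_integral_maxcorr b0 e0 ex).
Qed.

Lemma gL_upper_indep : gL_upper lambda b e x = gL_replaced lambda b (pLL_indep b) e x.
Proof.
rewrite (gL_replaced_indep _ b0 e0 ex) (sector_integral_indep b0 e0 ex).
rewrite /gL_upper -expRD; congr expR.
by move: (F1 b x) (F1 b (e x)) (e x) (pi : R) => u v y p; ring.
Qed.

End explicit_bounds.

Theorem lemma7 (R : realType) (lambda : R) (hlambda : 0 < lambda)
    (lL lN : R -> R) (hlL : path_loss lL) (hlN : path_loss lN)
    (hLN : forall x : R, 0 <= x -> lN x <= lL x)
    (he : forall x : R, 0 < x -> eNL lL lN x < x)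
    (d : measure_display) (Omega : measurableType d) (P : probability Omega R)
    (E : blockage_env P) :
  (forall (d' : measure_display) (Omega' : measurableType d')
      (P' : probability Omega' R) (E' : blockage_env P'),
      beta E = beta E' ->
      (forall r1 r2 theta : R, 0 <= r1 -> 0 <= r2 -> 0 <= theta <= 2 * pi ->
         pLL E r1 r2 theta <= pLL E' r1 r2 theta) ->
      forall x : R, 0 < x ->
        gL E' lambda (eNL lL lN) x <= gL E lambda (eNL lL lN) x) /\
  (forall x : R, 0 < x ->
    [/\ gL_lower lambda (beta E) (eNL lL lN) x <= gL E lambda (eNL lL lN) x,
        gL E lambda (eNL lL lN) x <= gL_upper lambda (beta E) (eNL lL lN) x,
        gL_lower lambda (beta E) (eNL lL lN) x
          = gL_lower_bessel lambda (beta E) (eNL lL lN) x,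
        gL_upper lambda (beta E) (eNL lL lN) x
          = gL_replaced lambda (beta E) (pLL_indep (beta E)) (eNL lL lN) x
      & gL_lower lambda (beta E) (eNL lL lN) x
          = gL_replaced lambda (beta E) (pLL_maxcorr (beta E)) (eNL lL lN) x]).
Proof.
pose e := eNL lL lN.
have e0 x : 0 <= e x by exact: eNL_ge0.
have ex x : 0 < x -> e x <= x by move=> /he/ltW.
split=> [d' Omega' P' E' bE pE x x0|x x0].
  have [g [mg g01 gE ->]] := gL_sector E lambda (e0 x) (ex x x0).
  have [g' [mg' g01' gE' ->]] := gL_sector E' lambda (e0 x) (ex x x0).
  (* Equal beta gives both models the same p_L, so the order of the p_LL passes to the ratios. *)
  rewrite -bE in gE' *.
  apply: (le_gL_sector _ (ltW hlambda) (expR_ge0 _) (e0 x) (ex x x0) mg g01 mg' g01').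
  move=> t theta /andP[et _] th; have t0 := le_trans (e0 x) et.
  by have := pE x t theta (ltW x0) t0 th; rewrite gE// gE'// ler_pM2l// expR_gt0.
have b0 := beta_gt0 E.
have [g [mg g01 gE gLE]] := gL_sector E lambda (e0 x) (ex x x0).
have exx := ex x x0.
have lower_repl := gL_lower_maxcorr lambda b0 (e0 x) exx.
have upper_repl := gL_upper_indep lambda b0 (e0 x) exx.
(* Only angles and radii in the annulus matter, since the disc of radius e x contributes its area in
   every case. *)
have bounds (t theta : R) : e x <= t <= x -> 0 <= theta <= 2 * pi ->
    ratio_indep (beta E) (t, theta) <= g (t, theta) <= ratio_maxcorr (beta E) (t, theta).
  move=> /andP[et _] th; have t0 := le_trans (e0 x) et; apply: (ratio_bounds (x := x) t0).
  by rewrite -(gE _ _ t0 th); exact: (pLL_bounds E (ltW x0) t0 th).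
split.
- rewrite lower_repl (gL_replaced_maxcorr lambda b0 (e0 x) exx) gLE.
  apply: (le_gL_sector _ (ltW hlambda) (expR_ge0 _) (e0 x) exx mg g01
    (measurable_ratio_maxcorr _) (ratio_maxcorr01 b0)) => t theta tb th.
  by have /andP[] := bounds t theta tb th.
- rewrite upper_repl (gL_replaced_indep lambda b0 (e0 x) exx) gLE.
  apply: (le_gL_sector _ (ltW hlambda) (expR_ge0 _) (e0 x) exx
    (measurable_ratio_indep _) (ratio_indep01 b0) mg g01) => t theta tb th.
  by have /andP[] := bounds t theta tb th.
- exact: (gL_lower_besselE lambda b0 (e0 x) exx).
- exact: upper_repl.
- exact: lower_repl.
Qed.
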